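(* Let $\gamma$ be a $\tau$-periodic trajectory of a Lagrangian system on an $m$-dimensional manifold with Poincaré map $P:W\to W$. Suppose that $N=\operatorname{Ker}(P-I)^2$ is symplectic, $V=\operatorname{Ker}(P-I)$, $\dim V=k$, is a Lagrangian subspace in $N$, and $\dim F_t=k$ for all $t$. Suppose $\det A^\perp\ne0$. Then (a) $\widehat Y=\widehat\Omega\oplus\widehat Y^0$ and $X^\perp=\Omega^\perp\oplus\Pi Y^0$; (b) the maps $\widehat\Pi|_{\widehat\Omega}:\widehat\Omega\to\Omega^\perp$ and $\widehat\Pi|_{\widehat Y^0}:\widehat Y^0\to X_0^\perp$ are linear isomorphisms; (c) $h|_{Y^0}=h^\perp|_{X_0^\perp}\circ\Pi|_{Y^0}$ and $\hat h|_{\widehat Y^0}=h^\perp|_{X_0^\perp}\circ\widehat\Pi|_{\widehat Y^0}$; (d) for any $\xi\in Y^0$ and $\alpha,\beta=1,\dots,k$, $\ h(\hat\eta_\alpha,\xi)=0$ and $h(\hat\eta_\alpha,\hat\eta_\beta)=a_{\alpha\beta}$; (e) for any $\xi^\perp\in\Pi Y^0$ and $\alpha,\beta=1,\dots,k$, $\ h^\perp(\eta_\alpha^\perp,\xi^\perp)=0$ and $h^\perp(\eta_\alpha^\perp,\eta_\beta^\perp)=a^\perp_{\alpha\beta}$.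
   Context: Summation over repeated Greek indices from $1$ to $k$ is assumed. The Lagrangian $\mathscr{L}(x,\dot x,t)$ is smooth, $\tau$-periodic in $t$, with $\mathscr{L}_{\dot x\dot x}$ positive definite. $E_t=T_{\gamma(t)}M$, $t\in\mathbb{R}/\tau\mathbb{Z}$, with metric $(v,w)=\langle\mathscr{L}_{\dot x\dot x}(\gamma,\dot\gamma,t)v,w\rangle$; $X$ is the space of $\tau$-periodic $W^{1,2}$ fields $\xi(t)\in E_t$. The second variation of the action $\int_0^\tau\mathscr{L}dt$ at $\gamma$ is uniquely written as $h(\xi,\eta)=\int_0^\tau((D\xi,D\eta)+(U\xi,\eta))dt$ on $X$, with $D$ a covariant derivative compatible with the metric and $U(t)$ symmetric. The variational system is $D^2\xi=U\xi$; $P(\xi(0),D\xi(0))=(\xi(\tau),D\xi(\tau))$ on $W=E_0\oplus E_0$; $\omega(w,v)=(\zeta,D\xi)-(\xi,D\zeta)$, for $w,v\in W$ corresponding to solutions $\zeta,\xi$, is the invariant symplectic form. Let $w^1,\dots,w^k$ be a basis of $V$, $\zeta^1,\dots,\zeta^k$ the corresponding $\tau$-periodic solutions, $\Gamma=\operatorname{span}(\zeta^1,\dots,\zeta^k)\subset X$, $F_t=\operatorname{span}(\zeta^1(t),\dots,\zeta^k(t))$, $I^\alpha(\xi,D\xi)=(\zeta^\alpha,D\xi)-(\xi,D\zeta^\alpha)$, $I=(I^1,\dots,I^k)$; $g^{\alpha\beta}(t)=(\zeta^\alpha(t),\zeta^\beta(t))$, $(g_{\alpha\beta})=(g^{\alpha\beta})^{-1}$,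 $\bar g_{\alpha\beta}=\int_0^\tau g_{\alpha\beta}dt$, $(\kappa^{\alpha\beta})=(\bar g_{\alpha\beta})^{-1}$. Spaces: $Y=\{\xi\in X:I(\xi,D\xi)\equiv\mathrm{const}\}$, $Y^0=\{\xi\in X:I(\xi,D\xi)\equiv0\}$, $Z=\{\xi\in X:\xi(t)\in F_t\ \forall t\}$; $\widehat X=X/\Gamma$, $\widehat Y=Y/\Gamma$, $\widehat Y^0$ is the image of $Y^0$ in $\widehat X$. Since $h(\Gamma,\cdot)=0$, $h$ induces $\hat h$ on $\widehat X$; $h$ applied to elements of $\widehat Y$ means $\hat h$. $E_t^\perp$ is the orthogonal complement of $F_t$ in $E_t$, $\Pi$ the pointwise orthogonal projection onto $E_t^\perp$, $D^\perp=\Pi D$, $X^\perp=\{\eta\in X:\eta(t)\in E_t^\perp\}$, $X_0^\perp=\Pi Y^0$; $\widehat\Pi:\widehat X\to X^\perp$ is induced by $\Pi:X\to X^\perp$. On $X^\perp$ $$h^\perp(\eta,\eta)=\int_0^\tau\bigl((D^\perp\eta,D^\perp\eta)+(U\eta,\eta)-3g_{\alpha\beta}(\eta,D^\perp\zeta^\alpha)(\eta,D^\perp\zeta^\beta)\bigr)dt .$$ For a form $f$ and a linear map $\ell$, $f\circ\ell$ denotes $f(\ell\cdot,\ell\cdot)$. For $\eta\in X$ there is $\xi\in Y$, unique modulo $\Gamma$, with $\xi-\eta\in Z$; $\Phi:X\to\widehat Y$ sends $\eta$ to the class of $\xi$. Let $q_1,\dots,q_k$ be the basis in a Lagrangian complement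 of $V$ in $N$ with $\omega(w^\alpha,q_\beta)=\delta^\alpha_\beta$, $\omega(q_\alpha,q_\beta)=0$, and let $\eta_\alpha(t)$ be the corresponding (generally non-periodic) solutions of the variational system. Then $Pq_\alpha=q_\alpha+s_{\alpha\beta}w^\beta$ with $(s_{\alpha\beta})$ symmetric; $a_{\alpha\beta}=s_{\alpha\delta}\kappa^{\delta\varepsilon}s_{\varepsilon\beta}-s_{\alpha\beta}$, $a^\perp_{\alpha\beta}=s_{\alpha\beta}-\bar g_{\alpha\beta}$, $A^\perp=(a^\perp_{\alpha\beta})$. The fields $\eta_\alpha^\perp=\Pi\eta_\alpha$ are $\tau$-periodic, so $\eta_\alpha^\perp\in X^\perp$; $\hat\eta_\alpha=\Phi\eta_\alpha^\perp\in\widehat Y$, i.e. the class modulo $\Gamma$ of $\eta_\alpha-\lambda_{\alpha\beta}\zeta^\beta$, where $\lambda_{\alpha\beta}(t)$ are chosen so that this field is $\tau$-periodic and $I$ is constant on it. $\Omega^\perp=\operatorname{span}(\eta_1^\perp,\dots,\eta_k^\perp)\subset X^\perp$, $\widehat\Omega=\operatorname{span}(\hat\eta_1,\dots,\hat\eta_k)\subset\widehat Y$. *)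

(* Defs.v *)
From HB Require Import structures.
From mathcomp Require Import all_boot all_order all_algebra generic_quotient ring_quotient.
From mathcomp Require Import all_classical all_reals all_analysis.

Set Implicit Arguments.
Unset Strict Implicit.
Unset Printing Implicit Defensive.

Import Order.TTheory GRing.Theory Num.Theory.
Import numFieldNormedType.Exports.

Local Open Scope classical_set_scope.
Local Open Scope ring_scope.
Local Open Scope quotient_scope.

Section LinearAlgebra.
Context {R : nzRingType} {V : lmodType R}.

Definition spanned k (b : 'I_k -> V) : set V :=
  [set v | exists c : 'I_k -> R, v = \sum_a c a *: b a].

Definition lin_indep k (b : 'I_k -> V) : Prop :=
  forall c : 'I_k -> R, \sum_a c a *: b a = 0 -> forall a, c a = 0.

Definition is_basis (A : set V) k (b : 'I_k -> V) : Prop :=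
  lin_indep b /\ A = spanned b.

Definition has_dim (A : set V) (k : nat) : Prop :=
  exists b : 'I_k -> V, is_basis A b.

(* Intended for linear subspaces [A], [B], [C]. *)
Definition direct_sum (A B C : set V) : Prop :=
  A = [set x | exists y z, [/\ B y, C z & x = y + z]] /\ B `&` C = [set 0].

End LinearAlgebra.

Definition linear_iso {R : nzRingType} {V W : lmodType R}
    (A : set V) (B : set W) (f : V -> W) : Prop :=
  (forall (c : R) x y, A x -> A y -> f (c *: x + y) = c *: f x + f y) /\
  set_bij A B f.

Section SpanQuotient.
Context {R : nzRingType} {V : lmodType R} {k : nat} (b : 'I_k -> V).

Definition span_pred : {pred V} := fun v => `[< spanned b v >].

Lemma span_predP v : reflect (spanned b v) (v \in span_pred).
Proof. exact: asboolP. Qed.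

Lemma span_pred_submod_closed : submod_closed span_pred.
Proof.
split; first by apply/span_predP; exists (fun=> 0); rewrite big1 // => a _; rewrite scale0r.
move=> c u v /span_predP[d ->] /span_predP[e ->]; apply/span_predP.
exists (fun a => c * d a + e a); rewrite scaler_sumr -big_split /=.
by apply: eq_bigr => a _; rewrite scalerDl scalerA.
Qed.

HB.instance Definition _ :=
  GRing.isSubmodClosed.Build R V span_pred span_pred_submod_closed.

Lemma span_pred_oppr_closed : oppr_closed span_pred.
Proof. by move=> v hv; rewrite -scaleN1r rpredZ. Qed.

HB.instance Definition _ :=
  GRing.isOppClosed.Build V span_pred span_pred_oppr_closed.

Definition quot_span : Type := Quotient.quot span_pred.

HB.instance Definition _ := GRing.Zmodule.on quot_span.

Definition qclass (v : V) : quot_span := \pi_(Quotient.quot span_pred) v.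
Definition qrepr (x : quot_span) : V := repr (x : Quotient.quot span_pred).

Lemma qreprK x : qclass (qrepr x) = x.
Proof. exact: reprK. Qed.

Lemma qclassE u v : qclass u = qclass v <-> spanned b (u - v).
Proof.
split=> [/eqP e|/span_predP e]; last first.
  by apply/eqP; rewrite /qclass -Quotient.idealrBE.
by apply/span_predP; rewrite Quotient.idealrBE.
Qed.

Lemma qclassD u v : qclass (u + v) = qclass u + qclass v.
Proof. exact: Quotient.pi_add. Qed.

Definition qscale (a : R) (x : quot_span) : quot_span := qclass (a *: qrepr x).

Lemma qclassZ a v : qscale a (qclass v) = qclass (a *: v).
Proof.
apply/qclassE/span_predP; rewrite -scalerBr rpredZ //.
by apply/span_predP/qclassE/qreprK.
Qed.

Let scaleA a c x : qscale a (qscale c x) = qscale (a * c) x.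
Proof. by rewrite -(qreprK x) !qclassZ scalerA. Qed.

Let scale1 : left_id 1 qscale.
Proof. by move=> x; rewrite -(qreprK x) qclassZ scale1r. Qed.

Let scaleDr : right_distributive qscale +%R.
Proof.
move=> a x y; rewrite -(qreprK x) -(qreprK y).
by rewrite -qclassD !qclassZ -qclassD scalerDr.
Qed.

Let scaleDl x : {morph qscale^~ x : a c / a + c}.
Proof. by move=> a c; rewrite -(qreprK x) !qclassZ -qclassD scalerDl. Qed.

HB.instance Definition _ := GRing.Zmodule_isLmodule.Build R quot_span
  scaleA scale1 scaleDr scaleDl.

End SpanQuotient.

Section Smoothness.
Context {R : realType}.

Fixpoint Cn {V W : normedModType R} (n : nat) (A : set V) (f : V -> W) : Prop :=
  if n is n'.+1 then
    (forall x, A x -> differentiable f x) /\ (forall v, Cn n' A ('D_v f))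
  else forall x, A x -> {for x, continuous f}.

(* Used for open sets [A] only. *)
Definition smooth_on {V W : normedModType R} (A : set V) (f : V -> W) : Prop :=
  forall n, Cn n A f.

End Smoothness.

(* [chart i] and [chart_inv i] are only meaningful on [dom i] and on its image. *)
Record manifold (R : realType) (m : nat) := Manifold {
  mcarrier :> topologicalType;
  atlas : Type;
  dom : atlas -> set mcarrier;
  chart : atlas -> mcarrier -> 'rV[R]_m;
  chart_inv : atlas -> 'rV[R]_m -> mcarrier;
  manifold_hausdorff : hausdorff_space mcarrier;
  manifold_second_countable : @second_countable mcarrier;
  dom_cover : forall p, exists i, dom i p;
  dom_open : forall i, open (dom i);
  chart_open : forall i, open (chart i @` dom i);
  chartK : forall i p, dom i p -> chart_inv i (chart i p) = p;
  chart_continuous : forall i p, dom i p -> {for p, continuous (chart i)};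
  chart_inv_continuous : forall i x, (chart i @` dom i) x ->
    {for x, continuous (chart_inv i)};
  transition_smooth : forall i j,
    smooth_on (chart i @` (dom i `&` dom j)) (chart j \o chart_inv i)
}.

Section Tangent.
Context {R : realType} {m : nat} {M : manifold R m}.

(* A tangent vector is the family of its components in all the charts around
   its base point, extended by 0 to the other charts; the tangent space at [p]
   is a subspace of the module of all such families. *)
Definition tvec : lmodType R := atlas M -> 'rV[R]_m.

(* The tangent vector at [p] whose component in the chart [i] is [y]. *)
Definition tvec_of (i : atlas M) (p : M) (y : 'rV[R]_m) : tvec :=
  fun j => if `[< dom j p >]
           then 'D_y (chart j \o chart_inv i) (chart i p) else 0.

Definition tangent (p : M) : set tvec :=
  [set v | forall i, dom i p -> v = tvec_of i p (v i)].

Definition smooth_map {V : normedModType R} (f : V -> M) : Prop :=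
  continuous f /\ forall i, smooth_on (f @^-1` dom i) (chart i \o f).

Definition velocity (c : R -> M) (t : R) : tvec :=
  fun i => if `[< dom i (c t) >] then derive1 (chart i \o c) t else 0.

End Tangent.
Arguments tvec {R m} M.

Section Lagrangian.
Context {R : realType} {m : nat} {M : manifold R m}.
Variable L : M -> tvec M -> R -> R.

Definition local_lagrangian (i : atlas M) (x y : 'rV[R]_m) (t : R) : R :=
  L (chart_inv i x) (tvec_of i (chart_inv i x) y) t.

(* The second derivative of [L] along the fibre, applied to [u] and [w]. *)
Definition fibre_hessian (p : M) (v : tvec M) (t : R) (u w : tvec M) : R :=
  derive1 (fun r : R => derive1 (fun s : R => L p (v + r *: u + s *: w) t) 0) 0.

Definition action (tau : R) (c : R -> M) : R :=
  \int[lebesgue_measure]_(t in `[0, tau]) L (c t) (velocity c t) t.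

(* The Euler-Lagrange equations, paired with an arbitrary [v]. *)
Definition euler_lagrange (c : R -> M) : Prop :=
  forall i t (v : 'rV[R]_m), dom i (c t) ->
  let x := chart i \o c in
  derive1 (fun s => 'D_v (fun y => local_lagrangian i (x s) y s) (derive1 x s)) t =
  'D_v (fun z => local_lagrangian i z (derive1 x t) t) (x t).

End Lagrangian.

Record lagrangian_system (R : realType) (m : nat) := LagrangianSystem {
  config : manifold R m;
  lag : config -> tvec config -> R -> R;
  tau : R;
  gamma : R -> config;
  tau_gt0 : 0 < tau;
  lag_smooth : forall i, smooth_on
    [set z : 'rV[R]_m * 'rV[R]_m * R | (chart i @` dom i) z.1.1]
    (fun z => local_lagrangian lag i z.1.1 z.1.2 z.2);
  lag_periodic : forall p v t, tangent p v -> lag p v (t + tau) = lag p v t;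
  lag_convex : forall p v t u, tangent p v -> tangent p u -> u != 0 ->
    0 < fibre_hessian lag p v t u u;
  gamma_smooth : smooth_map gamma;
  gamma_periodic : forall t, gamma (t + tau) = gamma t;
  gamma_trajectory : euler_lagrange lag gamma
}.
Arguments lag {R m}.
Arguments tau {R m}.
Arguments gamma {R m}.

Section AlongGamma.
Context {R : realType} {m : nat} (S : lagrangian_system R m).
Local Notation M := (config S).
Local Notation gam := (gamma S).

Definition field : lmodType R := R -> tvec M.

Definition metric (t : R) (u v : tvec M) : R :=
  fibre_hessian (lag S) (gam t) (velocity gam t) t u v.

Definition along (xi : field) : Prop := forall t, tangent (gam t) (xi t).

Definition field_derivable (xi : field) (t : R) : Prop :=
  forall i, dom i (gam t) -> derivable (fun s : R => xi s i) t 1.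

(* The operator [D] with connection coefficients [C] in the charts; for a field
   of class W^{1,2} the value is meaningful for almost every [t]. *)
Definition cov_of (C : atlas M -> R -> 'M[R]_m) (xi : field) : field :=
  fun t i => if `[< dom i (gam t) >]
             then derive1 (fun s : R => xi s i) t + xi t i *m C i t else 0.

(* [B i t] acts on row vectors of components, hence on the right. *)
Definition endo_of (B : atlas M -> R -> 'M[R]_m) (t : R) (v : tvec M) : tvec M :=
  fun i => if `[< dom i (gam t) >] then v i *m B i t else 0.

Definition form_of (C B : atlas M -> R -> 'M[R]_m) (xi eta : field) : R :=
  \int[lebesgue_measure]_(t in `[0, tau S])
    (metric t (cov_of C xi t) (cov_of C eta t) +
     metric t (endo_of B t (xi t)) (eta t)).

(* [G (s, t)] is a smooth family, with parameter [s], of tau-periodic curves. *)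
Definition variation (G : R * R -> M) : Prop :=
  [/\ smooth_map G, forall t, G (0, t) = gam t
    & forall s t, G (s, t + tau S) = G (s, t)].

Definition variation_field (G : R * R -> M) : field :=
  fun t => velocity (fun s => G (s, t)) 0.

End AlongGamma.

(* The covariant derivative [D] and the operator [U] along [gamma], given by their
   matrices in the charts. [conn_metric], [pot_symmetric] and [second_variationE]
   determine both uniquely. Tangency and metric compatibility of [D] are stated
   pointwise, for fields differentiable at the given time. *)
Record second_variation (R : realType) (m : nat) (S : lagrangian_system R m) :=
  SecondVariation {
  conn : atlas (config S) -> R -> 'M[R]_m;
  pot : atlas (config S) -> R -> 'M[R]_m;
  conn_smooth : forall i, smooth_on (gamma S @^-1` dom i) (conn i);
  pot_smooth : forall i, smooth_on (gamma S @^-1` dom i) (pot i);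
  conn_periodic : forall i t, dom i (gamma S t) -> conn i (t + tau S) = conn i t;
  pot_periodic : forall i t, dom i (gamma S t) -> pot i (t + tau S) = pot i t;
  conn_tangent : forall (xi : field S) t, along xi -> field_derivable xi t ->
    tangent (gamma S t) (cov_of conn xi t);
  pot_tangent : forall t v, tangent (gamma S t) v ->
    tangent (gamma S t) (endo_of pot t v);
  conn_metric : forall (xi eta : field S) t, along xi -> along eta ->
    field_derivable xi t -> field_derivable eta t ->
    is_derive t (1 : R) (fun s => metric s (xi s) (eta s))
      (metric t (cov_of conn xi t) (eta t) + metric t (xi t) (cov_of conn eta t));
  pot_symmetric : forall t u v, tangent (gamma S t) u -> tangent (gamma S t) v ->
    metric t (endo_of pot t u) v = metric t u (endo_of pot t v);
  second_variationE : forall G : R * R -> config S, variation G ->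
    derive1n 2 (fun s => action (lag S) (tau S) (fun t => G (s, t))) 0 =
    form_of conn pot (variation_field G) (variation_field G)
}.

Section Variational.
Context {R : realType} {m : nat} {S : lagrangian_system R m}.
Variable B : second_variation S.

Definition D (xi : field S) : field S := cov_of (conn B) xi.
Definition U (t : R) (v : tvec (config S)) : tvec (config S) := endo_of (pot B) t v.

Definition h (xi eta : field S) : R := form_of (conn B) (pot B) xi eta.

Definition solution (xi : field S) : Prop :=
  along xi /\ forall t,
    [/\ field_derivable xi t, field_derivable (D xi) t & D (D xi) t = U t (xi t)].

(* [E_0 (+) E_0] is the subspace [Wspace] of this module. *)
Definition phase : lmodType R := (tvec (config S) * tvec (config S))%type.

Definition phase_at (xi : field S) (t : R) : phase := (xi t, D xi t).

Definition Wspace : set phase :=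
  [set w | tangent (gamma S 0) w.1 /\ tangent (gamma S 0) w.2].

(* As every element of [Wspace] is the initial value of a unique solution, this
   determines [P] on [Wspace]; its values elsewhere are not used. *)
Definition poincare_map (P : phase -> phase) : Prop :=
  forall xi, solution xi -> P (phase_at xi 0) = phase_at xi (tau S).

(* [(zeta, D xi) - (xi, D zeta)] at time 0; it does not depend on the time. *)
Definition omega (w v : phase) : R :=
  metric 0 w.1 v.2 - metric 0 v.1 w.2.

Definition kerPI (P : phase -> phase) : set phase :=
  [set w | Wspace w /\ P w - w = 0].

Definition kerPI2 (P : phase -> phase) : set phase :=
  [set w | Wspace w /\ P (P w - w) - (P w - w) = 0].

Definition symplectic_subspace (N : set phase) : Prop :=
  forall w, N w -> (forall v, N v -> omega w v = 0) -> w = 0.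

Definition lagrangian_in (N K : set phase) : Prop :=
  K = [set w | N w /\ forall v, K v -> omega w v = 0].

(* Absolutely continuous on [a, b], with square integrable derivative [rho]. *)
Definition W12_on (a b : R) (f : R -> 'rV[R]_m) : Prop :=
  exists rho : R -> 'rV[R]_m, forall j,
    [/\ measurable_fun `[a, b] (fun t => rho t 0 j),
        lebesgue_measure.-integrable `[a, b] (fun t => ((rho t 0 j) ^+ 2)%:E)
      & forall t, t \in `[a, b] ->
          f t 0 j = f a 0 j + \int[lebesgue_measure]_(s in `[a, t]) rho s 0 j].

Definition Xspace : set (field S) :=
  [set xi | [/\ along xi, forall t, xi (t + tau S) = xi t
    & forall i a b, a <= b -> (forall t, t \in `[a, b] -> dom i (gamma S t)) ->
        W12_on a b (fun t => xi t i)]].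

Section Reduction.
Context {k : nat}.
Variable zeta : 'I_k -> field S.

Definition Fspace (t : R) : set (tvec (config S)) := spanned (fun a => zeta a t).

Definition Eperp (t : R) : set (tvec (config S)) :=
  [set v | tangent (gamma S t) v /\ forall u, Fspace t u -> metric t v u = 0].

Definition I_ (a : 'I_k) (xi : field S) (t : R) : R :=
  metric t (zeta a t) (D xi t) - metric t (xi t) (D (zeta a) t).

(* Since [D xi] is only square integrable, identities in [t] involving it are
   understood almost everywhere. *)
Definition Yspace : set (field S) :=
  [set xi | Xspace xi /\ exists c : 'I_k -> R,
    forall a, {ae lebesgue_measure, forall t : R, I_ a xi t = c a}].

Definition Y0space : set (field S) :=
  [set xi | Xspace xi /\
    forall a, {ae lebesgue_measure, forall t : R, I_ a xi t = 0}].

Definition Zspace : set (field S) :=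
  [set xi | Xspace xi /\ forall t, Fspace t (xi t)].

Definition Xperp : set (field S) :=
  [set xi | Xspace xi /\ forall t, Eperp t (xi t)].

(* The orthogonal projection onto [Eperp t], for [v] in [E_t]. *)
Definition proj (t : R) (v : tvec (config S)) : tvec (config S) :=
  xget 0 [set u | Eperp t u /\ Fspace t (v - u)].

Definition Pi (xi : field S) : field S := fun t => proj t (xi t).
Definition Dperp (xi : field S) : field S := Pi (D xi).

Definition X0perp : set (field S) := Pi @` Y0space.

(* [g^{alpha beta}], [g_{alpha beta}], the integral of the latter, and kappa. *)
Definition gram (t : R) : 'M[R]_k := \matrix_(a, b) metric t (zeta a t) (zeta b t).
Definition gram_inv (t : R) : 'M[R]_k := invmx (gram t).
Definition gbar : 'M[R]_k :=
  \matrix_(a, b) \int[lebesgue_measure]_(t in `[0, tau S]) gram_inv t a b.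
Definition kappa : 'M[R]_k := invmx gbar.

(* The symmetric bilinear form of the quadratic form [h^perp]. *)
Definition hperp (xi eta : field S) : R :=
  \int[lebesgue_measure]_(t in `[0, tau S])
    (metric t (Dperp xi t) (Dperp eta t) + metric t (U t (xi t)) (eta t)
     - 3 * \sum_a \sum_b gram_inv t a b *
         metric t (xi t) (Dperp (zeta a) t) *
         metric t (eta t) (Dperp (zeta b) t)).

(* [Xhat], [Yhat] and [Y0hat] are subspaces of the quotient of all fields by
   [Gamma], the span of [zeta]. *)
Definition hat : lmodType R := quot_span zeta.
Definition Xhat : set hat := qclass zeta @` Xspace.
Definition Yhat : set hat := qclass zeta @` Yspace.
Definition Y0hat : set hat := qclass zeta @` Y0space.

(* On [Xhat] these do not depend on the representatives chosen by [qrepr]. *)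
Definition hhat (x y : hat) : R := h (qrepr x) (qrepr y).
Definition Pihat (x : hat) : field S := Pi (qrepr x).

Definition Phi (eta : field S) : hat :=
  qclass zeta (xget 0 [set xi | Yspace xi /\ Zspace (xi - eta)]).

Definition a_mx (s : 'M[R]_k) : 'M[R]_k := s *m kappa *m s - s.
Definition aperp_mx (s : 'M[R]_k) : 'M[R]_k := s - gbar.

End Reduction.
End Variational.

Arguments phase {R m} S.
Arguments Xhat {R m S k} zeta.
Arguments Yhat {R m S} B {k} zeta.
Arguments Y0hat {R m S} B {k} zeta.
Arguments hhat {R m S} B {k} zeta x y.
Arguments Pihat {R m S k} zeta x.

(* Main.v *)
(** For [xi], [xi'] in [Y] with constants [c], [c'] the integrand of [h xi xi']
    exceeds that of [hperp (Pi xi) (Pi xi')] by [g_ab c_a c'_b] and the derivative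
    of a periodic function, whence [h xi xi' = hperp (Pi xi) (Pi xi') + gbar_ab c_a c'_b].
    In particular the two forms agree on [Y0].

    A representative of [etahat_a] is [xi_a = eta_a - lambda_b zeta^b], where [lambda]
    increases by the row [s_a] over a period. The integrand of [h xi_a xi'] is the
    derivative of [(D eta_a, xi') - lambda_b ((D zeta^b, xi') + c'_b)], so
    [h xi_a xi' = - s_ab c'_b]. Integrating [lambda' = g (e_a - c_a)] over a period, where
    [c_a] is the constant of [xi_a], gives [s = (1 - C) gbar] for the matrix [C] with
    rows [c_a], that is, [C = 1 - s kappa = - A^perp kappa], which is invertible exactly
    when [A^perp] is. This yields both matrices in (d) and (e), the symmetry of [s]
    coming from that of [h]. The decompositions hold because the constant of an element
    of [Y] is a unique combination of the [c_a], and [Pi] is injective on [Y / Gamma]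
    because positivity of [gbar] forces [Y] and [Z] to meet in [Gamma]. *)

Require Import Defs.
From HB Require Import structures.
From mathcomp Require Import all_boot all_order all_algebra.
From mathcomp Require Import all_classical all_reals all_analysis measurable_realfun.
From mathcomp Require Import ring lra.

Import Order.TTheory GRing.Theory Num.Theory.
Import numFieldNormedType.Exports.

Set Implicit Arguments.
Unset Strict Implicit.
Unset Printing Implicit Defensive.

Local Open Scope classical_set_scope.
Local Open Scope ring_scope.

(** Three obstacles shape the development. A field of class W^{1,2} has a covariant derivative only
    almost everywhere, and elsewhere [D xi] is a default value; so every identity is proved at
    points of differentiability, where it is algebra, and then integrated through absolutely
    continuous primitives. One chart need not contain [gamma], so regularity of the scalar
    integrands is proved inside a chart and glued along a subdivision. [metric] is an iterated
    derivative, whose symmetry and bilinearity have to be derived from smoothness of the Lagrangian.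
    The coefficient 3 in [hperp] is 4 - 1: writing [xi = Pi xi + x_a zeta^a] and
    [p^a = (Pi xi, D zeta^a)], the Lagrangian property of V gives [I^a = - 2 p^a + g^{ab} x_b'], and
    eliminating [x'] produces the square of this 2, while replacing [D] by [Dperp] already accounts
    for one copy of [g_ab p^a p^b]. *)

Section ae_integral.
Context d (T : measurableType d) (R : realType) (mu : {measure set T -> \bar R}).
Local Open Scope ereal_scope.
Import HBNNSimple.

Lemma ge0_ae_le_integral (D : set T) (f g : T -> \bar R) :
  (forall x, D x -> 0 <= f x) -> (forall x, D x -> 0 <= g x) ->
  {ae mu, forall x, D x -> f x = g x} ->
  \int[mu]_(x in D) f x <= \int[mu]_(x in D) g x.
Proof.
move=> f0 g0 [N [mN muN0 fgN]].
have gD0 x : 0 <= (g \_ D) x by rewrite patchE; case: ifPn => // /[!inE]; exact: g0.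
rewrite !ge0_integralE//; apply: ge_ereal_sup => _ [h /= hf <-].
(* [h'] vanishes on the null set: it has the integral of [h], and lies below the restriction of [g]
   everywhere. *)
pose h' := proj_nnsfun h (measurableC mN).
have -> : sintegral mu h = sintegral mu h'.
  rewrite -!integralT_nnsfun; apply: ge0_ae_eq_integral => //=.
  - exact/measurable_EFinP.
  - by apply/measurable_EFinP/measurable_funM => //; exact: measurable_funP.
  - by move=> x _; rewrite lee_fin; exact: fun_ge0.
  - by move=> x _; rewrite lee_fin; exact: (@fun_ge0 _ _ h' x).
  - exists N; split => //; apply: subsetCl => x /= Nx _.
    by rewrite /mindic indicE mem_set// mulr1.
apply: ereal_sup_ubound; exists h' => //= x.
rewrite /mindic indicE; have [Nx|Nx] := pselect (N x).
  by rewrite memNset ?mulr0//= => /(_ Nx).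
rewrite mem_set//= mulr1 (le_trans (hf x))// !patchE; case: ifPn => // /[!inE] Dx.
by rewrite (_ : f x = g x)//; apply: contrapT => fg; apply: Nx; apply: fgN => /= /(_ Dx).
Qed.

(* No measurability is required: the integral is a supremum over simple functions, which can be cut off on a null set. *)
Lemma ae_integral (D : set T) (f g : T -> \bar R) :
  {ae mu, forall x, D x -> f x = g x} ->
  \int[mu]_(x in D) f x = \int[mu]_(x in D) g x.
Proof.
move=> fg; rewrite [LHS]integralE [RHS]integralE.
have fgp : {ae mu, forall x, D x -> f^\+ x = g^\+ x}.
  by apply: filterS fg => x fg /fg; rewrite !funeposE => ->.
have fgn : {ae mu, forall x, D x -> f^\- x = g^\- x}.
  by apply: filterS fg => x fg /fg; rewrite !funenegE => ->.
congr (_ - _); apply/eqP; rewrite eq_le; apply/andP; split.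
- exact: ge0_ae_le_integral.
- by apply: ge0_ae_le_integral => //; apply: filterS fgp => x fg' /fg'.
- exact: ge0_ae_le_integral.
- by apply: ge0_ae_le_integral => //; apply: filterS fgn => x fg' /fg'.
Qed.

End ae_integral.

(** Compactness of a segment as an induction principle: the supremum of the [x] with [P a x] cannot
    be less than [b], by the local hypothesis at that supremum. It serves for gluing over charts,
    for the product rule and for propagating uniqueness of solutions. *)
Lemma itv_ind (R : realType) (P : R -> R -> Prop) (a b : R) : a <= b ->
  (forall x y z, a <= x -> x <= y -> y <= z -> z <= b -> P x y -> P y z -> P x z) ->
  (forall x, a <= x -> x <= b -> exists2 e : R, 0 < e &
     forall y z, a <= y -> y <= z -> z <= b -> x - e < y -> z < x + e -> P y z) ->
  P a b.
Proof.
move=> ab Pt Pl.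
pose A := [set x | [/\ a <= x, x <= b & P a x]].
have Aa : A a.
  split => //; have [e e0 H] := Pl a (lexx _) ab.
  by apply: H => //; [rewrite ltrBlDr ltrDl|rewrite ltrDl].
have supA : has_sup A by split; [exists a|exists b => x []].
pose s := sup A.
have as_ : a <= s by exact: (ub_le_sup supA.2 Aa).
have sb : s <= b by apply: ge_sup; [exists a|move=> x []].
have [e e0 H] := Pl s as_ sb.
have [x [ax xb Pax] sx] := sup_adherent e0 supA.
have xs : x <= s by exact: (ub_le_sup supA.2).
(* If [s] were less than [b], [z] would exceed [s] and still satisfy [P a z]; halving [e] keeps [z]
   strictly below [s + e]. *)
pose z := Num.min b (s + e / 2).
have sz : s <= z by rewrite le_min sb lerDl divr_ge0// ltW.
have zb : z <= b by rewrite ge_min lexx.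
have zse : z < s + e by rewrite gt_min ltrD2l ltr_pdivrMr// ltr_pMr// ltr1n orbT.
have Pxz : P x z by apply: H => //; exact: le_trans sz.
have Paz : P a z by apply: (Pt a x z) => //; exact: le_trans sz.
have zs : z <= s.
  by apply: (ub_le_sup supA.2); split => //; exact: le_trans sz.
suff : z = b by move=> <-.
by move: zs; rewrite /z ge_min => /orP[bs|]; [apply/eqP; rewrite eq_le zb (le_trans bs)|
  rewrite gerDl leNgt divr_gt0].
Qed.

(** * Absolutely continuous functions *)

Section absolutely_continuous.
Context {R : realType}.
Local Notation mu := (@lebesgue_measure R).
Implicit Types (f g h r : R -> R) (a b c t : R).

Lemma ae_imp (P Q : R -> Prop) : (forall t, P t -> Q t) ->
  {ae mu, forall t, P t} -> {ae mu, forall t, Q t}.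
Proof. by move=> H; apply: (@filterS _ _ (ae_filter_ringOfSetsType mu)) => t; exact: H. Qed.

Lemma ae_imp2 (P1 P2 Q : R -> Prop) : (forall t, P1 t -> P2 t -> Q t) ->
  {ae mu, forall t, P1 t} -> {ae mu, forall t, P2 t} -> {ae mu, forall t, Q t}.
Proof. by move=> H; apply: (@filterS2 _ _ (ae_filter_ringOfSetsType mu)) => t; exact: H. Qed.

Lemma ae_imp3 (P1 P2 P3 Q : R -> Prop) : (forall t, P1 t -> P2 t -> P3 t -> Q t) ->
  {ae mu, forall t, P1 t} -> {ae mu, forall t, P2 t} -> {ae mu, forall t, P3 t} ->
  {ae mu, forall t, Q t}.
Proof. by move=> H; apply: (@filterS3 _ _ (ae_filter_ringOfSetsType mu)) => t; exact: H. Qed.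

Lemma ae_all (P : R -> Prop) : (forall t, P t) -> {ae mu, forall t, P t}.
Proof. by move=> H; apply: aeW. Qed.

Lemma ae_forall n (P : 'I_n -> R -> Prop) : (forall i, {ae mu, forall t, P i t}) ->
  {ae mu, forall t, forall i, P i t}.
Proof.
elim: n P => [|n ih] P H; first by apply: ae_all => t [].
apply: (ae_imp2 _ (H ord0) (ih (fun i => P (lift ord0 i)) (fun i => H _))) => t H0 H1 i.
by case: (unliftP ord0 i) => [j|] ->.
Qed.

Lemma itv_measurable a b : measurable (`[a, b]%classic : set (measurableTypeR R)).
Proof. by []. Qed.

Lemma itv_integrable_measurable a b f :
  mu.-integrable `[a, b] (EFin \o f) -> measurable_fun `[a, b] f.
Proof. by move=> /integrableP[H _]; apply/measurable_EFinP; exact: H. Qed.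

Lemma itv_integrableD a b f g : mu.-integrable `[a, b] (EFin \o f) ->
  mu.-integrable `[a, b] (EFin \o g) -> mu.-integrable `[a, b] (EFin \o (fun t => f t + g t)).
Proof. by move=> fi gi; exact: (integrableD (itv_measurable a b) fi gi). Qed.

Lemma itv_integrableB a b f g : mu.-integrable `[a, b] (EFin \o f) ->
  mu.-integrable `[a, b] (EFin \o g) -> mu.-integrable `[a, b] (EFin \o (fun t => f t - g t)).
Proof. by move=> fi gi; exact: (integrableB (itv_measurable a b) fi gi). Qed.

Lemma itv_integrableZ a b c f : mu.-integrable `[a, b] (EFin \o f) ->
  mu.-integrable `[a, b] (EFin \o (fun t => c * f t)).
Proof. by move=> fi; exact: (integrableZl (itv_measurable a b) c fi). Qed.

Lemma itv_integrable_le a b f g : measurable_fun `[a, b] f ->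
  (forall t, t \in `[a, b] -> `|f t| <= g t) ->
  mu.-integrable `[a, b] (EFin \o g) -> mu.-integrable `[a, b] (EFin \o f).
Proof.
move=> mf fg gi; apply: le_integrable gi => //; first by apply/measurable_EFinP; exact: mf.
by move=> t tab /=; rewrite lee_fin (le_trans (fg t tab))// ler_norm.
Qed.

Lemma itv_integrable_cst a b c : mu.-integrable `[a, b] (EFin \o (cst c)).
Proof.
by apply: continuous_compact_integrable; [exact: segment_compact|
  apply: continuous_subspaceT => x; exact: cvg_cst].
Qed.

Lemma itv_Rintegral_cst0 a b : \int[mu]_(t in `[a, b]) (cst 0 : R -> R) t = 0.
Proof. by rewrite Rintegral_cst// mul0r. Qed.

(** The integrands contain [D xi], which has default values where [xi] is not differentiable, so
    membership here and in [L2] is only up to a null set; [ae_Rintegral] carries integrals over to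
    the good representative. *)
Definition L1 a b f := exists2 g : R -> R, mu.-integrable `[a, b] (EFin \o g) &
  {ae mu, forall t, t \in `[a, b] -> f t = g t}.

Definition L2 a b f := exists g : R -> R, [/\ measurable_fun `[a, b] g,
  mu.-integrable `[a, b] (EFin \o (fun t => g t ^+ 2)) &
  {ae mu, forall t, t \in `[a, b] -> f t = g t}].

(** The conditions that [W12_on] puts on one coordinate, so that membership in X translates
    coordinate by coordinate. *)
Definition H1_deriv a b f r := [/\ measurable_fun `[a, b] r,
  mu.-integrable `[a, b] (EFin \o (fun t => r t ^+ 2)) &
  forall t, t \in `[a, b] -> f t = f a + \int[mu]_(s in `[a, t]) r s].

Definition H1 a b f := exists r : R -> R, H1_deriv a b f r.

Lemma ler_sqr_norml (x K : R) : `|x| <= K -> x ^+ 2 <= K ^+ 2.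
Proof. by rewrite ler_norml => /andP[x1 x2]; nra. Qed.

Lemma ae_set1 a : {ae mu, forall t, t != a}.
Proof.
exists [set a]; split => //; first by rewrite lebesgue_measure_set1.
by move=> t /= /negP; rewrite negbK => /eqP.
Qed.

Lemma ae_itv_oo a b (P : R -> Prop) :
  {ae mu, forall t, t \in `]a, b[ -> P t} -> {ae mu, forall t, t \in `[a, b] -> P t}.
Proof.
move=> H; apply: (ae_imp3 _ (ae_set1 a) (ae_set1 b) H) => t ta tb {}H.
by rewrite in_itv/= => /andP[at_ tb']; apply: H; rewrite in_itv/= !lt_neqAle eq_sym ta tb at_ tb'.
Qed.

Lemma ae_Rintegral a b f g : {ae mu, forall t, t \in `[a, b] -> f t = g t} ->
  \int[mu]_(t in `[a, b]) f t = \int[mu]_(t in `[a, b]) g t.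
Proof.
move=> fg; congr fine; apply: ae_integral.
by apply: (ae_imp _ fg) => t {}fg /= tab; rewrite fg.
Qed.

Lemma itv_sub a b c d : a <= c -> d <= b -> `[c, d]%classic `<=` `[a, b]%classic.
Proof.
move=> ac db t /=; rewrite !in_itv/= => /andP[ct td].
by rewrite (le_trans ac ct) (le_trans td db).
Qed.

Lemma integrable_itv_sub a b c d f : a <= c -> d <= b ->
  mu.-integrable `[a, b] (EFin \o f) -> mu.-integrable `[c, d] (EFin \o f).
Proof. by move=> ac db; apply: integrableS => //; exact: itv_sub. Qed.

Lemma Rintegral_itv_cat a b c f : a <= b -> b <= c ->
  mu.-integrable `[a, c] (EFin \o f) ->
  \int[mu]_(t in `[a, c]) f t = \int[mu]_(t in `[a, b]) f t + \int[mu]_(t in `[b, c]) f t.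
Proof.
move=> ab bc fi; have := @Rintegral_itvB _ f (BLeft a) (BRight c) b fi.
rewrite !bnd_simp => /(_ ab bc) E; apply/eqP; rewrite addrC -subr_eq E Rintegral_itv_obnd_cbnd//.
by apply: integrableS fi => // t /=; rewrite !in_itv/= => /andP[bt ->]; rewrite (le_trans ab (ltW bt)).
Qed.

Lemma itv_itvU a b c : a <= b -> b <= c -> `[a, c]%classic = `[a, b] `|` `]b, c] :> set R.
Proof. by move=> ab bc; rewrite -itv_bndbnd_setU//= bnd_simp. Qed.

Lemma within_bounded a b h : {within `[a, b], continuous h} ->
  exists K : R, 0 <= K /\ forall t, t \in `[a, b] -> `|h t| <= K.
Proof.
move=> hc; have /compact_bounded[M [_ HM]] := continuous_compact hc (@segment_compact _ a b).
exists (`|M| + 1); split => [|t tab]; first by rewrite addr_ge0.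
apply: HM; last by exists t.
by rewrite (le_lt_trans (ler_norm _))// ltrDl.
Qed.

Lemma within_measurable a b h : {within `[a, b], continuous h} -> measurable_fun `[a, b] h.
Proof. exact: subspace_continuous_measurable_fun. Qed.

Lemma within_itv_sub a b c d h : a <= c -> d <= b ->
  {within `[a, b], continuous h} -> {within `[c, d], continuous h}.
Proof. by move=> ac db; apply: continuous_subspaceW; exact: itv_sub. Qed.

Lemma sqr_integrable_integrable a b g : measurable_fun `[a, b] g ->
  mu.-integrable `[a, b] (EFin \o (fun t => g t ^+ 2)) -> mu.-integrable `[a, b] (EFin \o g).
Proof.
move=> mg g2; apply: (itv_integrable_le mg _ (itv_integrableD (itv_integrable_cst a b 1) g2)).
by move=> t _ /=; rewrite -real_normK ?num_real; have := normr_ge0 (g t); nra.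
Qed.

Lemma integrable_itvMcont a b h f : {within `[a, b], continuous h} ->
  mu.-integrable `[a, b] (EFin \o f) -> mu.-integrable `[a, b] (EFin \o (fun t => h t * f t)).
Proof.
move=> hc fi; have [K [K0 HK]] := within_bounded hc.
apply: (itv_integrable_le _ _ (itv_integrableZ K (integrable_norm fi))).
  apply: measurable_funM; first exact: within_measurable.
  exact: itv_integrable_measurable.
by move=> t tab /=; rewrite normrM ler_wpM2r// HK.
Qed.

Lemma L1_ae a b f g : {ae mu, forall t, t \in `[a, b] -> f t = g t} -> L1 a b f -> L1 a b g.
Proof.
move=> fg [k ki fk]; exists k => //; apply: (ae_imp2 _ fg fk) => t {}fg {}fk tab.
by rewrite -fg// fk.
Qed.

Lemma L2_ae a b f g : {ae mu, forall t, t \in `[a, b] -> f t = g t} -> L2 a b f -> L2 a b g.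
Proof.
move=> fg [k [mk ki fk]]; exists k; split => //; apply: (ae_imp2 _ fg fk) => t {}fg {}fk tab.
by rewrite -fg// fk.
Qed.

Lemma L2_L1 a b f : L2 a b f -> L1 a b f.
Proof. by move=> [g [mg gi fg]]; exists g => //; exact: sqr_integrable_integrable. Qed.

Lemma L1D a b f g : L1 a b f -> L1 a b g -> L1 a b (fun t => f t + g t).
Proof.
move=> [k ki fk] [l li gl]; exists (fun t => k t + l t).
  exact: (itv_integrableD ki li).
by apply: (ae_imp2 _ fk gl) => t {}fk {}gl tab; rewrite fk// gl.
Qed.

Lemma L1Z a b c f : L1 a b f -> L1 a b (fun t => c * f t).
Proof.
move=> [k ki fk]; exists (fun t => c * k t).
  exact: itv_integrableZ.
by apply: (ae_imp _ fk) => t {}fk tab; rewrite fk.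
Qed.

Lemma L1_sum a b n (f : 'I_n -> R -> R) :
  (forall i, L1 a b (f i)) -> L1 a b (fun t => \sum_i f i t).
Proof.
move=> fi; elim: n f fi => [|n ih] f fi.
  exists (cst 0); last by apply: ae_all => t _; rewrite big_ord0.
  exact: itv_integrable_cst.
have := L1D (ih (fun i => f (lift ord0 i)) (fun i => fi _)) (fi ord0).
by apply: L1_ae; apply: ae_all => t _; rewrite big_ord_recl addrC.
Qed.

Lemma L1_RintegralD a b f g : L1 a b f -> L1 a b g ->
  \int[mu]_(t in `[a, b]) (f t + g t) = \int[mu]_(t in `[a, b]) f t + \int[mu]_(t in `[a, b]) g t.
Proof.
move=> [k ki fk] [l li gl]; rewrite (ae_Rintegral fk) (ae_Rintegral gl) -RintegralD//.
by apply: ae_Rintegral; apply: (ae_imp2 _ fk gl) => t {}fk {}gl tab; rewrite fk// gl.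
Qed.

Lemma L1_RintegralZ a b c f : L1 a b f ->
  \int[mu]_(t in `[a, b]) (c * f t) = c * \int[mu]_(t in `[a, b]) f t.
Proof.
move=> [k ki fk]; rewrite (ae_Rintegral fk) -RintegralZl//.
by apply: ae_Rintegral; apply: (ae_imp _ fk) => t {}fk tab; rewrite fk.
Qed.

Lemma L1_Rintegral_sum a b n (f : 'I_n -> R -> R) : (forall i, L1 a b (f i)) ->
  \int[mu]_(t in `[a, b]) (\sum_i f i t) = \sum_i \int[mu]_(t in `[a, b]) f i t.
Proof.
elim: n f => [|n ih] f fi.
  rewrite big_ord0; under eq_Rintegral do rewrite big_ord0.
  by rewrite Rintegral_cst// mul0r.
under eq_Rintegral do rewrite big_ord_recl.
rewrite L1_RintegralD//; last by apply: L1_sum => i; exact: fi.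
by rewrite big_ord_recl ih.
Qed.

Lemma L2D a b f g : L2 a b f -> L2 a b g -> L2 a b (fun t => f t + g t).
Proof.
move=> [k [mk ki fk]] [l [ml li gl]]; exists (fun t => k t + l t); split.
- exact: measurable_funD.
- apply: (itv_integrable_le _ _ (itv_integrableD (itv_integrableZ 2 ki) (itv_integrableZ 2 li))).
    by apply: measurable_funX; exact: measurable_funD.
  by move=> t _ /=; rewrite ger0_norm ?sqr_ge0//; have := sqr_ge0 (k t - l t); nra.
- by apply: (ae_imp2 _ fk gl) => t {}fk {}gl tab; rewrite fk// gl.
Qed.

Lemma L2_sum a b n (f : 'I_n -> R -> R) :
  (forall i, L2 a b (f i)) -> L2 a b (fun t => \sum_i f i t).
Proof.
move=> fi; elim: n f fi => [|n ih] f fi.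
  exists (cst 0); split => //; last by apply: ae_all => t _; rewrite big_ord0.
  by apply: eq_integrable (itv_integrable_cst a b 0) => // t _ /=; rewrite expr0n.
have := L2D (ih (fun i => f (lift ord0 i)) (fun i => fi _)) (fi ord0).
by apply: L2_ae; apply: ae_all => t _; rewrite big_ord_recl addrC.
Qed.

Lemma L2Mcont a b h f : {within `[a, b], continuous h} -> L2 a b f -> L2 a b (fun t => h t * f t).
Proof.
move=> hc [k [mk ki fk]]; exists (fun t => h t * k t); split.
- by apply: measurable_funM => //; exact: within_measurable.
- have [K [K0 HK]] := within_bounded hc.
  apply: (itv_integrable_le _ _ (itv_integrableZ (K ^+ 2) ki)).
    by apply/measurable_funX/measurable_funM => //; exact: within_measurable.
  move=> t tab /=; rewrite ger0_norm ?sqr_ge0// exprMn ler_wpM2r ?sqr_ge0//.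
  by apply: ler_sqr_norml; exact: HK.
- by apply: (ae_imp _ fk) => t {}fk tab; rewrite fk.
Qed.

Lemma L2_cont a b h : {within `[a, b], continuous h} -> L2 a b h.
Proof.
move=> hc; have L21 : L2 a b (cst 1).
  exists (cst 1); split => //; last by apply: ae_all.
  by apply: eq_integrable (itv_integrable_cst a b 1) => // t _ /=; rewrite expr1n.
by apply: L2_ae (L2Mcont hc L21); apply: ae_all => t _; rewrite mulr1.
Qed.

Lemma L1_cont a b h : {within `[a, b], continuous h} -> L1 a b h.
Proof. by move=> /L2_cont/L2_L1. Qed.

Lemma L2M a b f g : L2 a b f -> L2 a b g -> L1 a b (fun t => f t * g t).
Proof.
move=> [k [mk ki fk]] [l [ml li gl]]; exists (fun t => k t * l t).
  apply: (itv_integrable_le _ _ (itv_integrableD ki li)); first exact: measurable_funM.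
  by move=> t _ /=; rewrite ler_norml; have := sqr_ge0 (k t - l t); have := sqr_ge0 (k t + l t); nra.
by apply: (ae_imp2 _ fk gl) => t {}fk {}gl tab; rewrite fk// gl.
Qed.

Lemma L1Mcont a b h f : {within `[a, b], continuous h} -> L1 a b f -> L1 a b (fun t => h t * f t).
Proof.
move=> hc [k ki fk]; exists (fun t => h t * k t).
  exact: integrable_itvMcont.
by apply: (ae_imp _ fk) => t {}fk tab; rewrite fk.
Qed.

Lemma itv_paste_integrable a b c f g : a <= b -> b <= c ->
  mu.-integrable `[a, b] (EFin \o f) -> mu.-integrable `[b, c] (EFin \o g) ->
  mu.-integrable `[a, c] (EFin \o (fun t => if t <= b then f t else g t)).
Proof.
move=> ab bc fi gi.
have E1 : `[a, c]%classic `&` `[a, b]%classic = `[a, b]%classic :> set R.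
  by rewrite setIC; apply/setIidl; exact: (itv_sub (lexx _) bc).
have E2 : `[a, c]%classic `&` `]b, c]%classic = `]b, c]%classic :> set R.
  rewrite setIC; apply/setIidl => t /=; rewrite !in_itv/= => /andP[bt ->].
  by rewrite (le_trans ab (ltW bt)).
have gi' : mu.-integrable `]b, c] (EFin \o g).
  by apply: integrableS gi => // t /=; rewrite !in_itv/= => /andP[/ltW -> ->].
have f1 : mu.-integrable `[a, c] (EFin \o (f \_ `[a, b])).
  by rewrite -restrict_EFin; apply/integrable_restrict => //; rewrite E1.
have g1 : mu.-integrable `[a, c] (EFin \o (g \_ `]b, c])).
  by rewrite -restrict_EFin; apply/integrable_restrict => //; rewrite E2.
apply: eq_integrable (itv_integrableD f1 g1) => //= t; rewrite inE/= in_itv/= => /andP[at_ tc].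
rewrite !patchE; have [tb|bt] := leP t b.
  rewrite mem_set/= ?in_itv/= ?at_// memNset ?addr0//= in_itv/=.
  by move=> /andP[]; rewrite ltNge tb.
rewrite memNset/=; last by rewrite in_itv/= at_ leNgt bt.
by rewrite mem_set ?add0r//= in_itv/= bt.
Qed.

Lemma itv_paste_measurable a b c f g : a <= b -> b <= c ->
  measurable_fun `[a, b] f -> measurable_fun `[b, c] g ->
  measurable_fun `[a, c] (fun t => if t <= b then f t else g t).
Proof.
move=> ab bc mf mg; rewrite (itv_itvU ab bc); apply/measurable_funU => //; split.
  by apply: eq_measurable_fun mf => t; rewrite inE/= in_itv/= => /andP[_ ->].
have mg' : measurable_fun `]b, c] g.
  by apply: measurable_funS mg => // t /=; rewrite !in_itv/= => /andP[/ltW -> ->].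
by apply: eq_measurable_fun mg' => t; rewrite inE/= in_itv/= => /andP[]; rewrite ltNge => /negbTE ->.
Qed.

Lemma itv_paste_sqr a b c (k l : R -> R) : a <= b -> b <= c ->
  mu.-integrable `[a, b] (EFin \o (fun t => k t ^+ 2)) ->
  mu.-integrable `[b, c] (EFin \o (fun t => l t ^+ 2)) ->
  mu.-integrable `[a, c] (EFin \o (fun t => (if t <= b then k t else l t) ^+ 2)).
Proof.
move=> ab bc k2 l2; apply: eq_integrable (itv_paste_integrable ab bc k2 l2) => //= t _.
by case: ifP.
Qed.

Lemma L1_cat a b c f : a <= b -> b <= c -> L1 a b f -> L1 b c f -> L1 a c f.
Proof.
move=> ab bc [k ki fk] [l li fl]; exists (fun t => if t <= b then k t else l t).
  exact: itv_paste_integrable.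
apply: (ae_imp2 _ fk fl) => t {}fk {}fl; rewrite in_itv/= => /andP[at_ tc].
by case: (leP t b) => tb; [rewrite fk// in_itv/= at_|rewrite fl// in_itv/= tc ltW].
Qed.

Lemma L2_cat a b c f : a <= b -> b <= c -> L2 a b f -> L2 b c f -> L2 a c f.
Proof.
move=> ab bc [k [mk ki fk]] [l [ml li fl]]; exists (fun t => if t <= b then k t else l t).
have m := itv_paste_measurable ab bc mk ml; have i := itv_paste_sqr ab bc ki li; split => //.
apply: (ae_imp2 _ fk fl) => t {}fk {}fl; rewrite in_itv/= => /andP[at_ tc].
by case: (leP t b) => tb; [rewrite fk// in_itv/= at_|rewrite fl// in_itv/= tc ltW].
Qed.

Lemma H1_deriv_integrable a b f r : H1_deriv a b f r -> mu.-integrable `[a, b] (EFin \o r).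
Proof. by move=> [mr ri _]; exact: sqr_integrable_integrable. Qed.

Lemma H1_deriv_incr a b f r s t : H1_deriv a b f r -> a <= s -> s <= t -> t <= b ->
  f t - f s = \int[mu]_(x in `[s, t]) r x.
Proof.
move=> fr as_ st tb; have ri := H1_deriv_integrable fr; have [_ _ H] := fr.
rewrite (H t) ?in_itv/= ?(le_trans as_ st)// (H s) ?in_itv/= ?as_ ?(le_trans st tb)//.
rewrite (@Rintegral_itv_cat a s t)//; first by ring.
exact: (integrable_itv_sub (lexx _) tb ri).
Qed.

Lemma H1_cat a b c f : a <= b -> b <= c -> H1 a b f -> H1 b c f -> H1 a c f.
Proof.
move=> ab bc [k [mk ki fk]] [l [ml li fl]]; exists (fun t => if t <= b then k t else l t).
have m := itv_paste_measurable ab bc mk ml; have i := itv_paste_sqr ab bc ki li; split => //.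
have Ek t : t <= b -> \int[mu]_(s in `[a, t]) (if s <= b then k s else l s) = \int[mu]_(s in `[a, t]) k s.
  move=> tb; apply: eq_Rintegral => s; rewrite inE/= in_itv/= => /andP[_ st].
  by rewrite (le_trans st tb).
(* At [b] itself the pasted density has the value of [k] instead of [l]; a single point does not
   affect the integral. *)
have El t : b <= t -> \int[mu]_(s in `[b, t]) (if s <= b then k s else l s) = \int[mu]_(s in `[b, t]) l s.
  move=> bt; apply: ae_Rintegral; apply: (ae_imp _ (ae_set1 b)) => s sb.
  by rewrite in_itv/= => /andP[bs st]; rewrite leNgt lt_neqAle eq_sym sb bs.
move=> t; rewrite in_itv/= => /andP[at_ tc]; have [tb|/ltW bt] := leP t b.
  by rewrite Ek// -fk// in_itv/= at_.
rewrite (@Rintegral_itv_cat a b t)//; last first.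
  by apply: (integrable_itv_sub (lexx _) tc); exact: sqr_integrable_integrable.
have bab : b \in `[a, b] by rewrite in_itv/= ab lexx.
have tbc : t \in `[b, c] by rewrite in_itv/= bt.
by rewrite Ek// El// addrA -(fk _ bab) (fl _ tbc).
Qed.

Lemma H1_deriv_cont a b f r : a <= b -> H1_deriv a b f r -> {within `[a, b], continuous f}.
Proof.
move=> ab fr; have ri := H1_deriv_integrable fr; have [_ _ H] := fr.
have /subspace_continuousP C := parameterized_integral_continuous ab ri.
apply/subspace_continuousP => x xab.
have : (fun y => f a + parameterized_integral mu a y r) z @[z --> within `[a, b] (nbhs x)] --> f x.
  by rewrite (H x xab); apply: cvgD; [exact: cvg_cst|exact: C].
apply: cvg_trans; apply: near_eq_cvg; near=> y.
have yab : y \in `[a, b] by near: y; exact: withinT.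
by rewrite /from_subspace/= (H y yab).
Unshelve. all: by end_near.
Qed.

Lemma H1_cont a b f : a <= b -> H1 a b f -> {within `[a, b], continuous f}.
Proof. by move=> ab [r /(H1_deriv_cont ab)]. Qed.

(** Almost every point is a Lebesgue point of the density, and there the indefinite integral is
    differentiable. *)
Lemma H1_ae_deriv a b f r : H1_deriv a b f r ->
  {ae mu, forall t, t \in `]a, b[ -> is_derive t 1 f (r t)}.
Proof.
move=> fr; have ri := H1_deriv_integrable fr; have [_ _ H] := fr.
pose g := r \_ `[a, b].
have gi : mu.-integrable `[a, b] (EFin \o g).
  by rewrite -restrict_EFin; apply/integrable_restrict => //=; rewrite setIid.
have := lebesgue_differentiation (integrable_locally (itv_measurable a b) ri).
apply: ae_imp => t gt; rewrite in_itv/= => /andP[at_ tb].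
have at' : (BLeft a < BRight t)%E by first [exact: ltW | rewrite bnd_simp ltW | exact: at_].
have [] := @FTC1_lebesgue_pt _ g (BLeft a) t b tb gi at' gt.
set F := (fun y => _) => Fd; rewrite derive1E => FE.
have Ft : is_derive t 1 F (r t).
  apply: DeriveDef => //; rewrite FE /g patchE mem_set//= in_itv/=.
  by rewrite !ltW.
have : is_derive t 1 (fun y => f a + F y) (r t).
  by rewrite -[r t]add0r; apply: is_deriveD.
apply: near_eq_is_derive.
have : \forall y \near t, y \in `]a, b[ by apply: near_in_itvoo; rewrite in_itv/= at_.
apply: filterS => y; rewrite in_itv/= => /andP[ay yb].
rewrite (H y) ?in_itv/= ?ltW//; congr (_ + _); apply: eq_Rintegral => s.
rewrite inE/= in_itv/= => /andP[as_ sy]; rewrite /g patchE mem_set//= in_itv/= as_.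
exact: le_trans sy (ltW yb).
Qed.

Lemma H1_ae_derivable a b f : H1 a b f ->
  {ae mu, forall t, t \in `]a, b[ -> derivable f t 1}.
Proof.
by move=> [r /H1_ae_deriv]; apply: ae_imp => t H /H Hd; exact: ex_derive.
Qed.

Lemma H1_deriv_L2 a b f r g : H1_deriv a b f r ->
  {ae mu, forall t, t \in `]a, b[ -> is_derive t 1 f (g t)} ->
  {ae mu, forall t, t \in `[a, b] -> r t = g t}.
Proof.
move=> fr fg; apply: ae_itv_oo; apply: (ae_imp2 _ fg (H1_ae_deriv fr)) => t H1 H2 tab.
by rewrite -(@derive_val _ _ _ _ _ _ _ (H1 tab)) -(@derive_val _ _ _ _ _ _ _ (H2 tab)).
Qed.

Lemma H1_L2 a b f g : H1 a b f -> {ae mu, forall t, t \in `]a, b[ -> is_derive t 1 f (g t)} ->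
  L2 a b g.
Proof.
move=> [r fr] fg; have rg := H1_deriv_L2 fr fg; have [mr ri _] := fr.
by exists r; split => //; apply: (ae_imp _ rg) => t {}H /H ->.
Qed.

Lemma H1_FTC a b f g : a <= b -> H1 a b f ->
  {ae mu, forall t, t \in `]a, b[ -> is_derive t 1 f (g t)} ->
  \int[mu]_(t in `[a, b]) g t = f b - f a.
Proof.
move=> ab [r fr] fg; rewrite -(ae_Rintegral (H1_deriv_L2 fr fg)).
by rewrite (H1_deriv_incr fr).
Qed.

Lemma H1_cst a b c : H1 a b (cst c).
Proof.
exists (cst 0); split => //; first by apply: eq_integrable (itv_integrable_cst a b 0) => // t _ /=; rewrite expr0n.
by move=> t _; rewrite Rintegral_cst// mul0r addr0.
Qed.

Lemma H1D a b f g : H1 a b f -> H1 a b g -> H1 a b (fun t => f t + g t).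
Proof.
move=> [k fk] [l gl]; exists (fun t => k t + l t).
have ki := H1_deriv_integrable fk; have li := H1_deriv_integrable gl.
have [mk k2 Hk] := fk; have [ml l2 Hl] := gl.
split; first exact: measurable_funD.
- apply: (itv_integrable_le _ _ (itv_integrableD (itv_integrableZ 2 k2) (itv_integrableZ 2 l2))).
    by apply: measurable_funX; exact: measurable_funD.
  by move=> t _ /=; rewrite ger0_norm ?sqr_ge0//; have := sqr_ge0 (k t - l t); nra.
move=> t tab; rewrite Hk// Hl//; move: tab; rewrite in_itv/= => /andP[at_ tb].
rewrite RintegralD//; first by ring.
  exact: (integrable_itv_sub (lexx _) tb).
exact: (integrable_itv_sub (lexx _) tb).
Qed.

Lemma within_dist a b f x (e : R) : {within `[a, b], continuous f} -> x \in `[a, b] -> 0 < e ->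
  exists2 d : R, 0 < d & forall y, y \in `[a, b] -> `|y - x| < d -> `|f y - f x| < e.
Proof.
move=> /subspace_continuousP C xab e0; have := C x xab.
move=> /cvgrPdist_lt /(_ e e0) [d /= d0 Hd]; exists d => // y yab yx.
by rewrite distrC; apply: Hd => //=; rewrite distrC.
Qed.

(* On a short interval [s, t], [f t g t - f s g s] is the integral of [f s g' + g t f'];
   replacing [f s] and [g t] by [f] and [g] costs at most a small multiple of the
   integral of [|f'| + |g'|], and these errors add up. *)
Lemma H1M a b f g : H1 a b f -> H1 a b g -> H1 a b (fun t => f t * g t).
Proof.
have [ab|ba] := leP a b; last first.
  move=> _ _; exists (cst 0); split => //.
    by apply: eq_integrable (itv_integrable_cst a b 0) => // t _ /=; rewrite expr0n.
  by move=> t; rewrite in_itv/= => /andP[at_ tb]; have := le_trans at_ tb; rewrite leNgt ba.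
move=> [r fr] [q gq].
have ri := H1_deriv_integrable fr; have qi := H1_deriv_integrable gq.
have fc := H1_deriv_cont ab fr; have gc := H1_deriv_cont ab gq.
pose w t := f t * q t + g t * r t.
have fqL : L2 a b q by case: gq => mq q2 _; exists q; split => //; apply: ae_all.
have grL : L2 a b r by case: fr => mr r2 _; exists r; split => //; apply: ae_all.
have wi : mu.-integrable `[a, b] (EFin \o w).
  exact: (itv_integrableD (integrable_itvMcont fc qi) (integrable_itvMcont gc ri)).
have mw := itv_integrable_measurable wi.
pose G s t := f t * g t - f s * g s - \int[mu]_(x in `[s, t]) w x.
pose E s t := \int[mu]_(x in `[s, t]) (`|q x| + `|r x|).
have Ei : mu.-integrable `[a, b] (EFin \o (fun x => `|q x| + `|r x|)).
  by apply: itv_integrableD; exact: integrable_norm.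
have GE e t : 0 < e -> a <= t -> t <= b -> `|G a t| <= e * E a t.
  move=> e0 at_ tb; apply: (@itv_ind R (fun s t => `|G s t| <= e * E s t)) => //.
    move=> x y z ax xy yz zt Hxy Hyz.
    have xb : z <= b by exact: le_trans tb.
    have -> : E x z = E x y + E y z.
      by apply: Rintegral_itv_cat => //; exact: (integrable_itv_sub ax xb Ei).
    have -> : G x z = G x y + G y z.
      rewrite /G (@Rintegral_itv_cat x y z)//; first by ring.
      exact: (integrable_itv_sub ax xb wi).
    by rewrite mulrDr (le_trans (ler_normD _ _))// lerD.
  move=> x ax xt; have xab : x \in `[a, b] by rewrite in_itv/= ax (le_trans xt tb).
  have e20 : 0 < e / 2 by rewrite divr_gt0.
  have [d1 d10 H1] := within_dist fc xab e20.
  have [d2 d20 H2] := within_dist gc xab e20.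
  exists (Num.min d1 d2); first by rewrite lt_min d10.
  move=> y z ay yz zt; rewrite ltrBlDr -ltrBlDl lt_min => /andP[xy1 xy2].
  rewrite -ltrBlDl lt_min => /andP[zx1 zx2].
  have zb : z <= b by exact: le_trans tb.
  have Hf u : u \in `[y, z] -> `|f y - f u| <= e.
    rewrite in_itv/= => /andP[yu uz].
    have [ua ub] : a <= u /\ u <= b by split; [exact: le_trans yu|exact: le_trans zb].
    have := H1 y; have := H1 u; rewrite !in_itv/= ua ub ay (le_trans yz zb)/= => /(_ isT) Hu /(_ isT) Hy.
    have {}Hu : `|f u - f x| < e / 2 by apply: Hu; rewrite ltr_norml; lra.
    have {}Hy : `|f y - f x| < e / 2 by apply: Hy; rewrite ltr_norml; lra.
    by move: Hu Hy; rewrite !ltr_norml ler_norml; lra.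
  have Hg u : u \in `[y, z] -> `|g z - g u| <= e.
    rewrite in_itv/= => /andP[yu uz].
    have [ua ub] : a <= u /\ u <= b by split; [exact: le_trans yu|exact: le_trans zb].
    have := H2 z; have := H2 u; rewrite !in_itv/= ua ub (le_trans ay yz) zb/= => /(_ isT) Hu /(_ isT) Hz.
    have {}Hu : `|g u - g x| < e / 2 by apply: Hu; rewrite ltr_norml; lra.
    have {}Hz : `|g z - g x| < e / 2 by apply: Hz; rewrite ltr_norml; lra.
    by move: Hu Hz; rewrite !ltr_norml ler_norml; lra.
  have qi' := integrable_itv_sub ay zb qi; have ri' := integrable_itv_sub ay zb ri.
  have wi' := integrable_itv_sub ay zb wi.
  have i1 : mu.-integrable `[y, z] (EFin \o (fun t => f y * q t)) by exact: (itv_integrableZ _ qi').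
  have i2 : mu.-integrable `[y, z] (EFin \o (fun t => g z * r t)) by exact: (itv_integrableZ _ ri').
  have i3 : mu.-integrable `[y, z] (EFin \o (fun t => f y * q t + g z * r t)) by exact: (itv_integrableD i1 i2).
  have GI : G y z = \int[mu]_(t in `[y, z]) ((f y * q t + g z * r t) - w t).
    rewrite RintegralB// RintegralD// !RintegralZl//.
    rewrite -(H1_deriv_incr gq ay yz zb) -(H1_deriv_incr fr ay yz zb) /G; ring.
  have i4 : mu.-integrable `[y, z] (EFin \o (fun t => (f y * q t + g z * r t) - w t)).
    exact: (itv_integrableB i3 wi').
  rewrite GI (le_trans (le_normr_Rintegral _ i4))//.
  rewrite /E -RintegralZl//; last exact: (integrable_itv_sub ay zb Ei).
  apply: le_Rintegral => //.
  - exact: integrable_norm.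
  - exact: (itv_integrableZ e (integrable_itv_sub ay zb Ei)).
  move=> u uyz; rewrite /w.
  rewrite (_ : _ - _ = (f y - f u) * q u + (g z - g u) * r u); last by ring.
  rewrite mulrDr (le_trans (ler_normD _ _))// !normrM lerD// ler_wpM2r//.
    exact: Hf.
  exact: Hg.
have [v [mv v2 wv]] : L2 a b w by apply: L2D; exact: L2Mcont.
have w2 : mu.-integrable `[a, b] (EFin \o (fun t => w t ^+ 2)).
  have [Kf [Kf0 HKf]] := within_bounded fc; have [Kg [Kg0 HKg]] := within_bounded gc.
  have [[_ q2 _] [_ r2 _]] := (gq, fr).
  apply: (itv_integrable_le _ _ (itv_integrableD (itv_integrableZ (2 * Kf ^+ 2) q2)
    (itv_integrableZ (2 * Kg ^+ 2) r2))); first exact: measurable_funX.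
  move=> t tab /=; rewrite ger0_norm ?sqr_ge0//.
  have A1 : (f t * q t) ^+ 2 <= Kf ^+ 2 * q t ^+ 2.
    by rewrite exprMn ler_wpM2r ?sqr_ge0//; apply: ler_sqr_norml; exact: HKf.
  have A2 : (g t * r t) ^+ 2 <= Kg ^+ 2 * r t ^+ 2.
    by rewrite exprMn ler_wpM2r ?sqr_ge0//; apply: ler_sqr_norml; exact: HKg.
  by rewrite /w; have := sqr_ge0 (f t * q t - g t * r t); nra.
exists w; split => // t; rewrite in_itv/= => /andP[at_ tb].
suff : G a t = 0 by move=> /eqP; rewrite /G -addrA -opprD subr_eq0 => /eqP.
apply/eqP; rewrite -normr_le0; apply/ler_addgt0Pr => e e0; rewrite add0r.
have Eat0 : 0 <= E a t by apply: Rintegral_ge0 => x _; rewrite addr_ge0.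
have := GE (e / (E a t + 1)) t _ at_ tb; rewrite divr_gt0 ?ltr_wpDl// => /(_ isT) /le_trans; apply.
by rewrite mulrAC ler_pdivrMr ?ltr_wpDl// ler_wpM2l ?lerDl ?ltW.
Qed.

Lemma H1_sum a b n (f : 'I_n -> R -> R) :
  (forall i, H1 a b (f i)) -> H1 a b (fun t => \sum_i f i t).
Proof.
elim: n f => [|n ih] f fi; first by under eq_fun do rewrite big_ord0; exact: H1_cst.
under eq_fun do rewrite big_ord_recl.
by apply: H1D => //; apply: ih.
Qed.

Lemma H1Z a b c f : H1 a b f -> H1 a b (fun t => c * f t).
Proof. by move=> fh; apply: H1M => //; exact: H1_cst. Qed.

Lemma H1B a b f g : H1 a b f -> H1 a b g -> H1 a b (fun t => f t - g t).
Proof.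
move=> fh gh; under eq_fun do rewrite -mulN1r.
by apply: H1D => //; exact: H1Z.
Qed.

Lemma H1_eq a b f g : a <= b -> (forall t, t \in `[a, b] -> f t = g t) -> H1 a b f -> H1 a b g.
Proof.
move=> ab fg [r [mr r2 H]]; exists r; split => // t tab.
by rewrite -(fg t tab) -(fg a) ?in_itv/= ?lexx//; exact: H.
Qed.

Lemma H1_C1 a b f : a <= b ->
  (forall t, t \in `[a, b] -> derivable f t 1) ->
  {within `[a, b], continuous (derive1 f)} -> H1 a b f.
Proof.
move=> ab fd fc; exists (derive1 f); split.
- exact: within_measurable.
- have [K [K0 HK]] := within_bounded fc.
  apply: (@continuous_compact_integrable _ (fun t => (derive1 f) t ^+ 2)); first exact: segment_compact.
  by move=> x; apply: continuousM; exact: fc.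
move=> t; rewrite in_itv/= le_eqVlt => /andP[/predU1P[<- _|at_ tb]].
  by rewrite set_itv1 Rintegral_set1 addr0.
have fcont x : a <= x -> x <= t -> {for x, continuous f}.
  move=> ax xt; apply: differentiable_continuous; apply/derivable1_diffP; apply: fd.
  by rewrite in_itv/= ax (le_trans xt tb).
suff E : (\int[mu]_(s in `[a, t]) (derive1 f s)%:E = (f t)%:E - (f a)%:E)%E.
  by rewrite /Rintegral E -EFinB/=; ring.
apply: continuous_FTC2 => //.
- exact: (within_itv_sub (lexx _) tb).
- split.
  + move=> x; rewrite in_itv/= => /andP[ax xt]; apply: fd.
    by rewrite in_itv/= !ltW// (lt_le_trans xt tb).
  + by apply: cvg_at_right_filter; apply: fcont => //; exact: ltW.
  + by apply: cvg_at_left_filter; apply: fcont => //; exact: ltW.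
Qed.

End absolutely_continuous.

(** * Translation invariance of the integral *)

Section translation.
Context {R : realType}.
Local Notation mu := (@lebesgue_measure R).

(** The translated measure agrees with Lebesgue measure on half-open intervals, which determine
    it. *)
Lemma lebesgue_measure_shift (c : R) (A : set R) : measurable A ->
  pushforward mu ((fun x => x + c) : _ -> measurableTypeR R) A = mu A.
Proof.
move=> mA; apply/esym/lebesgue_measure_unique => //; first exact: measurable_funD.
move=> mphi _ [[a b]] _ <-.
have E : (fun x => x + c) @^-1` `]a, b]%classic = `]a - c, b - c]%classic :> set R.
  by apply/seteqP; split=> x /=; rewrite !in_itv/= ltrBlDr lerBrDr.
change (mu `]a, b] = mu ((fun x => x + c) @^-1` `]a, b]%classic)); rewrite E.
by rewrite !lebesgue_measure_itv/= !lte_fin ltrD2r -EFinB; congr (if _ then _ else _); rewrite -EFinD opprB addrA subrK.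
Qed.

Lemma ae_shift (c : R) (P : R -> Prop) : {ae mu, forall t, P t} -> {ae mu, forall t, P (t + c)}.
Proof.
move=> [N [mN N0 PN]]; exists ((fun x => x + c) @^-1` N); split.
- rewrite -[X in measurable X]setTI.
  by have : measurable_fun setT (fun x : R => x + c) by [exact: measurable_funD]; exact.
- by have := lebesgue_measure_shift c mN; rewrite N0.
- by move=> t /= Pt; exact: PN.
Qed.

Lemma Rintegral_shift (a b c : R) (f : R -> R) : mu.-integrable `[a + c, b + c] (EFin \o f) ->
  \int[mu]_(t in `[a + c, b + c]) f t = \int[mu]_(t in `[a, b]) f (t + c).
Proof.
move=> fi; pose D : set (measurableTypeR R) := `[a + c, b + c]%classic.
have mD : measurable D by exact: measurable_itv.
pose phi : measurableTypeR R -> measurableTypeR R := fun x => x + c.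
have mphi : measurable_fun setT phi by exact: measurable_funD.
(* Extending by zero gives a function measurable on the whole line, as the change of variables
   requires. *)
pose g := f \_ D.
have Dphi : phi @^-1` D = `[a, b]%classic :> set R.
  by apply/seteqP; split=> x /=; rewrite /D/= /phi !in_itv/= !lerD2r.
have gT : mu.-integrable setT (EFin \o g).
  by rewrite -restrict_EFin; apply/integrable_restrict => //; rewrite setTI.
have mg : measurable_fun setT (EFin \o g) by case/integrableP: gT.
have mupush : forall A : set (measurableTypeR R), measurable A -> pushforward mu phi A = mu A.
  by move=> A mA; exact: lebesgue_measure_shift.
have gi : mu.-integrable `[a, b] ((EFin \o g) \o phi).
  apply: integrableS (_ : measurable setT) _ _ _ => //.
  apply/integrableP; split; first exact: measurableT_comp.
  case/integrableP: gT => _; rewrite -(@eq_measure_integral _ _ _ setT mu (pushforward mu phi))//.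
    by rewrite ge0_integral_pushforward ?preimage_setT//; exact: measurableT_comp.
  by move=> A mA _; exact: mupush.
transitivity (\int[mu]_(t in D) g t).
  by apply: eq_Rintegral => t tD; rewrite /g patchE tD.
have E : (\int[mu]_(t in D) (EFin \o g) t = \int[mu]_(t in phi @^-1` D) ((EFin \o g) \o phi) t)%E.
  rewrite -(integral_pushforward mphi mg)//; last by rewrite Dphi.
  by apply: eq_measure_integral => A mA _; exact/esym/mupush.
rewrite /Rintegral E Dphi; congr fine; apply: eq_integral => t; rewrite inE/= => tab.
rewrite /g patchE mem_set//.
by change ((phi @^-1` D) t); rewrite Dphi.
Qed.

Lemma L1_Rintegral_shift (a b c : R) (f : R -> R) : L1 (a + c) (b + c) f ->
  \int[mu]_(t in `[a + c, b + c]) f t = \int[mu]_(t in `[a, b]) f (t + c).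
Proof.
move=> [g gi fg]; rewrite (ae_Rintegral fg) Rintegral_shift//.
apply: ae_Rintegral; apply: ae_imp (ae_shift c fg) => t fgt tab.
by rewrite fgt//; move: tab; rewrite !in_itv/= !lerD2r.
Qed.

End translation.

(** * Primitives of locally square integrable functions *)

Section primitive.
Context {R : realType}.
Local Notation mu := (@lebesgue_measure R).
Implicit Types f r : R -> R.

Lemma ae_loc (P : R -> Prop) : (forall a b : R, a < b -> {ae mu, forall t, t \in `]a, b[ -> P t}) ->
  {ae mu, forall t, P t}.
Proof.
move=> H.
have {}H (n : nat) : mu.-negligible [set t : R | (t \in `](- n.+1%:R), n.+1%:R[) /\ ~ P t].
  have := H (- n.+1%:R) n.+1%:R; rewrite gtrN ?ltr0n// => /(_ isT); apply: negligibleS.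
  by move=> t /= [tn Pt] /(_ tn).
apply: negligibleS (negligible_bigcup H) => t /= Pt.
exists (Num.truncn `|t|) => //=; split => //.
by rewrite in_itv/= -ltr_norml; exact: truncnS_gt.
Qed.

Lemma H1_const f : (forall a b, a <= b -> H1 a b f) ->
  {ae mu, forall t, is_derive t (1 : R) f 0} -> forall a b, f a = f b.
Proof.
move=> fH fd; suff H a b : a <= b -> f a = f b.
  by move=> a b; case: (leP a b) => [/H//|/ltW/H].
move=> ab; have E : \int[mu]_(t in `[a, b]) (cst 0 : R -> R) t = f b - f a.
  by apply: H1_FTC => //; [exact: fH|apply: ae_imp fd => t].
by apply/esym/eqP; rewrite -subr_eq0 -E itv_Rintegral_cst0.
Qed.

(** In [I_const_exists] such primitives are the coefficients of the correction that makes [I]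
    constant. They are needed on the whole line, hence the base point 0 and the change of sign for
    negative times. *)
Lemma H1_ex_primitive f : (forall a b, a <= b -> L2 a b f) -> exists x : R -> R,
  [/\ forall a b, a <= b -> H1 a b x, {ae mu, forall t, is_derive t (1 : R) x (f t)} &
      forall a b, a <= b -> x b - x a = \int[mu]_(t in `[a, b]) f t].
Proof.
move=> fL.
pose x t := if 0 <= t then \int[mu]_(s in `[0, t]) f s else - \int[mu]_(s in `[t, 0]) f s.
have fi a b : a <= b -> exists2 g : R -> R, mu.-integrable `[a, b] (EFin \o g) &
    {ae mu, forall t, t \in `[a, b] -> f t = g t} by move=> /fL/L2_L1.
have cat a b c : a <= b -> b <= c -> \int[mu]_(t in `[a, c]) f t =
    \int[mu]_(t in `[a, b]) f t + \int[mu]_(t in `[b, c]) f t.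
  move=> ab bc; have [g gi fg] := fi a c (le_trans ab bc).
  rewrite (ae_Rintegral fg) (Rintegral_itv_cat ab bc gi); congr (_ + _); apply/esym/ae_Rintegral.
    by apply: ae_imp fg => t H tab; apply: H; exact: (itv_sub (lexx _) bc).
  by apply: ae_imp fg => t H tab; apply: H; exact: (itv_sub ab (lexx _)).
have xE a b : a <= b -> x b - x a = \int[mu]_(t in `[a, b]) f t.
  move=> ab; rewrite /x; have [a0|a0] := leP 0 a.
    by rewrite (le_trans a0 ab) (cat 0 a b)//; ring.
  have [b0|b0] := leP 0 b; first by rewrite (cat a 0 b)// ?ltW//; ring.
  by rewrite (cat a b 0)// ?ltW//; ring.
have xH a b : a <= b -> exists2 r, H1_deriv a b x r & {ae mu, forall t, t \in `[a, b] -> f t = r t}.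
  move=> ab; have [g [mg g2 fg]] := fL _ _ ab; exists g => //; split => // t.
  rewrite in_itv/= => /andP[at_ tb]; apply/eqP; rewrite addrC -subr_eq xE//; apply/eqP.
  by apply: ae_Rintegral; apply: ae_imp fg => s H sat; apply: H; exact: (itv_sub (lexx _) tb).
exists x; split => //.
- by move=> a b /xH[r xr _]; exists r.
- apply: ae_loc => a b /ltW /xH[r xr fr]; apply: ae_imp2 (H1_ae_deriv xr) fr => t H fr tab.
  by rewrite fr; [exact: H|exact: subset_itv_oo_cc].
Qed.

End primitive.

(** * Derivatives along lines and symmetry of mixed second derivatives *)

Section lines.
Context {R : realType} {V : normedModType R}.

Lemma is_derive_line (W : normedModType R) (F : V -> W) (x w : V) (r : R) : derivable F (x + r *: w) w ->
  is_derive r (1 : R) (fun s : R => F (x + s *: w)) ('D_w F (x + r *: w)).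
Proof.
move=> Fd; have E : (fun h : R => h^-1 *: (F (x + (h *: (1 : R) + r) *: w) - F (x + r *: w))) =
    (fun h : R => h^-1 *: (F (h *: w + (x + r *: w)) - F (x + r *: w))).
  by apply/funext => h; rewrite [h *: 1]mulr1 scalerDl addrCA.
by split; rewrite /derivable /derive ?E.
Qed.

(** Mean value theorem twice: first for [F (z + h v + r u) - F (z + r u)] as a function of [r], then
    for ['D_u F] along [v]. *)
Lemma second_difference (F : V -> R) (A : set V) (z u v : V) (h : R) : 0 < h ->
  (forall r s : R, A (z + r *: u + s *: v)) -> Cn 1 A F -> Cn 1 A ('D_u F) ->
  exists r s : R, [/\ r \in `]0, h[, s \in `]0, h[ &
    F (z + h *: u + h *: v) - F (z + h *: u) - F (z + h *: v) + F z =
    h ^+ 2 * 'D_v ('D_u F) (z + r *: u + s *: v)].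
Proof.
move=> h0 Az [Fd _] [Du _].
have Az1 r : A (z + r *: u) by have := Az r 0; rewrite scale0r addr0.
have dF r : is_derive r (1 : R) (fun r => F (z + h *: v + r *: u) - F (z + r *: u))
    ('D_u F (z + h *: v + r *: u) - 'D_u F (z + r *: u)).
  apply: is_deriveB; apply: is_derive_line; apply: diff_derivable; apply: Fd => //.
  by rewrite addrAC.
have [r rh Er] := MVT h0 (fun r _ => dF r) (derivable_within_continuous (fun r _ => ex_derive (is_derive := dF r))).
have dG s : is_derive s (1 : R) (fun s => 'D_u F (z + r *: u + s *: v)) ('D_v ('D_u F) (z + r *: u + s *: v)).
  by apply: is_derive_line; apply: diff_derivable; apply: Du.
have [s sh Es] := MVT h0 (fun s _ => dG s) (derivable_within_continuous (fun s _ => ex_derive (is_derive := dG s))).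
exists r, s; split => //.
move: Er Es; rewrite !scale0r !addr0 !subr0 => Er Es.
have -> : F (z + h *: u + h *: v) - F (z + h *: u) - F (z + h *: v) + F z =
  F (z + h *: v + h *: u) - F (z + h *: u) - (F (z + h *: v) - F z).
  by rewrite (addrAC z (h *: u)); ring.
by rewrite Er (addrAC z (h *: v)) Es; ring.
Qed.

Lemma ler_dist_half (p q x e : R) : `|p - x| < e / 2 -> `|q - x| < e / 2 -> `|p - q| <= e.
Proof. by rewrite !ltr_norml ler_norml => /andP[? ?] /andP[? ?]; apply/andP; split; lra. Qed.

(** The second difference is symmetric in [u] and [v], so it is [h ^+ 2] times either mixed
    derivative, each taken at some nearby point; continuity of both at [z] identifies them. This is
    the source of the symmetry of the metric. *)
Lemma schwarz (F : V -> R) (A : set V) (z u v : V) :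
  (forall r s : R, A (z + r *: u + s *: v)) -> Cn 2 A F ->
  'D_u ('D_v F) z = 'D_v ('D_u F) z.
Proof.
move=> Az F2; have [Fd Fd1] := F2.
have F1 : Cn 1 A F by split => // w x Ax; have [H _] := Fd1 w; exact/differentiable_continuous/H.
have Az0 : A z by have := Az 0 0; rewrite !scale0r !addr0.
have cuv : 'D_u ('D_v F) x @[x --> z] --> 'D_u ('D_v F) z by have [_ /(_ u z Az0)] := Fd1 v.
have cvu : 'D_v ('D_u F) x @[x --> z] --> 'D_v ('D_u F) z by have [_ /(_ v z Az0)] := Fd1 u.
apply/eqP; rewrite -subr_eq0 -normr_le0; apply/ler_addgt0Pr => e e0; rewrite add0r.
have e20 : 0 < e / 2 by rewrite divr_gt0.
have /cvgrPdist_lt/(_ _ e20)/nbhs_normP[d1 /= d10 H1] := cuv.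
have /cvgrPdist_lt/(_ _ e20)/nbhs_normP[d2 /= d20 H2] := cvu.
(* With the [h] below, every [r u + s v] with [r] and [s] in []0, h[] is shorter than both radii of
   continuity; the 1 keeps [M] positive. *)
pose M := `|u| + `|v| + 1; have M0 : 0 < M by rewrite ltr_wpDl// addr_ge0.
pose h := Num.min d1 d2 / M / 2.
have h0 : 0 < h by rewrite !divr_gt0// lt_min d10.
have hd : h * M < Num.min d1 d2.
  by rewrite /h mulrAC divfK ?gt_eqF// ltr_pdivrMr// ltr_pMr ?ltr1n// lt_min d10.
have small r s : r \in `]0, h[ -> s \in `]0, h[ -> `|r *: u + s *: v| < Num.min d1 d2.
  rewrite !in_itv/= => /andP[r0 rh] /andP[s0 sh]; apply: le_lt_trans hd.
  rewrite (le_trans (ler_normD _ _))// !normrZ !gtr0_norm// /M !mulrDr.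
  by rewrite (le_trans (lerD (ler_wpM2r (normr_ge0 u) (ltW rh)) (ler_wpM2r (normr_ge0 v) (ltW sh))))// lerDl mulr1 ltW.
have [r [s [rh sh E1]]] := second_difference h0 Az F1 (Fd1 u).
have Az' r' s' : A (z + r' *: v + s' *: u) by rewrite addrAC; exact: Az.
have [r' [s' [rh' sh' E2]]] := second_difference h0 Az' F1 (Fd1 v).
have E : 'D_v ('D_u F) (z + r *: u + s *: v) = 'D_u ('D_v F) (z + r' *: v + s' *: u).
  have hn0 : h ^+ 2 != 0 by rewrite expf_neq0// gt_eqF.
  have perm (p q x y : R) : p - q - x + y = p - x - q + y by ring.
  move: E2; rewrite (addrAC z (h *: v)) => E2; apply: (mulfI hn0).
  exact: (etrans (esym E1) (etrans (perm _ _ _ _) E2)).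
have {}H1 := H1 (z + r' *: v + s' *: u); have {}H2 := H2 (z + r *: u + s *: v).
have S1 : ball_ Num.norm z d1 (z + r' *: v + s' *: u).
  rewrite /ball_/= -addrA opprD addNKr normrN addrC.
  by have := small _ _ sh' rh'; rewrite lt_min => /andP[].
have S2 : ball_ Num.norm z d2 (z + r *: u + s *: v).
  rewrite /ball_/= -addrA opprD addNKr normrN.
  by have := small _ _ rh sh; rewrite lt_min => /andP[].
by have := H2 S2; rewrite E; exact: ler_dist_half (H1 S1).
Qed.

End lines.

Section fun_derive.
Context {R : realType}.
Implicit Types (f g : R -> R) (t : R).

Lemma is_derive1_eq f t df df' : is_derive t (1 : R) f df -> df = df' ->
  is_derive t (1 : R) f df'.
Proof. by move=> H <-. Qed.

Lemma is_derive_funD f g t df dg : is_derive t (1 : R) f df -> is_derive t (1 : R) g dg ->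
  is_derive t (1 : R) (fun s => f s + g s) (df + dg).
Proof. exact: is_deriveD. Qed.

Lemma is_derive_funB f g t df dg : is_derive t (1 : R) f df -> is_derive t (1 : R) g dg ->
  is_derive t (1 : R) (fun s => f s - g s) (df - dg).
Proof. exact: is_deriveB. Qed.

Lemma is_derive_funM f g t df dg : is_derive t (1 : R) f df -> is_derive t (1 : R) g dg ->
  is_derive t (1 : R) (fun s => f s * g s) (df * g t + f t * dg).
Proof. by move=> Hf Hg; apply: (is_derive1_eq (is_deriveM Hf Hg)); rewrite /GRing.scale/=; ring. Qed.

Lemma is_derive_funZ c f t df : is_derive t (1 : R) f df ->
  is_derive t (1 : R) (fun s => c * f s) (c * df).
Proof. exact: is_deriveZ. Qed.

Lemma is_derive_fun_sum (T : finType) (f : T -> R -> R) t (df : T -> R) :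
  (forall i, is_derive t (1 : R) (f i) (df i)) ->
  is_derive t (1 : R) (fun s => \sum_i f i s) (\sum_i df i).
Proof.
move=> fd; have -> : (fun s => \sum_i f i s) = \sum_(i < #|T|) f (enum_val i).
  by apply/funext => s; rewrite fct_sumE (reindex _ (onW_bij _ (@enum_val_bij T))).
rewrite (reindex _ (onW_bij _ (@enum_val_bij T)))/=.
exact: is_derive_sum.
Qed.

End fun_derive.

(** * Gronwall's argument for linear differential inequalities *)

Section gronwall.
Context {R : realType} {T : finType}.
Implicit Types (y dy : T -> R -> R).

(** Cauchy-Schwarz against a constant family, read off from the nonnegative sum of all
    [(|a_i| - |a_j|)^2]. *)
Lemma sqr_sum_le (a : T -> R) : (\sum_i `|a i|) ^+ 2 <= #|T|%:R * \sum_i a i ^+ 2.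
Proof.
have : 0 <= \sum_i \sum_j (`|a i| - `|a j|) ^+ 2.
  by apply: sumr_ge0 => i _; apply: sumr_ge0 => j _; rewrite sqr_ge0.
have -> : \sum_i \sum_j (`|a i| - `|a j|) ^+ 2 =
    2 * (#|T|%:R * (\sum_i a i ^+ 2)) - 2 * (\sum_i `|a i|) ^+ 2.
  have -> : (\sum_i `|a i|) ^+ 2 = \sum_i \sum_j `|a i| * `|a j|.
    by rewrite expr2 mulr_suml; apply: eq_bigr => i _; rewrite mulr_sumr.
  have E1 : #|T|%:R * (\sum_i a i ^+ 2) = \sum_(i : T) \sum_(j : T) a i ^+ 2.
    by rewrite mulr_sumr; apply: eq_bigr => i _; rewrite sumr_const mulr_natl.
  have E2 : #|T|%:R * (\sum_i a i ^+ 2) = \sum_(i : T) \sum_(j : T) a j ^+ 2.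
    by rewrite sumr_const mulr_natl.
  rewrite mulr2n mulrDl mul1r {1}E1 E2 mulr_sumr -big_split -sumrB/=.
  apply: eq_bigr => i _; rewrite mulr_sumr -big_split -sumrB/=; apply: eq_bigr => j _.
  by rewrite sqrrB !real_normK ?num_real//; ring.
by rewrite subr_ge0 ler_pM2l.
Qed.

(** The sum of squares [f] satisfies [|f'| <= C f], so [f e^{Ct}] is nondecreasing and [f e^{-Ct}]
    nonincreasing. As [f] is nonnegative and vanishes at [t0], the first forces [f = 0] to the left
    of [t0] and the second to the right. *)
Lemma gronwall_local y dy (a b K t0 : R) : t0 \in `]a, b[ ->
  (forall i t, t \in `]a, b[ -> is_derive t (1 : R) (y i) (dy i t)) ->
  (forall i t, t \in `]a, b[ -> `|dy i t| <= K * \sum_j `|y j t|) ->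
  (forall i, y i t0 = 0) -> forall i t, t \in `]a, b[ -> y i t = 0.
Proof.
move=> t0ab yd yK y0.
pose f t := \sum_i y i t ^+ 2.
(* The 2 comes from differentiating squares, [|K|] from the hypothesis and [#|T|] from
   [sqr_sum_le]. *)
pose C := 2 * `|K| * #|T|%:R.
have f0 t : 0 <= f t by apply: sumr_ge0 => i _; exact: sqr_ge0.
have ft0 : f t0 = 0 by rewrite /f big1// => i _; rewrite y0 expr0n.
pose df t := \sum_i 2 * y i t * dy i t.
have fd t : t \in `]a, b[ -> is_derive t (1 : R) f (df t).
  move=> tab; apply: is_derive_fun_sum => i.
  by apply: (is_derive1_eq (is_derive_funM (yd i t tab) (yd i t tab))); ring.
have dfC t : t \in `]a, b[ -> `|df t| <= C * f t.
  move=> tab; rewrite (le_trans (ler_norm_sum _ _ _))//.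
  apply: (@le_trans _ _ (2 * `|K| * (\sum_i `|y i t|) ^+ 2)); last first.
    by rewrite /C -[leRHS]mulrA ler_wpM2l ?mulr_ge0// sqr_sum_le.
  rewrite expr2 mulrA mulr_sumr; apply: ler_sum => i _.
  rewrite !normrM (ger0_norm (_ : 0 <= 2))//.
  apply: (@le_trans _ _ (2 * `|y i t| * (`|K| * \sum_j `|y j t|))).
    rewrite ler_wpM2l// ?mulr_ge0// (le_trans (yK i t tab))// ler_wpM2r ?ler_norm//.
    exact: sumr_ge0.
  by rewrite le_eqVlt; apply/orP; left; apply/eqP; ring.
suff fz t : t \in `]a, b[ -> f t = 0.
  move=> i t tab; apply/eqP; rewrite -sqrf_eq0 eq_le sqr_ge0 andbT.
  by rewrite -(fz t tab) /f (bigD1 i)//= lerDl sumr_ge0// => j _; exact: sqr_ge0.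
have main (c lo hi : R) : a < lo -> hi < b -> lo < hi -> exists2 x, x \in `]lo, hi[ &
    f hi * expR (c * hi) - f lo * expR (c * lo) = (df x + c * f x) * expR (c * x) * (hi - lo).
  move=> alo hib lohi.
  have gd s : s \in `[lo, hi] ->
      is_derive s (1 : R) (fun s => f s * expR (c * s)) ((df s + c * f s) * expR (c * s)).
    rewrite in_itv/= => /andP[ls sh]; have sab : s \in `]a, b[.
      by rewrite in_itv/= (lt_le_trans alo ls) (le_lt_trans sh hib).
    have ed : is_derive s (1 : R) (fun s => expR (c * s)) (c * expR (c * s)).
      apply: (is_derive1_eq (is_derive1_comp (is_derive_expR (c * s)) (is_derive_funZ c (is_derive_id s (1 : R))))).
      by rewrite mulr1 mulrC.
    by apply: (is_derive1_eq (is_derive_funM (fd s sab) ed)); ring.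
  have gd' : forall s, s \in `]lo, hi[ -> is_derive s (1 : R) (fun s => f s * expR (c * s))
      ((fun s => (df s + c * f s) * expR (c * s)) s).
    by move=> s /subset_itv_oo_cc; exact: gd.
  have [|x xlh E] := MVT lohi gd'; last by exists x.
  by apply: derivable_within_continuous => s slh; exact: (ex_derive (is_derive := gd s slh)).
have C0 : 0 <= C by rewrite !mulr_ge0.
move=> tab; move: t0ab (tab); rewrite !in_itv/= => /andP[at0 t0b] /andP[at_ tb].
have [tt0|t0t|->//] := ltgtP t t0.
  have [x xlh] := main C t t0 at_ t0b tt0.
  have xab : x \in `]a, b[.
    by move: xlh; rewrite !in_itv/= => /andP[tx xt0]; rewrite (lt_trans at_ tx) (lt_trans xt0 t0b).
  rewrite ft0 mul0r sub0r => E; apply/eqP; rewrite eq_le f0 andbT.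
  rewrite -(pmulr_lle0 _ (expR_gt0 (C * t))) -oppr_ge0 E; apply: mulr_ge0; last by rewrite subr_ge0 ltW.
  apply: mulr_ge0; last by rewrite ltW ?expR_gt0.
  have := dfC x xab; rewrite ler_norml => /andP[H _].
  by rewrite -(opprK (df x)) addrC subr_ge0 lerNl.
have [x xlh] := main (- C) t0 t at0 tb t0t.
have xab : x \in `]a, b[.
  by move: xlh; rewrite !in_itv/= => /andP[tx xt0]; rewrite (lt_trans at0 tx) (lt_trans xt0 tb).
rewrite ft0 mul0r subr0 => E; apply/eqP; rewrite eq_le f0 andbT.
rewrite -(pmulr_lle0 _ (expR_gt0 (- C * t))) E.
rewrite pmulr_lle0 ?subr_gt0// pmulr_lle0 ?expR_gt0//.
by have := dfC x xab; rewrite ler_norml => /andP[_]; rewrite mulNr subr_le0.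
Qed.

End gronwall.

(** * Geometry along the trajectory *)

Section derivatives.
Context {R : realType}.

Lemma derive_chain (U V W : normedModType R) (f : U -> V) (g : V -> W) (x v : U) :
  differentiable f x -> differentiable g (f x) -> 'D_v (g \o f) x = 'D_('D_v f x) g (f x).
Proof.
move=> df dg; have dgf := differentiable_comp df dg.
by rewrite !deriveE// diff_comp.
Qed.

Lemma derive_linear (V W : normedModType R) (f : V -> W) (x u v : V) (c : R) :
  differentiable f x -> 'D_(c *: u + v) f x = c *: 'D_u f x + 'D_v f x.
Proof. by move=> df; rewrite !deriveE// linearP. Qed.

Lemma derive1_shift (V : normedModType R) (f : R -> V) (c t : R) :
  derive1 (fun s => f (s + c)) t = derive1 f (t + c).
Proof.
have E : (fun h => h^-1 *: (f (h + (t + c)) - f (t + c))) = (fun h => h^-1 *: (f (h + t + c) - f (t + c))).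
  by apply/funext => h; rewrite addrA.
by rewrite [RHS]/derive1 E.
Qed.

Lemma derivable_shift (V : normedModType R) (f : R -> V) (c t : R) :
  derivable f (t + c) 1 -> derivable (fun s => f (s + c)) t 1.
Proof.
have E : (fun h => h^-1 *: (f (h *: (1 : R) + (t + c)) - f (t + c))) =
    (fun h => h^-1 *: (f (h *: (1 : R) + t + c) - f (t + c))).
  by apply/funext => h; rewrite addrA.
by rewrite /derivable E.
Qed.

End derivatives.

Section tangent_space.
Context {R : realType} {m : nat} {M : manifold R m}.
Implicit Types (p : M) (i j l : atlas M) (u v : tvec M) (y : 'rV[R]_m).

Lemma transition_differentiable i j p : dom i p -> dom j p ->
  differentiable (chart j \o chart_inv i) (chart i p).
Proof.
by move=> ip jp; have [H _] := @transition_smooth R m M i j 1%N; apply: H; exists p.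
Qed.

Lemma chart_inv_near_dom i j p : dom i p -> dom j p ->
  \forall x \near chart i p, (chart i @` dom i) x /\ dom j (chart_inv i x).
Proof.
move=> ip jp; have ipi : (chart i @` dom i) (chart i p) by exists p.
have H1 : \forall x \near chart i p, (chart i @` dom i) x.
  by apply: open_nbhs_nbhs; split => //; exact: chart_open.
have H2 : \forall x \near chart i p, dom j (chart_inv i x).
  apply: (chart_inv_continuous ipi); rewrite chartK//.
  by apply: open_nbhs_nbhs; split => //; exact: dom_open.
by apply: filterS2 H1 H2.
Qed.

Lemma tvec_of_out i p y j : ~ dom j p -> tvec_of i p y j = 0.
Proof. by move=> jp; rewrite /tvec_of; case: asboolP. Qed.

Lemma tvec_of_in i p y j : dom j p -> tvec_of i p y j = 'D_y (chart j \o chart_inv i) (chart i p).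
Proof. by move=> jp; rewrite /tvec_of; case: asboolP. Qed.

Lemma tvec_ofP i p (c : R) y y' : dom i p ->
  tvec_of i p (c *: y + y') = c *: tvec_of i p y + tvec_of i p y'.
Proof.
move=> ip; apply/funext => j; rewrite [RHS]/=.
change (tvec_of i p (c *: y + y') j = c *: tvec_of i p y j + tvec_of i p y' j).
have [jp|jp] := pselect (dom j p); last by rewrite !tvec_of_out// scaler0 addr0.
by rewrite !tvec_of_in// derive_linear//; exact: transition_differentiable.
Qed.

Lemma tvec_of_self i p y : dom i p -> tvec_of i p y i = y.
Proof.
move=> ip; rewrite tvec_of_in// (@near_eq_derive _ _ _ _ id) ?derive_id//.
by apply: filterS (chart_inv_near_dom ip ip) => x [[q iq <-] _]; rewrite /= chartK.
Qed.

(** Chain rule for the transition maps, whose composition law holds in a neighbourhood of the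
    point. *)
Lemma tvec_of_chain i j p y : dom i p -> dom j p -> tvec_of j p (tvec_of i p y j) = tvec_of i p y.
Proof.
move=> ip jp; apply/funext => l; have [lp|lp] := pselect (dom l p); last by rewrite !tvec_of_out.
rewrite (tvec_of_in j _ lp) (tvec_of_in i _ lp) tvec_of_in//.
have dij := transition_differentiable ip jp.
have E : (chart j \o chart_inv i) (chart i p) = chart j p by rewrite /= chartK.
have djl := transition_differentiable jp lp.
rewrite -E in djl *; rewrite -derive_chain//.
apply: near_eq_derive; apply: filterS (chart_inv_near_dom ip jp) => x [_ jx].
by rewrite /= chartK.
Qed.

Lemma tangent_tvec_of i p y : dom i p -> tangent p (tvec_of i p y).
Proof. by move=> ip j jp; rewrite tvec_of_chain. Qed.

Lemma tangentP p (c : R) u v : tangent p u -> tangent p v -> tangent p (c *: u + v).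
Proof.
move=> up vp i ip; change (c *: u + v = tvec_of i p (c *: u i + v i)).
by rewrite tvec_ofP// -up// -vp.
Qed.

Lemma tvec_of0 i p : dom i p -> tvec_of i p 0 = 0.
Proof. by move=> ip; have := tvec_ofP (-1) 0 0 ip; rewrite scaler0 addr0 scaleN1r addNr. Qed.

Lemma tangent0 p : tangent p 0.
Proof. by move=> i ip; rewrite [0 i]/(0 : 'rV[R]_m) tvec_of0. Qed.

Lemma tangentZ p (c : R) u : tangent p u -> tangent p (c *: u).
Proof. by move=> up; rewrite -[_ *: _]addr0; apply: tangentP => //; exact: tangent0. Qed.

Lemma tangentD p u v : tangent p u -> tangent p v -> tangent p (u + v).
Proof. by move=> up vp; rewrite -[u]scale1r; exact: tangentP. Qed.

Lemma tangentB p u v : tangent p u -> tangent p v -> tangent p (u - v).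
Proof. by move=> up vp; rewrite addrC -scaleN1r; exact: tangentP. Qed.

Lemma tangent_sum p (I : finType) (u : I -> tvec M) : (forall a, tangent p (u a)) ->
  tangent p (\sum_a u a).
Proof. by move=> H; apply: (big_ind (tangent p)) => //; [exact: tangent0|exact: tangentD]. Qed.

Lemma tangent_out p u j : tangent p u -> ~ dom j p -> u j = 0.
Proof. by move=> up jp; have [i ip] := dom_cover p; rewrite (up i ip) tvec_of_out. Qed.

Lemma tangent_inj p u v i : dom i p -> tangent p u -> tangent p v -> u i = v i -> u = v.
Proof. by move=> ip up vp uv; rewrite (up i ip) (vp i ip) uv. Qed.

Lemma tangent_frame p u i : dom i p -> tangent p u ->
  u = \sum_l u i 0 l *: tvec_of i p (delta_mx 0 l).
Proof.
move=> ip up; apply: (tangent_inj ip up).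
  by apply: tangent_sum => l; apply: tangentZ; exact: tangent_tvec_of.
rewrite fct_sumE [LHS]row_sum_delta; apply: eq_bigr => l _.
by change (u i 0 l *: delta_mx 0 l = u i 0 l *: tvec_of i p (delta_mx 0 l) i); rewrite tvec_of_self.
Qed.

Lemma curve_near_dom (c : R -> M) t i : {for t, continuous c} -> dom i (c t) ->
  \forall s \near t, dom i (c s).
Proof. by move=> ct it; apply: ct; apply: open_nbhs_nbhs; split => //; exact: dom_open. Qed.

Lemma tangent_velocity (c : R -> M) t : smooth_map c -> tangent (c t) (velocity c t).
Proof.
move=> [cc cs] i it; apply/funext => j.
have dc l : dom l (c t) -> derivable (chart l \o c) t 1.
  by move=> lt; apply/derivable1_diffP; have [H _] := cs l 1%N; exact: H.
rewrite {1}/velocity; case: asboolP => [jt|jt]; last by rewrite tvec_of_out.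
have -> : velocity c t i = derive1 (chart i \o c) t by rewrite /velocity asboolT.
rewrite tvec_of_in// !derive1E.
have <- : 'D_1 ((chart j \o chart_inv i) \o (chart i \o c)) t = 'D_1 (chart j \o c) t.
  apply: near_eq_derive; apply: filterS (curve_near_dom (cc t) it) => s is_.
  by rewrite /= chartK.
rewrite derive_chain//; first by apply/derivable1_diffP; exact: dc.
exact: transition_differentiable.
Qed.

End tangent_space.
Arguments tangent0 {R m M} p.
Arguments tangentP {R m M p} c {u v}.
Arguments tangentZ {R m M p} c {u}.
Arguments tangentD {R m M p u v}.
Arguments tangentB {R m M p u v}.
Arguments tangent_sum {R m M p I u}.
Arguments tangent_tvec_of {R m M i p} y.
Arguments tangent_velocity {R m M c} t.
Opaque tangent.

Section metric.
Context {R : realType} {m : nat} (S : lagrangian_system R m).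
Local Notation M := (config S).
Local Notation gam := (gamma S).
Implicit Types (t : R) (i : atlas M) (u v w : tvec M).

Let Lz i (z : 'rV[R]_m * 'rV[R]_m * R) := local_lagrangian (lag S) i z.1.1 z.1.2 z.2.
Let Az i := [set z : 'rV[R]_m * 'rV[R]_m * R | (chart i @` dom i) z.1.1].
(** A direction along the fibre; together with [jet], the 1-jet of [gamma] in a chart, it expresses
    the metric by second derivatives of the local Lagrangian. *)
Let fib (y : 'rV[R]_m) : 'rV[R]_m * 'rV[R]_m * R := (0, y, 0).
Let jet i t : 'rV[R]_m * 'rV[R]_m * R := (chart i (gam t), velocity gam t i, t).

Lemma jet_line i t (y : 'rV[R]_m) (r : R) (z : 'rV[R]_m * 'rV[R]_m * R) :
  z + r *: fib y = (z.1.1, z.1.2 + r *: y, z.2).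
Proof.
case: z => [[z1 z2] z3]; rewrite /fib.
by change ((z1 + r *: 0, z2 + r *: y, z3 + r *: 0) = (z1, z2 + r *: y, z3)); rewrite !scaler0 !addr0.
Qed.

Lemma jet_dom i t y y' (r s : R) : dom i (gam t) -> Az i (jet i t + r *: fib y + s *: fib y').
Proof. by move=> it; rewrite !jet_line//=; exists (gam t). Qed.

Lemma Lz_Cn n i : Cn n (Az i) (Lz i).
Proof. exact: lag_smooth. Qed.

Lemma tangent_gamma_velocity t : tangent (gam t) (velocity gam t).
Proof. exact/tangent_velocity/gamma_smooth. Qed.

(** Tangency is essential: the local Lagrangian sees [lag] only on vectors given by [tvec_of], and a
    tangent vector is the [tvec_of] of its own component. The nested one-variable derivatives then
    become directional derivatives of a smooth function. *)
Lemma metric_chart i t u v : dom i (gam t) -> tangent (gam t) u -> tangent (gam t) v ->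
  metric t u v = 'D_(fib (u i)) ('D_(fib (v i)) (Lz i)) (jet i t).
Proof.
move=> it ut vt; rewrite /metric /fibre_hessian.
have dL z : Az i z -> differentiable (Lz i) z by have [H _] := Lz_Cn 1 i; exact: H.
have d2L z y : Az i z -> differentiable ('D_y (Lz i)) z by have [_ /(_ y)[H _]] := Lz_Cn 2 i; exact: H.
have E (r s : R) : lag S (gam t) (velocity gam t + r *: u + s *: v) t = Lz i (jet i t + r *: fib (u i) + s *: fib (v i)).
  rewrite !jet_line//= /Lz/= /local_lagrangian chartK//.
  have T : tangent (gam t) (velocity gam t + r *: u + s *: v).
    apply: tangentD (tangentD _ (tangentZ r ut)) (tangentZ s vt).
    exact: tangent_gamma_velocity.
  by rewrite {1}(T i it).
have E1 (r : R) : derive1 (fun s => lag S (gam t) (velocity gam t + r *: u + s *: v) t) 0 =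
    'D_(fib (v i)) (Lz i) (jet i t + r *: fib (u i)).
  under eq_fun do rewrite E.
  rewrite derive1E; have := @is_derive_line _ _ _ (Lz i) (jet i t + r *: fib (u i)) (fib (v i)) 0.
  rewrite scale0r addr0 => H; apply: derive_val; apply: H.
  by apply/diff_derivable/dL; have := jet_dom (u i) (v i) r 0 it; rewrite scale0r addr0.
under eq_fun do rewrite E1.
rewrite derive1E; have := @is_derive_line _ _ _ ('D_(fib (v i)) (Lz i)) (jet i t) (fib (u i)) 0.
rewrite scale0r addr0 => H; apply: derive_val; apply: H.
by apply/diff_derivable/d2L; have := jet_dom (u i) (v i) 0 0 it; rewrite !scale0r !addr0.
Qed.

Lemma metricC t u v : tangent (gam t) u -> tangent (gam t) v -> metric t u v = metric t v u.
Proof.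
move=> ut vt; have [i it] := dom_cover (gam t); rewrite (metric_chart it ut vt) (metric_chart it vt ut).
by apply: schwarz (Lz_Cn 2 i) => r s; exact: jet_dom.
Qed.

Lemma metricPl t (c : R) u v w : tangent (gam t) u -> tangent (gam t) v -> tangent (gam t) w ->
  metric t (c *: u + v) w = c * metric t u w + metric t v w.
Proof.
move=> ut vt wt; have [i it] := dom_cover (gam t); 
rewrite (metric_chart it (tangentP c ut vt) wt) (metric_chart it ut wt) (metric_chart it vt wt).
have -> : fib ((c *: u + v) i) = c *: fib (u i) + fib (v i).
  by rewrite /fib; change ((0, c *: u i + v i, 0) = (c *: 0 + 0, c *: u i + v i, c *: 0 + 0) :> 'rV[R]_m * 'rV[R]_m * R); rewrite !scaler0 !addr0.
rewrite derive_linear//.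
have [_ /(_ (fib (w i)))[H _]] := Lz_Cn 2 i; apply: H.
by have := jet_dom 0 0 0 0 it; rewrite !scale0r !addr0.
Qed.

Lemma metric_gt0 t u : tangent (gam t) u -> u != 0 -> 0 < metric t u u.
Proof. by move=> ut u0; apply: lag_convex => //; exact: tangent_gamma_velocity. Qed.

Lemma metricT t u v : tangent (gam t) u -> tangent (gam t) v ->
  metric (t + tau S) u v = metric t u v.
Proof.
move=> ut vt; rewrite /metric gamma_periodic.
have -> : velocity gam (t + tau S) = velocity gam t.
  apply/funext => i; rewrite /velocity gamma_periodic -derive1_shift.
  have -> // : (fun s => (chart i \o gam) (s + tau S)) = chart i \o gam.
  by apply/funext => s; rewrite /= gamma_periodic.
pose hess (f : R -> R -> R) := derive1 (fun r => derive1 (f r) 0) 0.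
pose Lt c (r s : R) := lag S (gam t) (velocity gam t + r *: u + s *: v) c.
suff E : Lt (t + tau S) = Lt t by change (hess (Lt (t + tau S)) = hess (Lt t)); rewrite E.
apply/funext => r; apply/funext => s; apply: lag_periodic.
apply: tangentD (tangentD _ (tangentZ r ut)) (tangentZ s vt).
exact: tangent_gamma_velocity.
Qed.

Definition frame i t (l : 'I_m) : tvec M := tvec_of i (gam t) (delta_mx 0 l).

Lemma tangent_frame_vec i t l : dom i (gam t) -> tangent (gam t) (frame i t l).
Proof. exact: tangent_tvec_of. Qed.

Definition chart_gram i t : 'M[R]_m := \matrix_(j, l) metric t (frame i t j) (frame i t l).

Lemma metric_sumr t (I : finType) (c : I -> R) (f : I -> tvec M) u :
  (forall a, tangent (gam t) (f a)) -> tangent (gam t) u ->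
  metric t (\sum_a c a *: f a) u = \sum_a c a * metric t (f a) u.
Proof.
move=> ft ut.
have m0 : metric t 0 u = 0.
  have := metricPl (-1) (tangent0 (gam t)) (tangent0 (gam t)) ut.
  by rewrite scaler0 addr0 mulN1r addNr.
suff [] : tangent (gam t) (\sum_a c a *: f a) /\
    metric t (\sum_a c a *: f a) u = \sum_a c a * metric t (f a) u by [].
elim/big_rec2: _ => [|a x y _ [yt <-]]; first by rewrite m0; split => //; exact: tangent0.
by split; [exact: (tangentP (c a) (ft a) yt)|rewrite (metricPl (c a) (ft a) yt ut)].
Qed.

Lemma metric_gram i t u v : dom i (gam t) -> tangent (gam t) u -> tangent (gam t) v ->
  metric t u v = \sum_j \sum_l u i 0 j * v i 0 l * chart_gram i t j l.
Proof.
move=> it ut vt; have fr l := tangent_frame_vec l it.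
rewrite {1}(tangent_frame it ut) (metric_sumr _ fr vt); apply: eq_bigr => j _.
rewrite (metricC (fr j) vt) {1}(tangent_frame it vt) (metric_sumr _ fr (fr j)).
by rewrite mulr_sumr; apply: eq_bigr => l _; rewrite mxE (metricC (fr l) (fr j)) mulrA.
Qed.

Let the_chart t : atlas M := sval (cid (dom_cover (gam t))).
Let the_chartP t : dom (the_chart t) (gam t). Proof. exact: svalP (cid (dom_cover (gam t))). Qed.

(* The second derivative defining [metric] is only known to be bilinear on tangent
   vectors; this form agrees with it there and is bilinear on all of [tvec]. *)
Definition dot t u v : R :=
  \sum_j \sum_l u (the_chart t) 0 j * v (the_chart t) 0 l * chart_gram (the_chart t) t j l.

Lemma metricE t u v : tangent (gam t) u -> tangent (gam t) v -> metric t u v = dot t u v.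
Proof. exact/metric_gram/the_chartP. Qed.

Lemma dotC t u v : dot t u v = dot t v u.
Proof.
rewrite /dot exchange_big; apply: eq_bigr => l _; apply: eq_bigr => j _.
have fr a := tangent_frame_vec a (the_chartP t).
by rewrite !mxE (metricC (fr j) (fr l)) [v _ _ _ * _]mulrC.
Qed.

Lemma dotPl t (c : R) u v w : dot t (c *: u + v) w = c * dot t u w + dot t v w.
Proof.
rewrite /dot mulr_sumr -big_split; apply: eq_bigr => j _.
rewrite mulr_sumr -big_split; apply: eq_bigr => l _ /=.
change ((c *: u + v) (the_chart t)) with (c *: u (the_chart t) + v (the_chart t)).
by rewrite !mxE; ring.
Qed.

Lemma dot0l t v : dot t 0 v = 0.
Proof. by have := dotPl t (-1) 0 0 v; rewrite scaler0 addr0 mulN1r addNr. Qed.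

Lemma dotZl t (c : R) u v : dot t (c *: u) v = c * dot t u v.
Proof. by rewrite -[_ *: _]addr0 dotPl dot0l addr0. Qed.

Lemma dotDl t u v w : dot t (u + v) w = dot t u w + dot t v w.
Proof. by rewrite -[u in LHS]scale1r dotPl mul1r. Qed.

Lemma dotBl t u v w : dot t (u - v) w = dot t u w - dot t v w.
Proof. by rewrite addrC -scaleN1r dotPl mulN1r addrC. Qed.

Lemma dotDr t u v w : dot t w (u + v) = dot t w u + dot t w v.
Proof. by rewrite dotC dotDl !(dotC t w). Qed.

Lemma dotBr t u v w : dot t w (u - v) = dot t w u - dot t w v.
Proof. by rewrite dotC dotBl !(dotC t w). Qed.

Lemma dot_suml t (I : finType) (f : I -> tvec M) u : dot t (\sum_a f a) u = \sum_a dot t (f a) u.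
Proof.
by elim/big_rec2: _ => [|a x y _ <-]; [rewrite dot0l|rewrite dotDl].
Qed.

Lemma dot_gt0 t u : tangent (gam t) u -> u != 0 -> 0 < dot t u u.
Proof. by move=> ut u0; rewrite -(metricE ut ut); exact: metric_gt0. Qed.

Lemma dotT t u v : tangent (gam t) u -> tangent (gam t) v -> dot (t + tau S) u v = dot t u v.
Proof. 
move=> ut vt; rewrite -(metricE ut vt) -(metricT ut vt) metricE// gamma_periodic//.
 Qed.

End metric.
Opaque dot.

Section coordinates.
Context {R : realType} {m : nat}.

Lemma is_derive_coord (f : R -> 'rV[R]_m) (t : R) j : derivable f t 1 ->
  is_derive t (1 : R) (fun s => f s 0 j) (derive1 f t 0 j).
Proof.
move=> fd; rewrite derive1E derive_mx// mxE.
by apply: DeriveDef => //; have /derivable_mxP := fd; exact.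
Qed.

Lemma derivable_row (f : R -> 'rV[R]_m) (t : R) :
  (forall j, derivable (fun s => f s 0 j) t 1) -> derivable f t 1.
Proof. by move=> H; apply/derivable_mxP => i j; rewrite ord1. Qed.

Lemma derive1_coord (f : R -> 'rV[R]_m) (t : R) j (d : R) : derivable f t 1 ->
  is_derive t (1 : R) (fun s => f s 0 j) d -> derive1 f t 0 j = d.
Proof.
by move=> fd H; rewrite -(derive_val (is_derive := H)) (derive_val (is_derive := is_derive_coord j fd)).
Qed.

Lemma within_continuous (a b : R) (f : R -> R) :
  (forall t, t \in `[a, b] -> {for t, continuous f}) -> {within `[a, b], continuous f}.
Proof. by move=> H; apply: continuous_in_subspaceT => t /set_mem /=; exact: H. Qed.

Lemma is_derive_continuous (t d : R) (f : R -> R) : is_derive t (1 : R) f d -> {for t, continuous f}.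
Proof. by move=> H; apply/differentiable_continuous/derivable1_diffP; exact: (ex_derive (is_derive := H)). Qed.

Lemma H1_is_derive (a b : R) (f g : R -> R) : a <= b ->
  (forall t, t \in `[a, b] -> is_derive t (1 : R) f (g t)) ->
  (forall t, t \in `[a, b] -> {for t, continuous g}) -> H1 a b f.
Proof.
move=> ab fd gc; apply: H1_C1 => //.
  by move=> t tab; exact: (ex_derive (is_derive := fd t tab)).
have /subspace_continuousP gc' := within_continuous gc.
apply/subspace_continuousP => x xab.
have E y : y \in `[a, b] -> derive1 f y = g y.
  by move=> yab; rewrite derive1E (derive_val (is_derive := fd y yab)).
rewrite /from_subspace/= E//; apply: cvg_trans (gc' x xab); apply: near_eq_cvg; near=> y.
have yab : y \in `[a, b] by near: y; exact: withinT.
by rewrite /from_subspace/= E.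
Unshelve. all: by end_near. Qed.

Lemma continuous_sum_at (I : finType) (f : I -> R -> R) (t : R) :
  (forall a, {for t, continuous (f a)}) -> {for t, continuous (fun s => \sum_a f a s)}.
Proof.
move=> H; have -> : (fun s => \sum_a f a s) = \sum_a f a by apply/funext => s; rewrite fct_sumE.
apply: (big_ind (fun g : R -> R => {for t, continuous g})) => //; first exact: cst_continuous.
by move=> g1 g2 h1 h2; exact: continuousD.
Qed.

Lemma within_sum (I : finType) (f : I -> R -> R) (a b : R) :
  (forall i, {within `[a, b], continuous (f i)}) -> {within `[a, b], continuous (fun s => \sum_i f i s)}.
Proof.
move=> H; have -> : (fun s => \sum_i f i s) = \sum_i f i by apply/funext => s; rewrite fct_sumE.
apply: (big_ind (fun g : R -> R => {within `[a, b], continuous g})) => //.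
  by move=> x; exact: cvg_cst.
by move=> g1 g2 h1 h2 x; apply: continuousD; [exact: h1|exact: h2].
Qed.

Lemma within_M (f g : R -> R) (a b : R) : {within `[a, b], continuous f} ->
  {within `[a, b], continuous g} -> {within `[a, b], continuous (fun s => f s * g s)}.
Proof. by move=> H1 H2 x; apply: continuousM; [exact: H1|exact: H2]. Qed.

End coordinates.

(** * Fields of class W^{1,2} and solutions of the variational system *)

Section fields.
Context {R : realType} {m : nat} {S : lagrangian_system R m} (B : second_variation S).
Local Notation M := (config S).
Local Notation gam := (gamma S).
Local Notation mu := (@lebesgue_measure R).
Implicit Types (t a b : R) (i : atlas M) (xi eta : field S).

Lemma gamma_continuous t : {for t, continuous gam}.
Proof. by have [H _] := gamma_smooth S; exact: H. Qed.

Lemma gamma_near_dom t i : dom i (gam t) -> \forall s \near t, dom i (gam s).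
Proof. exact/curve_near_dom/gamma_continuous. Qed.

Lemma gamma_differentiable t i : dom i (gam t) -> differentiable (chart i \o gam) t.
Proof. by move=> it; have [_ /(_ i 1%N)[H _]] := gamma_smooth S; exact: H. Qed.

(** Components in two charts differ by the Jacobian of the transition map, which is itself
    differentiable along [gamma]. *)
Lemma field_derivable_chart xi t i : along xi -> dom i (gam t) ->
  derivable (fun s => xi s i) t 1 -> field_derivable xi t.
Proof.
move=> xit it xd j jt.
have phid l s : dom i (gam s) -> dom j (gam s) ->
    differentiable ('D_(delta_mx 0 l) (chart j \o chart_inv i)) (chart i (gam s)).
  move=> is_ js; have [_ /(_ (delta_mx 0 l))[H _]] := @transition_smooth R m M i j 2%N.
  by apply: H; exists (gam s).
have E : \forall s \near t, \sum_l xi s i 0 l *: 'D_(delta_mx 0 l) (chart j \o chart_inv i) (chart i (gam s)) = xi s j.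
  apply: filterS2 (gamma_near_dom it) (gamma_near_dom jt) => s is_ js.
  rewrite [in RHS](xit s i is_) tvec_of_in//.
  have dphi := transition_differentiable is_ js.
  rewrite deriveE// {2}(row_sum_delta (xi s i)) linear_sum; apply: eq_bigr => l _.
  by rewrite linearZ deriveE.
apply: (near_eq_derivable E).
apply/derivable_mxP => r c.
rewrite (_ : (fun s => _) = (fun s => \sum_l xi s i 0 l * 'D_(delta_mx 0 l) (chart j \o chart_inv i) (chart i (gam s)) r c)); last first.
  by apply/funext => s; rewrite summxE; apply: eq_bigr => l _; rewrite mxE.
have dl l : derivable (fun s => 'D_(delta_mx 0 l) (chart j \o chart_inv i) (chart i (gam s)) r c) t 1.
  have := differentiable_comp (gamma_differentiable it) (phid l t it jt).
  by move=> /derivable1_diffP/derivable_mxP; exact.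
have := is_derive_fun_sum (fun l => is_derive_funM (is_derive_coord l xd) (derivableP (dl l))).
by move=> H; exact: (ex_derive (is_derive := H)).
Qed.

Lemma D_chart xi t i : dom i (gam t) ->
  D B xi t i = derive1 (fun s => xi s i) t + xi t i *m conn B i t.
Proof. by move=> it; rewrite /D /cov_of asboolT. Qed.

Lemma D_tangent xi t : along xi -> field_derivable xi t -> tangent (gam t) (D B xi t).
Proof. exact: conn_tangent. Qed.

Lemma U_chart t v i : dom i (gam t) -> U B t v i = v i *m pot B i t.
Proof. by move=> it; rewrite /U /endo_of asboolT. Qed.

Lemma U_tangent t v : tangent (gam t) v -> tangent (gam t) (U B t v).
Proof. exact: pot_tangent. Qed.

Lemma dot_Usym t u v : tangent (gam t) u -> tangent (gam t) v ->
  dot t (U B t u) v = dot t u (U B t v).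
Proof.
move=> ut vt; rewrite -(metricE (U_tangent ut) vt) -(metricE ut (U_tangent vt)).
exact: pot_symmetric.
Qed.

Lemma is_derive_dot xi eta t : along xi -> along eta -> field_derivable xi t -> field_derivable eta t ->
  is_derive t (1 : R) (fun s => dot s (xi s) (eta s)) (dot t (D B xi t) (eta t) + dot t (xi t) (D B eta t)).
Proof.
move=> xit etat xd ed; have := conn_metric B xit etat xd ed.
rewrite (metricE (D_tangent xit xd) (etat t)) (metricE (xit t) (D_tangent etat ed)).
have -> // : (fun s => metric s (xi s) (eta s)) = (fun s => dot s (xi s) (eta s)).
by apply/funext => s; rewrite metricE.
Qed.

Lemma conn_continuous t i j l : dom i (gam t) -> {for t, continuous (fun s => conn B i s j l)}.
Proof.
move=> it; have H : {for t, continuous (conn B i)} by exact: (conn_smooth B i 0%N).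
exact: (@continuous_comp _ _ _ (conn B i) (fun A : 'M[R]_m => A j l) t H (@coord_continuous _ _ _ j l _)).
Qed.

Lemma pot_continuous t i j l : dom i (gam t) -> {for t, continuous (fun s => pot B i s j l)}.
Proof.
move=> it; have H : {for t, continuous (pot B i)} by exact: (pot_smooth B i 0%N).
exact: (@continuous_comp _ _ _ (pot B i) (fun A : 'M[R]_m => A j l) t H (@coord_continuous _ _ _ j l _)).
Qed.

(** Extended by zero off the chart so as to be a field along all of [gamma], as [conn_metric]
    requires; domains being open, the extension does not influence derivatives at times inside the
    chart. *)
Definition frame_field i l : field S := fun t => if `[< dom i (gam t) >] then frame i t l else 0.

Lemma frame_field_in i l t : dom i (gam t) -> frame_field i l t = frame i t l.
Proof. by move=> it; rewrite /frame_field asboolT. Qed.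

Lemma along_frame_field i l : along (frame_field i l).
Proof.
move=> t; rewrite /frame_field; case: asboolP => it; first exact: tangent_frame_vec.
exact: tangent0.
Qed.

Lemma frame_field_near i l t : dom i (gam t) -> \forall s \near t, frame_field i l s i = delta_mx 0 l.
Proof.
move=> it; apply: filterS (gamma_near_dom it) => s is_.
by rewrite frame_field_in// /frame tvec_of_self.
Qed.

Lemma frame_field_derivable i l t : dom i (gam t) -> field_derivable (frame_field i l) t.
Proof.
move=> it; apply: (field_derivable_chart (@along_frame_field i l) it).
have E : \forall s \near t, cst (delta_mx 0 l : 'rV[R]_m) s = frame_field i l s i.
  by apply: filterS (frame_field_near l it) => s ->.
by apply: (near_eq_derivable E); exact: derivable_cst.
Qed.

Lemma D_frame_field i l t : dom i (gam t) ->
  D B (frame_field i l) t = \sum_p conn B i t l p *: frame i t p.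
Proof.
move=> it; apply: (tangent_inj it).
- by apply: D_tangent; [exact: along_frame_field|exact: frame_field_derivable].
- by apply: tangent_sum => p; apply: tangentZ; exact: tangent_frame_vec.
rewrite D_chart//.
have -> : derive1 (fun s => frame_field i l s i) t = 0.
  have E : \forall s \near t, cst (delta_mx 0 l : 'rV[R]_m) s = frame_field i l s i.
    by apply: filterS (frame_field_near l it) => s ->.
  by rewrite derive1E -(near_eq_derive (1 : R) E) derive_cst.
rewrite add0r frame_field_in// /frame tvec_of_self// -rowE fct_sumE [LHS]row_sum_delta.
apply: eq_bigr => p _; rewrite mxE.
by change (conn B i t l p *: delta_mx 0 p = conn B i t l p *: tvec_of i (gam t) (delta_mx 0 p) i); rewrite tvec_of_self.
Qed.

Definition chart_gram_deriv i t j l :=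
  (\sum_p conn B i t j p * chart_gram i t p l) + \sum_p conn B i t l p * chart_gram i t p j.

(** Compatibility of [D] with the metric, applied to two frame fields, expresses the derivative by
    connection coefficients and the Gram entries themselves. All of these are continuous, so the
    Gram entries are continuously differentiable. *)
Lemma is_derive_chart_gram i t j l : dom i (gam t) ->
  is_derive t (1 : R) (fun s => chart_gram i s j l) (chart_gram_deriv i t j l).
Proof.
move=> it; have fr p := tangent_frame_vec p it.
have := is_derive_dot (@along_frame_field i j) (@along_frame_field i l)
  (@frame_field_derivable i j t it) (@frame_field_derivable i l t it).
rewrite !D_frame_field// !frame_field_in// [dot t (frame i t j) _]dotC !dot_suml.
have E (a b : 'I_m) : \sum_p dot t (conn B i t a p *: frame i t p) (frame i t b) =
    \sum_p conn B i t a p * chart_gram i t p b.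
  by apply: eq_bigr => p _; rewrite dotZl mxE (metricE (fr p) (fr b)).
rewrite (E j l) (E l j).
apply: near_eq_is_derive; apply: filterS (gamma_near_dom it) => s is_.
by rewrite !frame_field_in// mxE (metricE (tangent_frame_vec j is_) (tangent_frame_vec l is_)).
Qed.

Lemma chart_gram_continuous i t j l : dom i (gam t) -> {for t, continuous (fun s => chart_gram i s j l)}.
Proof. by move=> it; exact: is_derive_continuous (is_derive_chart_gram j l it). Qed.

Lemma chart_gram_deriv_continuous i t j l : dom i (gam t) ->
  {for t, continuous (fun s => chart_gram_deriv i s j l)}.
Proof.
move=> it; apply: continuousD; apply: continuous_sum_at => p; apply: continuousM;
  by [exact: conn_continuous|exact: chart_gram_continuous].
Qed.

Lemma gamma_chart_itv t : exists i (e : R), 0 < e /\ forall s, t - e < s -> s < t + e -> dom i (gam s).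
Proof.
have [i it] := dom_cover (gam t); have /nbhs_normP[e /= e0 H] := gamma_near_dom it.
exists i, e; split => // s ts st; apply: H; rewrite /ball_/= ltr_distlC.
by rewrite ts st.
Qed.

(** Subdivision of a time interval into pieces, each lying in one chart; it reduces the regularity
    statements on arbitrary intervals to their chart versions. *)
Lemma chart_itv_ind (P : R -> R -> Prop) :
  (forall a b c, a <= b -> b <= c -> P a b -> P b c -> P a c) ->
  (forall i a b, a <= b -> (forall t, t \in `[a, b] -> dom i (gam t)) -> P a b) ->
  forall a b, a <= b -> P a b.
Proof.
move=> Pcat Ploc a b ab; apply: itv_ind => //; first by move=> x y z _ xy yz _; exact: Pcat.
move=> x _ _; have [i [e [e0 H]]] := gamma_chart_itv x; exists e => // y z _ yz _ xy zx.
apply: (Ploc i) => // t; rewrite in_itv/= => /andP[yt tz].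
by apply: H; [exact: lt_le_trans yt|exact: le_lt_trans zx].
Qed.

(** Membership in X without periodicity, so that the solutions [eta_a] and the fields
    [lambda_b zeta^b] are covered too. *)
Definition W12_field xi := along xi /\ forall i a b, a <= b ->
  (forall t, t \in `[a, b] -> dom i (gam t)) -> forall j, H1 a b (fun t => xi t i 0 j).

Lemma XspaceP xi : Xspace xi <-> W12_field xi /\ forall t, xi (t + tau S) = xi t.
Proof.
split=> [[xit xiT W]|[[xit W] xiT]].
  split => //; split => // i a b ab abi j; have [r H] := W i a b ab abi.
  by exists (fun t => r t 0 j); have [] := H j.
split => // i a b ab abi.
have H j : {r : R -> R | H1_deriv a b (fun t => xi t i 0 j) r} by apply: cid; exact: W.
exists (fun t => \row_j sval (H j) t) => j.
have E : (fun t => (\row_j sval (H j) t) 0 j) = sval (H j) by apply/funext => t; rewrite mxE.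
have [mr r2 HH] := svalP (H j); split.
- by rewrite E.
- by apply: eq_integrable r2 => // t _; rewrite /= mxE.
- by move=> t tab; rewrite E; exact: HH.
Qed.

(** * Regularity of the scalar integrands inside one chart *)

Section chart_interval.
Variables (i : atlas M) (a b : R).
Hypotheses (ab : a <= b) (abi : forall t, t \in `[a, b] -> dom i (gam t)).

Let abi_oo t : t \in `]a, b[ -> dom i (gam t). Proof. by move=> /subset_itv_oo_cc; exact: abi. Qed.

Let gram_within j l : {within `[a, b], continuous (fun t => chart_gram i t j l)}.
Proof. by apply: within_continuous => t /abi; exact: chart_gram_continuous. Qed.

Let conn_within j l : {within `[a, b], continuous (fun t => conn B i t j l)}.
Proof. by apply: within_continuous => t /abi; exact: conn_continuous. Qed.

Let W12_within xi j : W12_field xi -> {within `[a, b], continuous (fun t => xi t i 0 j)}.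
Proof. by move=> [_ W]; apply: H1_cont => //; exact: W. Qed.

Lemma W12_dot_chart xi eta : W12_field xi -> W12_field eta -> H1 a b (fun t => dot t (xi t) (eta t)).
Proof.
move=> [xit Wx] [etat We].
apply: (@H1_eq _ a b (fun t => \sum_j \sum_l xi t i 0 j * eta t i 0 l * chart_gram i t j l) _ ab).
  by move=> t tab; rewrite -(metricE (xit t) (etat t)) (metric_gram (abi tab)).
apply: H1_sum => j; apply: H1_sum => l; apply: H1M; first by apply: H1M; [exact: Wx|exact: We].
apply: H1_is_derive => // t tab; first exact: is_derive_chart_gram (abi tab).
exact: chart_gram_deriv_continuous (abi tab).
Qed.

Lemma W12_ae_chart xi : W12_field xi -> {ae mu, forall t, t \in `[a, b] -> field_derivable xi t}.
Proof.
move=> [xit W]; apply: ae_itv_oo.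
have H := ae_forall (fun j => H1_ae_derivable (W i a b ab abi j)).
apply: ae_imp H => t H tab; apply: (field_derivable_chart xit (abi_oo tab)).
by apply: derivable_row => j; exact: H.
Qed.

Lemma W12_D_chart xi j : W12_field xi -> L2 a b (fun t => D B xi t i 0 j).
Proof.
move=> Wxi; have [xit W] := Wxi.
apply: (@L2_ae _ a b (fun t => derive1 (fun s => xi s i) t 0 j + \sum_p xi t i 0 p * conn B i t p j)).
  by apply: ae_all => t tab; rewrite (D_chart xi (abi tab)) !mxE.
apply: L2D.
  apply: (H1_L2 (W i a b ab abi j)).
  have H := ae_forall (fun j => H1_ae_derivable (W i a b ab abi j)).
  by apply: ae_imp H => t H tab; apply: is_derive_coord; apply: derivable_row => l; exact: H.
apply: L2_cont; apply: within_sum => p; apply: within_M; first exact: W12_within.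
exact: conn_within.
Qed.

Lemma W12_ae_Dtangent_chart xi : W12_field xi ->
  {ae mu, forall t, t \in `[a, b] -> tangent (gam t) (D B xi t)}.
Proof.
move=> Wxi; apply: ae_imp (W12_ae_chart Wxi) => t H /H; apply: D_tangent; exact: Wxi.1.
Qed.

Lemma W12_dotD_chart xi eta : W12_field xi -> W12_field eta -> L2 a b (fun t => dot t (xi t) (D B eta t)).
Proof.
move=> Wxi Weta; have [xit W] := Wxi.
apply: (@L2_ae _ a b (fun t => \sum_j \sum_l (xi t i 0 j * chart_gram i t j l) * D B eta t i 0 l)).
  apply: ae_imp (W12_ae_Dtangent_chart Weta) => t H tab.
  rewrite -(metricE (xit t) (H tab)) (metric_gram (abi tab) (xit t) (H tab)).
  by apply: eq_bigr => j _; apply: eq_bigr => l _; rewrite mulrAC.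
apply: L2_sum => j; apply: L2_sum => l; apply: L2Mcont; last exact: W12_D_chart.
by apply: within_M => //; exact: W12_within.
Qed.

Lemma W12_DdotD_chart xi eta : W12_field xi -> W12_field eta ->
  L1 a b (fun t => dot t (D B xi t) (D B eta t)).
Proof.
move=> Wxi Weta.
apply: (@L1_ae _ a b (fun t => \sum_j \sum_l chart_gram i t j l * (D B xi t i 0 j * D B eta t i 0 l))).
  apply: ae_imp2 (W12_ae_Dtangent_chart Wxi) (W12_ae_Dtangent_chart Weta) => t H1 H2 tab.
  rewrite -(metricE (H1 tab) (H2 tab)) (metric_gram (abi tab) (H1 tab) (H2 tab)).
  by apply: eq_bigr => j _; apply: eq_bigr => l _; rewrite mulrC.
apply: L1_sum => j; apply: L1_sum => l; apply: L1Mcont => //.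
by apply: L2M; exact: W12_D_chart.
Qed.

Lemma W12_U_chart xi eta : W12_field xi -> W12_field eta -> L1 a b (fun t => dot t (U B t (xi t)) (eta t)).
Proof.
move=> Wxi Weta; have [xit _] := Wxi; have [etat _] := Weta.
apply: (@L1_ae _ a b (fun t => \sum_j \sum_l (\sum_p xi t i 0 p * pot B i t p j) * eta t i 0 l * chart_gram i t j l)).
  apply: ae_all => t tab; have Ut := U_tangent (xit t).
  rewrite -(metricE Ut (etat t)) (metric_gram (abi tab) Ut (etat t)).
  by apply: eq_bigr => j _; apply: eq_bigr => l _; rewrite (U_chart _ (abi tab)) !mxE.
apply: L1_sum => j; apply: L1_sum => l; apply: L1_cont; apply: within_M => //.
apply: within_M; last exact: W12_within.
apply: within_sum => p; apply: within_M; first exact: W12_within.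
by apply: within_continuous => t /abi; exact: pot_continuous.
Qed.

End chart_interval.

Lemma W12_dot xi eta a b : W12_field xi -> W12_field eta -> a <= b -> H1 a b (fun t => dot t (xi t) (eta t)).
Proof.
move=> Wx We; move: a b; apply: chart_itv_ind; first by move=> a b c; exact: H1_cat.
by move=> i a b ab abi; exact: (W12_dot_chart ab abi Wx We).
Qed.

Lemma W12_dotD xi eta a b : W12_field xi -> W12_field eta -> a <= b ->
  L2 a b (fun t => dot t (xi t) (D B eta t)).
Proof.
move=> Wx We; move: a b; apply: chart_itv_ind; first by move=> a b c; exact: L2_cat.
by move=> i a b ab abi; exact: (W12_dotD_chart ab abi Wx We).
Qed.

Lemma W12_DdotD xi eta a b : W12_field xi -> W12_field eta -> a <= b ->
  L1 a b (fun t => dot t (D B xi t) (D B eta t)).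
Proof.
move=> Wx We; move: a b; apply: chart_itv_ind; first by move=> a b c; exact: L1_cat.
by move=> i a b ab abi; exact: (W12_DdotD_chart ab abi Wx We).
Qed.

Lemma W12_U xi eta a b : W12_field xi -> W12_field eta -> a <= b ->
  L1 a b (fun t => dot t (U B t (xi t)) (eta t)).
Proof.
move=> Wx We; move: a b; apply: chart_itv_ind; first by move=> a b c; exact: L1_cat.
by move=> i a b ab abi; exact: (W12_U_chart ab abi Wx We).
Qed.

Lemma W12_ae xi : W12_field xi -> {ae mu, forall t, field_derivable xi t}.
Proof.
move=> Wx; apply: ae_loc => a b /ltW ab.
suff : {ae mu, forall t, t \in `[a, b] -> field_derivable xi t}.
  by apply: ae_imp => t H /subset_itv_oo_cc.
move: a b ab; apply: chart_itv_ind; last by move=> i a b ab abi; exact: (W12_ae_chart ab abi Wx).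
move=> a b c ab bc; apply: ae_imp2 => t H1 H2; rewrite in_itv/= => /andP[at_ tc].
have [tb|/ltW bt] := leP t b; [apply: H1|apply: H2]; first by rewrite in_itv/= at_.
by rewrite in_itv/= bt.
Qed.

End fields.

(** * Calculus of fields, and uniqueness for the variational system *)

Section field_calculus.
Context {R : realType} {m : nat} {S : lagrangian_system R m} (B : second_variation S).
Local Notation M := (config S).
Local Notation gam := (gamma S).
Local Notation mu := (@lebesgue_measure R).
Implicit Types (t a b : R) (i : atlas M) (xi eta : field S).

Definition fscale (x : R -> R) xi : field S := fun t => x t *: xi t.

Lemma is_derive_fscale_chart x xi t (dx : R) i : is_derive t (1 : R) x dx ->
  derivable (fun s => xi s i) t 1 -> derivable (fun s => fscale x xi s i) t 1 /\
  derive1 (fun s => fscale x xi s i) t = dx *: xi t i + x t *: derive1 (fun s => xi s i) t.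
Proof.
move=> xd xid.
have H j : is_derive t (1 : R) (fun s => fscale x xi s i 0 j)
    (dx * xi t i 0 j + x t * derive1 (fun s => xi s i) t 0 j).
  have E : (fun s => x s * xi s i 0 j) = (fun s => fscale x xi s i 0 j).
    apply/funext => s; change (x s * xi s i 0 j = (x s *: xi s i) 0 j); by rewrite mxE.
  by rewrite -E; exact: is_derive_funM xd (is_derive_coord j xid).
have D1 : derivable (fun s => fscale x xi s i) t 1.
  by apply: derivable_row => j; exact: (ex_derive (is_derive := H j)).
split => //; apply/rowP => j; rewrite (derive1_coord D1 (H j)).
by rewrite !mxE.
Qed.

Lemma along_fscale x xi : along xi -> along (fscale x xi).
Proof. by move=> xit t; apply: tangentZ; exact: xit. Qed.

Lemma field_derivable_fscale x xi t (dx : R) : is_derive t (1 : R) x dx -> field_derivable xi t ->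
  field_derivable (fscale x xi) t.
Proof. by move=> xd xid i it; have [] := is_derive_fscale_chart xd (xid i it). Qed.

Lemma D_fscale x xi t (dx : R) : along xi -> is_derive t (1 : R) x dx -> field_derivable xi t ->
  D B (fscale x xi) t = dx *: xi t + x t *: D B xi t.
Proof.
move=> xit xd xid; apply/funext => i.
change (D B (fscale x xi) t i = dx *: xi t i + x t *: D B xi t i).
have [it|it] := pselect (dom i (gam t)); last first.
  by rewrite (tangent_out (xit t) it) /D /cov_of !asboolF// !scaler0 addr0.
have [_ E] := is_derive_fscale_chart xd (xid i it).
rewrite !D_chart// E; change (fscale x xi t i) with (x t *: xi t i).
by rewrite scalerDr -scalemxAl addrA.
Qed.

Lemma field_derivableD xi eta t : field_derivable xi t -> field_derivable eta t ->
  field_derivable (xi + eta) t.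
Proof. by move=> x e i it; exact: derivableD (x i it) (e i it). Qed.

Lemma D_D xi eta t : field_derivable xi t -> field_derivable eta t ->
  D B (xi + eta) t = D B xi t + D B eta t.
Proof.
move=> x e; apply/funext => i.
change (D B (xi + eta) t i = D B xi t i + D B eta t i).
have [it|it] := pselect (dom i (gam t)); last by rewrite /D /cov_of !asboolF// addr0.
rewrite !D_chart//.
have -> : derive1 (fun s => (xi + eta) s i) t = derive1 (fun s => xi s i) t + derive1 (fun s => eta s i) t.
  by rewrite !derive1E -deriveD//; [exact: x|exact: e].
change ((xi + eta) t i) with (xi t i + eta t i).
by rewrite mulmxDl addrACA.
Qed.

Lemma field_derivable0 t : field_derivable (0 : field S) t.
Proof. by move=> i it; exact: derivable_cst. Qed.

Lemma fscale_cst (c : R) xi : fscale (cst c) xi = c *: xi.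
Proof. by []. Qed.

Lemma field_derivableZ (c : R) xi t : field_derivable xi t -> field_derivable (c *: xi) t.
Proof. exact: (field_derivable_fscale (is_derive_cst c t 1)). Qed.

Lemma D_Z (c : R) xi t : along xi -> field_derivable xi t -> D B (c *: xi) t = c *: D B xi t.
Proof.
by move=> xit xd; rewrite -fscale_cst (D_fscale xit (is_derive_cst c t 1) xd) scale0r add0r.
Qed.

Lemma D_0 t : D B (0 : field S) t = 0.
Proof.
have := D_D (@field_derivable0 t) (@field_derivable0 t); rewrite addr0 => E.
by apply: (addrI (D B 0 t)); rewrite -E addr0.
Qed.

Lemma D_sum (I : finType) (F : I -> field S) t : (forall c : I, field_derivable (F c) t) ->
  field_derivable (\sum_a F a) t /\ D B (\sum_a F a) t = \sum_a D B (F a) t.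
Proof.
move=> Fd; elim/big_rec2: _ => [|a y x _ [yd yE]].
  by split; [exact: field_derivable0|exact: D_0].
split; first exact: (field_derivableD (Fd a) yd).
by rewrite (D_D (Fd a) yd) yE.
Qed.

Lemma along_sum (I : finType) (F : I -> field S) : (forall c : I, along (F c)) -> along (\sum_a F a).
Proof. by move=> Ft t; rewrite fct_sumE; apply: tangent_sum => a; exact: Ft. Qed.

Lemma alongD xi eta : along xi -> along eta -> along (xi + eta).
Proof. by move=> x e t; apply: tangentD; [exact: x|exact: e]. Qed.

Lemma alongZ (c : R) xi : along xi -> along (c *: xi).
Proof. by move=> x t; apply: tangentZ; exact: x. Qed.

Lemma alongB xi eta : along xi -> along eta -> along (xi - eta).
Proof. by move=> x e t; apply: tangentB; [exact: x|exact: e]. Qed.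

Lemma W12_fieldD xi eta : W12_field xi -> W12_field eta -> W12_field (xi + eta).
Proof.
move=> [xt Wx] [et We]; split; first exact: alongD.
move=> i a b ab abi j.
apply: (@H1_eq _ a b (fun t => xi t i 0 j + eta t i 0 j) _ ab).
  by move=> t _; change (xi t i 0 j + eta t i 0 j = (xi t i + eta t i) 0 j); rewrite mxE.
by apply: H1D; [exact: Wx|exact: We].
Qed.

Lemma W12_fscale x xi : (forall a b, a <= b -> H1 a b x) -> W12_field xi -> W12_field (fscale x xi).
Proof.
move=> xH [xt Wx]; split; first exact: along_fscale.
move=> i a b ab abi j; apply: (@H1_eq _ a b (fun t => x t * xi t i 0 j) _ ab).
  by move=> t _; change (x t * xi t i 0 j = (x t *: xi t i) 0 j); rewrite mxE.
by apply: H1M; [exact: xH|exact: Wx].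
Qed.

Lemma W12_fieldZ (c : R) xi : W12_field xi -> W12_field (c *: xi).
Proof. by move=> Wx; rewrite -fscale_cst; apply: W12_fscale => // a b _; exact: H1_cst. Qed.

Lemma W12_fieldB xi eta : W12_field xi -> W12_field eta -> W12_field (xi - eta).
Proof. by move=> Wx We; rewrite -scaleN1r; apply: W12_fieldD => //; exact: W12_fieldZ. Qed.

Lemma W12_field0 : W12_field (0 : field S).
Proof.
split=> [t|i a b ab abi j]; first exact: tangent0.
apply: (H1_eq ab _ (H1_cst a b 0)) => t _.
by change (0 = (0 : 'rV[R]_m) 0 j); rewrite mxE.
Qed.

Lemma W12_field_sum (I : finType) (F : I -> field S) : (forall c : I, W12_field (F c)) ->
  W12_field (\sum_a F a).
Proof. by move=> FW; apply: (big_ind W12_field) => //; [exact: W12_field0|exact: W12_fieldD]. Qed.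

Lemma tangentT t : tangent (gam (t + tau S)) = tangent (gam t).
Proof. by rewrite gamma_periodic. Qed.

Lemma D_shift xi t : D B (fun s => xi (s + tau S)) t = D B xi (t + tau S).
Proof.
apply/funext => i; rewrite /D /cov_of gamma_periodic; case: asboolP => // it.
rewrite (conn_periodic B it).
exact: (congr1 (fun y => y + xi (t + tau S) i *m conn B i t) (derive1_shift (fun s => xi s i) (tau S) t)).
Qed.

Lemma U_T t v : U B (t + tau S) v = U B t v.
Proof.
apply/funext => i; rewrite /U /endo_of gamma_periodic; case: asboolP => // it.
by rewrite pot_periodic.
Qed.

Lemma field_derivable_shift xi t : field_derivable xi (t + tau S) ->
  field_derivable (fun s => xi (s + tau S)) t.
Proof.
move=> xd i it; apply: (@derivable_shift _ _ (fun s => xi s i)); apply: xd.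
by rewrite gamma_periodic.
Qed.

Lemma solution_along xi : solution B xi -> along xi.
Proof. by case. Qed.

Lemma solution_derivable xi t : solution B xi -> field_derivable xi t.
Proof. by case=> _ /(_ t)[]. Qed.

Lemma solution_D_derivable xi t : solution B xi -> field_derivable (D B xi) t.
Proof. by case=> _ /(_ t)[]. Qed.

Lemma solution_DD xi t : solution B xi -> D B (D B xi) t = U B t (xi t).
Proof. by case=> _ /(_ t)[]. Qed.

Lemma solution_along_D xi : solution B xi -> along (D B xi).
Proof. by move=> sx t; apply: D_tangent; [exact: solution_along|exact: solution_derivable]. Qed.

Lemma solution_shift xi : solution B xi -> solution B (fun t => xi (t + tau S)).
Proof.
move=> sx; have E : D B (fun s => xi (s + tau S)) = (fun s => D B xi (s + tau S)).
  by apply/funext => t; rewrite D_shift.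
split; first by move=> t; rewrite -tangentT; exact: solution_along.
move=> t; split.
- exact/field_derivable_shift/solution_derivable.
- by rewrite E; exact/field_derivable_shift/solution_D_derivable.
- by rewrite E D_shift solution_DD// U_T.
Qed.

Lemma U_D t u v : U B t (u + v) = U B t u + U B t v.
Proof.
apply/funext => i; change (U B t (u + v) i = U B t u i + U B t v i); rewrite /U /endo_of.
by case: asboolP => it; rewrite ?addr0//; change ((u + v) i) with (u i + v i); rewrite mulmxDl.
Qed.

Lemma U_Z t (c : R) u : U B t (c *: u) = c *: U B t u.
Proof.
apply/funext => i; change ((c *: U B t u) i) with (c *: U B t u i); rewrite /U /endo_of.
by case: asboolP => it; rewrite ?scaler0//; change ((c *: u) i) with (c *: u i); rewrite scalemxAl.
Qed.

Lemma solutionD xi eta : solution B xi -> solution B eta -> solution B (xi + eta).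
Proof.
move=> sx se; have E : D B (xi + eta) = D B xi + D B eta.
  by apply/funext => t; rewrite D_D//; exact: solution_derivable.
split; first by apply: alongD; exact: solution_along.
move=> t; split.
- by apply: field_derivableD; exact: solution_derivable.
- by rewrite E; apply: field_derivableD; exact: solution_D_derivable.
- rewrite E D_D; [|exact: solution_D_derivable..].
  by rewrite !solution_DD// -U_D.
Qed.

Lemma solutionZ (c : R) xi : solution B xi -> solution B (c *: xi).
Proof.
move=> sx; have E : D B (c *: xi) = c *: D B xi.
  by apply/funext => t; rewrite D_Z//; [exact: solution_along|exact: solution_derivable].
split; first by apply: alongZ; exact: solution_along.
move=> t; split.
- by apply: field_derivableZ; exact: solution_derivable.
- by rewrite E; apply: field_derivableZ; exact: solution_D_derivable.
- rewrite E D_Z; [|exact: solution_along_D|exact: solution_D_derivable].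
  by rewrite solution_DD// -U_Z.
Qed.

Lemma solution0 : solution B 0.
Proof.
have E : D B 0 = 0 by apply/funext => t; exact: D_0.
split; first by move=> t; exact: tangent0.
move=> t; rewrite E D_0; split; [exact: field_derivable0|exact: field_derivable0|].
by have := U_Z t 0 0; rewrite !scale0r.
Qed.

Lemma solution_sum (I : finType) (F : I -> field S) : (forall c : I, solution B (F c)) ->
  solution B (\sum_a F a).
Proof. by move=> sF; apply: (big_ind (solution B)) => //; [exact: solution0|exact: solutionD]. Qed.

Lemma is_derive_field_chart xi t i j : dom i (gam t) -> field_derivable xi t ->
  is_derive t (1 : R) (fun s => xi s i 0 j) (D B xi t i 0 j - \sum_p xi t i 0 p * conn B i t p j).
Proof.
move=> it xd; apply: (is_derive1_eq (is_derive_coord j (xd i it))).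
by rewrite D_chart// !mxE addrK.
Qed.

Lemma W12_C1 xi : along xi -> (forall t, field_derivable xi t) ->
  (forall t, field_derivable (D B xi) t) -> W12_field xi.
Proof.
move=> xt xd Dd; split => // i a b ab abi j.
apply: (@H1_is_derive _ _ _ _ (fun t => D B xi t i 0 j - \sum_p xi t i 0 p * conn B i t p j) ab).
  by move=> t tab; exact: is_derive_field_chart (abi t tab) (xd t).
move=> t /abi it; apply: continuousB.
  exact: is_derive_continuous (is_derive_field_chart j it (Dd t)).
apply: continuous_sum_at => p; apply: continuousM; last exact: conn_continuous.
exact: is_derive_continuous (is_derive_field_chart p it (xd t)).
Qed.

Lemma solution_W12 xi : solution B xi -> W12_field xi.
Proof.
move=> sx; apply: W12_C1; first exact: solution_along.
  by move=> t; exact: solution_derivable.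
by move=> t; exact: solution_D_derivable.
Qed.

Lemma solution_W12_D xi : solution B xi -> W12_field (D B xi).
Proof.
move=> sx; split; first exact: solution_along_D.
move=> i a b ab abi j.
apply: (@H1_is_derive _ _ _ _ (fun t => (\sum_p xi t i 0 p * pot B i t p j) - \sum_p D B xi t i 0 p * conn B i t p j) ab).
  move=> t tab; apply: (is_derive1_eq (is_derive_field_chart j (abi t tab) (@solution_D_derivable xi t sx))).
  by rewrite solution_DD// (U_chart B _ (abi t tab)) mxE.
move=> t /abi it; apply: continuousB; apply: continuous_sum_at => p; apply: continuousM.
- exact: is_derive_continuous (is_derive_field_chart p it (@solution_derivable xi t sx)).
- exact: pot_continuous.
- exact: is_derive_continuous (is_derive_field_chart p it (@solution_D_derivable xi t sx)).
- exact: conn_continuous.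
Qed.

(** In a chart the components of [xi] and [D xi] together solve a linear first-order system whose
    coefficients, built from [conn] and [pot], are bounded on the segment, so [gronwall_local]
    applies. *)
Lemma solution_unique_local xi i a b t0 : solution B xi -> (forall t, t \in `[a, b] -> dom i (gam t)) ->
  t0 \in `]a, b[ -> xi t0 = 0 -> D B xi t0 = 0 -> forall t, t \in `]a, b[ -> xi t = 0 /\ D B xi t = 0.
Proof.
move=> sx abi t0ab x0 d0.
pose y (q : 'I_m + 'I_m) t := match q with inl j => xi t i 0 j | inr j => D B xi t i 0 j end.
pose dy (q : 'I_m + 'I_m) t := match q with
  | inl j => D B xi t i 0 j - \sum_p xi t i 0 p * conn B i t p j
  | inr j => (\sum_p xi t i 0 p * pot B i t p j) - \sum_p D B xi t i 0 p * conn B i t p j end.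
have [K [K0 HK]] : exists K : R, 0 <= K /\ forall t, t \in `[a, b] -> forall p j,
    `|conn B i t p j| <= K /\ `|pot B i t p j| <= K.
  have [|K [K0 HK]] := @within_bounded _ a b (fun t => \sum_p \sum_j (`|conn B i t p j| + `|pot B i t p j|)).
    apply: within_continuous => t /abi it; apply: continuous_sum_at => p; apply: continuous_sum_at => j.
    apply: continuousD; apply: (continuous_comp _ (@norm_continuous _ _ _)).
      exact: conn_continuous.
    exact: pot_continuous.
  exists K; split => // t /HK; rewrite ger0_norm; last first.
    by apply: sumr_ge0 => p _; apply: sumr_ge0 => j _; rewrite addr_ge0.
  move=> Kt p j; suff : `|conn B i t p j| + `|pot B i t p j| <= K.
    by move=> H; split; apply: le_trans H; rewrite ?lerDl ?lerDr.
  apply: le_trans Kt; rewrite (bigD1 p)//= (bigD1 j)//= -addrA lerDl addr_ge0//.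
    by apply: sumr_ge0 => j' _; rewrite addr_ge0.
  by apply: sumr_ge0 => p' _; apply: sumr_ge0 => j' _; rewrite addr_ge0.
have yd q t : t \in `]a, b[ -> is_derive t (1 : R) (y q) (dy q t).
  move=> /subset_itv_oo_cc/abi it; case: q => j /=.
    exact: is_derive_field_chart it (@solution_derivable xi t sx).
  apply: (is_derive1_eq (is_derive_field_chart j it (@solution_D_derivable xi t sx))).
  by rewrite solution_DD// (U_chart B _ it) mxE.
have SE t : \sum_q `|y q t| = \sum_p `|xi t i 0 p| + \sum_p `|D B xi t i 0 p| by rewrite big_sumType.
have bnd (f : 'I_m -> R) (A : 'I_m -> R) : (forall p, `|A p| <= K) ->
    `|\sum_p f p * A p| <= K * \sum_p `|f p|.
  move=> HA; rewrite (le_trans (ler_norm_sum _ _ _))// mulr_sumr; apply: ler_sum => p _.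
  by rewrite normrM mulrC ler_wpM2r.
(* The 1 pays for the term [D xi] in the equation for [xi]; the entries of [conn] and [pot] cost at
   most [K]. *)
have yK q t : t \in `]a, b[ -> `|dy q t| <= (1 + K) * \sum_r `|y r t|.
  move=> /subset_itv_oo_cc tab; rewrite SE; have HKt := HK t tab.
  have X0 : 0 <= \sum_p `|xi t i 0 p| by exact: sumr_ge0.
  have D0 : 0 <= \sum_p `|D B xi t i 0 p| by exact: sumr_ge0.
  case: q => j /=; rewrite (le_trans (ler_normB _ _))//.
    have B1 := bnd (fun p => xi t i 0 p) (fun p => conn B i t p j) (fun p => (HKt p j).1).
    have B2 : `|D B xi t i 0 j| <= \sum_p `|D B xi t i 0 p|.
      by rewrite (bigD1 j)//= lerDl; exact: sumr_ge0.
    by apply: (le_trans (lerD B2 B1)); nra.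
  have B1 := bnd (fun p => xi t i 0 p) (fun p => pot B i t p j) (fun p => (HKt p j).2).
  have B2 := bnd (fun p => D B xi t i 0 p) (fun p => conn B i t p j) (fun p => (HKt p j).1).
  by apply: (le_trans (lerD B1 B2)); nra.
have y0 q : y q t0 = 0.
  case: q => j /=; rewrite ?x0 ?d0; change ((0 : 'rV[R]_m) 0 j = 0); by rewrite mxE.
have yz := gronwall_local t0ab yd yK y0.
move=> t tab; have it := abi _ (subset_itv_oo_cc tab).
split.
  have st : tangent (gam t) (xi t) by exact: solution_along.
  apply: (tangent_inj it st (tangent0 _)).
  by apply/rowP => j; rewrite [RHS]mxE; exact: (yz (inl j) t tab).
have st : tangent (gam t) (D B xi t) by exact: solution_along_D.
apply: (tangent_inj it st (tangent0 _)).
by apply/rowP => j; rewrite [RHS]mxE; exact: (yz (inr j) t tab).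
Qed.

Lemma solution_zero xi : solution B xi -> xi 0 = 0 -> D B xi 0 = 0 -> xi = 0.
Proof.
move=> sx x0 d0; pose Z t := xi t = 0 /\ D B xi t = 0.
(* An equivalence and not an implication, because vanishing has to spread from time 0 in both
   directions. *)
suff H a b : a <= b -> (Z a <-> Z b).
  by apply/funext => t; have [t0|/ltW t0] := leP 0 t; have [] := (H _ _ t0) => H1 H2;
    [have [] := H1 (conj x0 d0)|have [] := H2 (conj x0 d0)].
move=> ab; apply: (@itv_ind R (fun a b => Z a <-> Z b)) => //.
  by move=> x y z _ _ _ _ [? ?] [? ?]; split => ?; auto.
move=> x _ _; have [i [e [e0 He]]] := @gamma_chart_itv R m S x.
(* Halving puts the closed interval of radius [e / 2] inside the chart. *)
have e2 : 0 < e / 2 by rewrite divr_gt0.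
exists (e / 2) => // y z _ yz _ xy zx.
have He' t : t \in `[x - e / 2, x + e / 2] -> dom i (gam t).
  by rewrite in_itv/= => /andP[? ?]; apply: He; lra.
have yI : y \in `]x - e / 2, x + e / 2[ by rewrite in_itv/= xy (le_lt_trans yz zx).
have zI : z \in `]x - e / 2, x + e / 2[ by rewrite in_itv/= zx (lt_le_trans xy yz).
split=> -[h1 h2].
  exact: (solution_unique_local sx He' yI h1 h2 zI).
exact: (solution_unique_local sx He' zI h1 h2 yI).
Qed.

(** By this lemma relations between initial phases, such as those describing the Poincare map,
    become identities between fields. *)
Lemma solution_eq xi eta : solution B xi -> solution B eta ->
  phase_at B xi 0 = phase_at B eta 0 -> xi = eta.
Proof.
move=> sx se [E1 E2]; apply/eqP; rewrite -subr_eq0; apply/eqP.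
have seN : solution B (- eta) by rewrite -scaleN1r; exact: solutionZ.
apply: solution_zero; first exact: solutionD.
  by change (xi 0 - eta 0 = 0); rewrite E1 subrr.
rewrite D_D; [|exact: solution_derivable..].
rewrite -scaleN1r D_Z; [|exact: solution_along|exact: solution_derivable].
by rewrite E2 scaleN1r subrr.
Qed.

End field_calculus.

(** * The Gram matrix and the orthogonal projection *)

Section C1_functions.
Context {R : realType}.
Implicit Types (f g : R -> R) (t : R).

Definition C1_fun f := exists2 g : R -> R,
  forall t, is_derive t (1 : R) f (g t) & forall t, {for t, continuous g}.

Lemma C1_fun_continuous f t : C1_fun f -> {for t, continuous f}.
Proof. by move=> [g fg _]; exact: is_derive_continuous (fg t). Qed.

Lemma C1_fun_derivable f t : C1_fun f -> derivable f t 1.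
Proof. by move=> [g fg _]; exact: (ex_derive (is_derive := fg t)). Qed.

Lemma C1_fun_H1 f a b : a <= b -> C1_fun f -> H1 a b f.
Proof.  by move=> ab [g fg gc]; exact (H1_is_derive ab (fun t _ => fg t) (fun t _ => gc t)). Qed.

Lemma C1_fun_cst (c : R) : C1_fun (fun=> c).
Proof.
exists (fun=> 0) => t; first exact: is_derive_cst.
exact: cst_continuous.
Qed.

Lemma C1_funD f g : C1_fun f -> C1_fun g -> C1_fun (fun t => f t + g t).
Proof.
move=> [df fd fc] [dg gd gc]; exists (fun t => df t + dg t) => t.
  exact: is_derive_funD.
by apply: continuousD; [exact: fc|exact: gc].
Qed.

Lemma C1_funM f g : C1_fun f -> C1_fun g -> C1_fun (fun t => f t * g t).
Proof.
move=> Cf Cg; have [df fd fc] := Cf; have [dg gd gc] := Cg.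
exists (fun t => df t * g t + f t * dg t) => t; first exact: is_derive_funM.
by apply: continuousD; apply: continuousM; [exact: fc|exact: C1_fun_continuous|exact: C1_fun_continuous|exact: gc].
Qed.

Lemma C1_funV f : (forall t, f t != 0) -> C1_fun f -> C1_fun (fun t => (f t)^-1).
Proof.
move=> f0 Cf; have [df fd fc] := Cf.
have Hd t : is_derive t (1 : R) (fun t => (f t)^-1) (- ((f t)^-1 * (f t)^-1) * df t).
  by apply: (is_derive1_eq (is_deriveV (f0 t) (fd t))); rewrite /GRing.scale/= -exprVn expr2.
exists (fun t => - ((f t)^-1 * (f t)^-1) * df t) => // t.
apply: continuousM; last exact: fc.
by apply: continuousN; apply: continuousM; exact: is_derive_continuous (Hd t).
Qed.

Lemma C1_fun_sum (I : finType) (F : I -> R -> R) : (forall i, C1_fun (F i)) ->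
  C1_fun (fun t => \sum_i F i t).
Proof.
move=> CF; elim: (index_enum I) => [|i r ih].
  by under eq_fun do rewrite big_nil; exact: C1_fun_cst.
by under eq_fun do rewrite big_cons; exact: C1_funD.
Qed.

Lemma C1_fun_prod (I : finType) (F : I -> R -> R) : (forall i, C1_fun (F i)) ->
  C1_fun (fun t => \prod_i F i t).
Proof.
move=> CF; elim: (index_enum I) => [|i r ih].
  by under eq_fun do rewrite big_nil; exact: C1_fun_cst.
by under eq_fun do rewrite big_cons; exact: C1_funM.
Qed.

Lemma C1_fun_det n (A : R -> 'M[R]_n) : (forall i j, C1_fun (fun t => A t i j)) ->
  C1_fun (fun t => \det (A t)).
Proof.
move=> CA; apply: C1_fun_sum => s; apply: C1_funM; first exact: C1_fun_cst.
by apply: C1_fun_prod => i; exact: CA.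
Qed.

(** By Cramer's rule each entry is a cofactor divided by the determinant. *)
Lemma C1_fun_invmx n (A : R -> 'M[R]_n) : (forall t, A t \in unitmx) ->
  (forall i j, C1_fun (fun t => A t i j)) -> forall i j, C1_fun (fun t => invmx (A t) i j).
Proof.
move=> uA CA i j.
have -> : (fun t => invmx (A t) i j) =
    (fun t => (\det (A t))^-1 * ((-1) ^+ (j + i) * \det (row' j (col' i (A t))))).
  by apply/funext => t; rewrite /invmx uA !mxE.
apply: C1_funM.
  apply: C1_funV; last exact: C1_fun_det.
  by move=> t; have := uA t; rewrite unitmxE unitfE.
apply: C1_funM; first exact: C1_fun_cst.
by apply: C1_fun_det => p q; under eq_fun do rewrite !mxE; exact: CA.
Qed.

End C1_functions.

Section bilinear_forms.
Context {R : realType} {k : nat}.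
Implicit Types (H : 'M[R]_k) (u v : 'I_k -> R).

Definition bil H u v := \sum_a \sum_b H a b * u a * v b.

Lemma bilC H u v : (forall a b, H a b = H b a) -> bil H u v = bil H v u.
Proof.
move=> HC; rewrite /bil exchange_big; apply: eq_bigr => a _; apply: eq_bigr => b _.
by rewrite HC mulrAC.
Qed.

Lemma bilPr H u v w (c : R) : bil H u (fun a => c * v a + w a) = c * bil H u v + bil H u w.
Proof.
rewrite /bil mulr_sumr -big_split; apply: eq_bigr => a _.
rewrite mulr_sumr -big_split; apply: eq_bigr => b _ /=; ring.
Qed.

Lemma bil_sum H u v w : (forall a, w a = \sum_b H a b * v b) -> \sum_a w a * u a = bil H u v.
Proof.
move=> wE; apply: eq_bigr => a _; rewrite wE mulr_suml; apply: eq_bigr => b _; ring.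
Qed.

Lemma bil_ext H u u' v v' : u =1 u' -> v =1 v' -> bil H u v = bil H u' v'.
Proof. by move=> uE vE; apply: eq_bigr => a _; apply: eq_bigr => b _; rewrite uE vE. Qed.

End bilinear_forms.

Section periodic_solutions.
Context {R : realType} {m : nat} {S : lagrangian_system R m} (B : second_variation S).
Context {k : nat} (zeta : 'I_k -> field S).
Local Notation M := (config S).
Local Notation gam := (gamma S).
Local Notation mu := (@lebesgue_measure R).
Local Notation D := (D B).
Local Notation U := (U B).
Implicit Types (t : R) (xi eta : field S) (a b c : 'I_k).

Hypothesis zeta_sol : forall a, solution B (zeta a).
Hypothesis zeta_free : forall t, lin_indep (fun a => zeta a t).

Lemma zeta_tangent a t : tangent (gam t) (zeta a t).
Proof. exact: solution_along. Qed.

Lemma zeta_along a : along (zeta a).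
Proof. exact: solution_along. Qed.

Lemma zeta_along_D a : along (D (zeta a)).
Proof. exact: solution_along_D. Qed.

Lemma zeta_derivable a t : field_derivable (zeta a) t.
Proof. exact: solution_derivable. Qed.

Lemma zeta_D_derivable a t : field_derivable (D (zeta a)) t.
Proof. exact: solution_D_derivable. Qed.

Lemma zeta_W12 a : W12_field (zeta a).
Proof. exact: solution_W12 (zeta_sol a). Qed.

Lemma zeta_D_W12 a : W12_field (D (zeta a)).
Proof. exact: solution_W12_D (zeta_sol a). Qed.

Local Notation gm := (gram zeta).
Local Notation hm := (gram_inv zeta).

Lemma gramE t a b : gm t a b = dot t (zeta a t) (zeta b t).
Proof. by rewrite mxE (metricE (@zeta_tangent a t) (@zeta_tangent b t)). Qed.

Lemma gram_sym t a b : gm t a b = gm t b a.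
Proof. by rewrite !gramE dotC. Qed.

Lemma tangent_comb t (x : 'I_k -> R) : tangent (gam t) (\sum_a x a *: zeta a t).
Proof. by apply: tangent_sum => a; apply: tangentZ; exact: zeta_tangent. Qed.

Lemma dot_comb t (x : 'I_k -> R) u : dot t (\sum_a x a *: zeta a t) u = \sum_a x a * dot t (zeta a t) u.
Proof. by rewrite dot_suml; apply: eq_bigr => a _; rewrite dotZl. Qed.

Lemma gram_gt0 t (x : 'I_k -> R) : (exists a, x a != 0) ->
  0 < dot t (\sum_a x a *: zeta a t) (\sum_a x a *: zeta a t).
Proof.
move=> [a xa]; apply: dot_gt0; first exact: tangent_comb.
by apply: contraNneq xa => E; rewrite (zeta_free E).
Qed.

(** A kernel vector would give a nonzero combination of the [zeta a t] orthogonal to all of them,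
    hence to itself. *)
Lemma gram_unit t : gm t \in unitmx.
Proof.
rewrite unitmxE unitfE; apply/negP => /det0P[v v0 vG].
have [a va] : exists a, v 0 a != 0.
  by apply: contrapT => H; move/negP: v0; apply; apply/eqP/rowP => a; rewrite mxE;
    apply/eqP; apply: contrapT => va; apply: H; exists a; apply/negP.
have := gram_gt0 t (ex_intro (fun a => v 0 a != 0) a va).
rewrite dot_comb big1 ?ltxx// => b _.
rewrite dotC dot_comb; have /rowP/(_ b) := vG; rewrite !mxE => E.
rewrite (_ : \sum_a _ = 0) ?mulr0// -[RHS]E; apply: eq_bigr => c _.
by rewrite gramE.
Qed.

Lemma gram_inv_sym t a b : hm t a b = hm t b a.
Proof.
have H : (gm t)^T = gm t by apply/matrixP => i j; rewrite mxE gram_sym.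
have E : (hm t)^T = hm t by rewrite /gram_inv trmx_inv H.
by rewrite -{1}E mxE.
Qed.

Lemma gram_invK t a b : \sum_c hm t a c * gm t c b = (a == b)%:R.
Proof. by have /matrixP/(_ a b) := mulVmx (gram_unit t); rewrite !mxE. Qed.

Lemma gramK t a b : \sum_c gm t a c * hm t c b = (a == b)%:R.
Proof. by have /matrixP/(_ a b) := mulmxV (gram_unit t); rewrite !mxE. Qed.

Lemma gram_inv_solve t (x y : 'I_k -> R) : (forall a, y a = \sum_b gm t a b * x b) ->
  forall a, x a = \sum_b hm t a b * y b.
Proof.
move=> yE a; under eq_bigr do rewrite yE mulr_sumr.
rewrite exchange_big/=; under eq_bigr => c _.
  under eq_bigr do rewrite mulrA.
  rewrite -mulr_suml gram_invK; over.
by rewrite (bigD1 a)//= eqxx mul1r big1 ?addr0// => c ca; rewrite eq_sym (negbTE ca) mul0r.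
Qed.

Lemma gram_solve t (x y : 'I_k -> R) : (forall a, y a = \sum_b hm t a b * x b) ->
  forall a, x a = \sum_b gm t a b * y b.
Proof.
move=> yE a; under eq_bigr do rewrite yE mulr_sumr.
rewrite exchange_big/=; under eq_bigr => c _.
  under eq_bigr do rewrite mulrA.
  rewrite -mulr_suml gramK; over.
by rewrite (bigD1 a)//= eqxx mul1r big1 ?addr0// => c ca; rewrite eq_sym (negbTE ca) mul0r.
Qed.

(** With [y] the image of [x] under the inverse Gram matrix, the value is the squared length of the
    combination of the [zeta a t] with coefficients [y]. *)
Lemma gram_inv_gt0 t (x : 'I_k -> R) : (exists a, x a != 0) -> 0 < bil (hm t) x x.
Proof.
move=> [a xa]; pose y a := \sum_b hm t a b * x b.
have xE : forall a, x a = \sum_b gm t a b * y b by apply: gram_solve.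
have ye : exists a, y a != 0.
  apply: contrapT => H; move/negP: xa; apply; rewrite xE big1// => b _.
  suff -> : y b = 0 by rewrite mulr0.
  by apply/eqP; apply: contrapT => yb; apply: H; exists b; apply/negP.
have := gram_gt0 t ye; congr (0 < _).
rewrite -(@bil_sum _ _ (hm t) x x y)// dot_comb; apply: eq_bigr => b _.
rewrite dotC dot_comb xE; congr (_ * _); apply: eq_bigr => c _.
by rewrite gramE dotC mulrC.
Qed.

(** Coordinates, in the basis [zeta b t], of the orthogonal projection of [v] onto F_t. *)
Definition coef t v a := \sum_b hm t a b * dot t v (zeta b t).

Lemma coef_comb t (x : 'I_k -> R) a : coef t (\sum_b x b *: zeta b t) a = x a.
Proof.
apply/esym/gram_inv_solve => b; rewrite dot_comb; apply: eq_bigr => c _.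
by rewrite gramE dotC mulrC.
Qed.

Lemma Fspace_coef t u : Fspace zeta t u -> u = \sum_a coef t u a *: zeta a t.
Proof. by move=> [x ->]; apply: eq_bigr => a _; rewrite coef_comb. Qed.

Lemma proj_unique t u u' v : Eperp zeta t u -> Fspace zeta t (v - u) ->
  Eperp zeta t u' -> Fspace zeta t (v - u') -> u = u'.
Proof.
move=> [ut up] [x Ex] [ut' up'] [x' Ex'].
have dt : tangent (gam t) (u - u') by exact: tangentB.
have F : Fspace zeta t (u - u').
  exists (fun a => x' a - x a); under eq_bigr do rewrite scalerBl.
  by rewrite sumrB -Ex -Ex' opprB [RHS]addrC addrA subrK.
apply/eqP; rewrite -subr_eq0; apply: contrapT => /negP d0.
have := dot_gt0 dt d0; rewrite dotBl.
have [y Ey] := F; have Ft : tangent (gam t) (u - u') by exact: dt.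
by rewrite -(metricE ut dt) -(metricE ut' dt) up// up'// subrr ltxx.
Qed.

(** [proj] is obtained by choice; on tangent vectors it equals this explicit formula, from which
    regularity, linearity and periodicity of [Pi] can be read off. *)
Definition perp t v := v - \sum_a coef t v a *: zeta a t.

Lemma perp_tangent t v : tangent (gam t) v -> tangent (gam t) (perp t v).
Proof. by move=> vt; apply: tangentB => //; exact: tangent_comb. Qed.

Lemma dot_perp_zeta t v a : dot t (perp t v) (zeta a t) = 0.
Proof.
rewrite /perp dotBl dot_comb.
rewrite (@gram_solve t (fun a => dot t v (zeta a t)) (coef t v)) //.
by apply/eqP; rewrite subr_eq0; apply/eqP; apply: eq_bigr => b _; rewrite gramE dotC mulrC.
Qed.

Lemma perp_Eperp t v : tangent (gam t) v -> Eperp zeta t (perp t v).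
Proof.
move=> vt; split; first exact: perp_tangent.
move=> u [x ->]; rewrite (metricE (perp_tangent vt) (@tangent_comb t x)) dotC dot_comb big1// => a _.
by rewrite dotC dot_perp_zeta mulr0.
Qed.

Lemma proj_perpE t v : tangent (gam t) v -> Defs.proj zeta t v = perp t v.
Proof.
move=> vt; have F : Fspace zeta t (v - perp t v).
  by exists (coef t v); rewrite /perp opprB addrC subrK.
apply: xget_unique; first by split; [exact: perp_Eperp|].
by move=> u [uE uF]; exact: (proj_unique uE uF (perp_Eperp vt) F).
Qed.

Lemma perp_id t v : Eperp zeta t v -> perp t v = v.
Proof.
move=> vE; have vt : tangent (gam t) v by exact: vE.1.
apply: (@proj_unique t _ _ v (perp_Eperp vt)) => //.
  by exists (coef t v); rewrite /perp opprB addrC subrK.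
by exists (fun=> 0); rewrite subrr big1// => a _; rewrite scale0r.
Qed.

(** Pythagoras: the components along F_t contribute the inverse Gram form of the products with the
    [zeta a t]. *)
Lemma dot_perp t u v : dot t (perp t u) (perp t v) =
  dot t u v - bil (hm t) (fun a => dot t u (zeta a t)) (fun a => dot t v (zeta a t)).
Proof.
rewrite {1}/perp dotBl dot_comb (big1 _ _ (fun a => coef t u a * dot t (zeta a t) (perp t v))); last first.
  by move=> a _; rewrite dotC dot_perp_zeta mulr0.
rewrite subr0 /perp dotBr dotC [X in _ - X]dotC dot_comb; congr (_ - _).
rewrite -(@bil_sum _ _ (hm t) _ _ (coef t v))//; apply: eq_bigr => a _.
by rewrite [dot t u _]dotC.
Qed.

Lemma gram_C1 a b : C1_fun (fun t => gm t a b).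
Proof.
have H t : is_derive t (1 : R) (fun t => gm t a b)
    (dot t (D (zeta a) t) (zeta b t) + dot t (zeta a t) (D (zeta b) t)).
  have -> : (fun t => gm t a b) = (fun t => dot t (zeta a t) (zeta b t)).
    by apply/funext => s; rewrite gramE.
  exact (is_derive_dot B (@zeta_along a) (@zeta_along b) (@zeta_derivable a t) (@zeta_derivable b t)).
exists (fun t => dot t (D (zeta a) t) (zeta b t) + dot t (zeta a t) (D (zeta b) t)) => // t.
have H2 c d := is_derive_dot B (@zeta_along_D c) (@zeta_along d) (@zeta_D_derivable c t) (@zeta_derivable d t).
apply: continuousD; first exact: is_derive_continuous (H2 a b).
have -> : (fun s => dot s (zeta a s) (D (zeta b) s)) = (fun s => dot s (D (zeta b) s) (zeta a s)).
  by apply/funext => s; exact: dotC.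
exact: is_derive_continuous (H2 b a).
Qed.

Lemma gram_inv_C1 a b : C1_fun (fun t => hm t a b).
Proof. exact: (C1_fun_invmx gram_unit gram_C1). Qed.

Definition crd xi a t := coef t (xi t) a.

Lemma crd_H1 xi a (x y : R) : x <= y -> W12_field xi -> H1 x y (crd xi a).
Proof.
move=> xy Wxi; apply: H1_sum => b; apply: H1M; first exact: C1_fun_H1 xy (gram_inv_C1 a b).
exact: W12_dot Wxi (zeta_W12 b) xy.
Qed.

Lemma crd_derivable xi a t : along xi -> field_derivable xi t -> derivable (crd xi a) t 1.
Proof.
move=> xit xd.
have H := is_derive_fun_sum (fun b => is_derive_funM (derivableP (@C1_fun_derivable _ _ t (gram_inv_C1 a b)))
  (is_derive_dot B xit (@zeta_along b) xd (@zeta_derivable b t))).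
exact: (ex_derive (is_derive := H)).
Qed.

Lemma PiE xi : along xi -> Pi zeta xi = xi - \sum_a fscale (crd xi a) (zeta a).
Proof.
move=> xit; apply/funext => t; rewrite /Pi (proj_perpE (xit t)).
change (perp t (xi t) = xi t - (\sum_a fscale (crd xi a) (zeta a)) t); by rewrite fct_sumE.
Qed.

Lemma Pi_at xi t : along xi -> Pi zeta xi t = perp t (xi t).
Proof. by move=> xit; rewrite /Pi (proj_perpE (xit t)). Qed.

Lemma along_Pi xi : along xi -> along (Pi zeta xi).
Proof. by move=> xit t; rewrite Pi_at//; apply: perp_tangent; exact: xit. Qed.

Lemma W12_Pi xi : W12_field xi -> W12_field (Pi zeta xi).
Proof.
move=> Wxi; rewrite PiE; last exact: Wxi.1.
apply: W12_fieldB => //; apply: W12_field_sum => a; apply: W12_fscale; last exact: zeta_W12.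
by move=> x y xy; exact: crd_H1.
Qed.

End periodic_solutions.

(** * Reduction of the second variation *)

Section second_variation_identities.
Context {R : realType} {m : nat} {S : lagrangian_system R m} (B : second_variation S).
Context {k : nat} (zeta : 'I_k -> field S).
Local Notation M := (config S).
Local Notation gam := (gamma S).
Local Notation mu := (@lebesgue_measure R).
Local Notation D := (D B).
Local Notation U := (U B).
Local Notation hm := (gram_inv zeta).
Local Notation Pi := (Pi zeta).
Local Notation crd := (crd zeta).
Implicit Types (t : R) (xi eta : field S) (a b c : 'I_k).

Hypothesis zeta_sol : forall a, solution B (zeta a).
Hypothesis zeta_free : forall t, lin_indep (fun a => zeta a t).
Hypothesis zeta_iso : forall a b t, dot t (zeta a t) (D (zeta b) t) = dot t (zeta b t) (D (zeta a) t).

Let zal := zeta_along zeta_sol.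
Let zald := zeta_along_D zeta_sol.
Let zd := zeta_derivable zeta_sol.
Let zdd := zeta_D_derivable zeta_sol.

Definition I_dot a xi t := dot t (zeta a t) (D xi t) - dot t (xi t) (D (zeta a) t).

Lemma I_dotE a xi t : along xi -> field_derivable xi t -> I_ B zeta a xi t = I_dot a xi t.
Proof.
move=> xit xd; rewrite /I_ /I_dot.
by rewrite (metricE (@zal a t) (D_tangent B xit xd)) (metricE (xit t) (@zald a t)).
Qed.

Definition qint xi eta t := metric t (D xi t) (D eta t) + metric t (U t (xi t)) (eta t).

Definition qperp xi eta t :=
  metric t (Dperp B zeta xi t) (Dperp B zeta eta t) + metric t (U t (xi t)) (eta t)
     - 3 * \sum_a \sum_b hm t a b *
         metric t (xi t) (Dperp B zeta (zeta a) t) *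
         metric t (eta t) (Dperp B zeta (zeta b) t).

Lemma qintE xi eta t : along xi -> along eta -> field_derivable xi t -> field_derivable eta t ->
  qint xi eta t = dot t (D xi t) (D eta t) + dot t (U t (xi t)) (eta t).
Proof.
move=> xit et xd ed; rewrite /qint (metricE (D_tangent B xit xd) (D_tangent B et ed)).
by rewrite (metricE (U_tangent B (xit t)) (et t)).
Qed.

(** For [xi] orthogonal to F_t this is also the product with [Dperp (zeta a)], the quantity that
    enters [hperp]. *)
Definition mom xi a t := dot t (xi t) (D (zeta a) t).

(** Differentiating [(xi, zeta^a) = 0] gives [(D xi, zeta^a) = - mom xi a], so passing from [Dperp]
    to [D] costs one further copy of the Gram term: 3 becomes 4. *)
Lemma qperpE xi eta t : along xi -> along eta -> field_derivable xi t -> field_derivable eta t ->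
  (forall s a, dot s (xi s) (zeta a s) = 0) -> (forall s a, dot s (eta s) (zeta a s) = 0) ->
  qperp xi eta t = dot t (D xi t) (D eta t) + dot t (U t (xi t)) (eta t)
    - 4 * bil (hm t) (mom xi^~ t) (mom eta^~ t).
Proof.
move=> xit et xd ed xz ez.
have Dx := D_tangent B xit xd; have De := D_tangent B et ed.
have Dp v : tangent (gam t) v -> Defs.proj zeta t v = perp zeta t v by exact: (proj_perpE zeta_sol zeta_free).
have pt v : tangent (gam t) v -> tangent (gam t) (perp zeta t v) by exact: (perp_tangent zeta_sol).
have H1 v a : along v -> field_derivable v t -> (forall s b, dot s (v s) (zeta b s) = 0) ->
    dot t (D v t) (zeta a t) = - mom v a t.
  move=> vt vd vz; have H := is_derive_dot B vt (@zal a) vd (@zd a t).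
  have E : (fun s => dot s (v s) (zeta a s)) = cst 0 by apply/funext => s; exact: vz.
  rewrite E in H; have := derive_val (is_derive := H); rewrite derive_cst => /esym/eqP.
  by rewrite addr_eq0 => /eqP.
have H2 v a : along v -> (forall s b, dot s (v s) (zeta b s) = 0) ->
    metric t (v t) (Dperp B zeta (zeta a) t) = mom v a t.
  move=> vt vz; rewrite /Dperp /Pi (Dp _ (@zald a t)) (metricE (vt t) (pt _ (@zald a t))).
  rewrite /perp dotBr [X in _ - X]dotC (dot_comb zeta) big1 ?subr0// => b _.
  by rewrite dotC vz mulr0.
rewrite /qperp; rewrite {1 2}/Dperp /Pi (Dp _ Dx) (Dp _ De) (metricE (pt _ Dx) (pt _ De)).
rewrite (metricE (U_tangent B (xit t)) (et t)).
rewrite (dot_perp zeta_sol zeta_free).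
have -> : \sum_a \sum_b hm t a b * metric t (xi t) (Dperp B zeta (zeta a) t) *
    metric t (eta t) (Dperp B zeta (zeta b) t) = bil (hm t) (mom xi^~ t) (mom eta^~ t).
  by apply: eq_bigr => a _; apply: eq_bigr => b _; rewrite !H2.
have -> : bil (hm t) (fun a => dot t (D xi t) (zeta a t)) (fun a => dot t (D eta t) (zeta a t)) =
    bil (hm t) (mom xi^~ t) (mom eta^~ t).
  apply: eq_bigr => a _; apply: eq_bigr => b _; rewrite !H1//; ring.
ring.
Qed.

Lemma dot_Pi_zeta xi t a : along xi -> dot t (Pi xi t) (zeta a t) = 0.
Proof. by move=> xit; rewrite (Pi_at zeta_sol zeta_free)// (dot_perp_zeta zeta_sol zeta_free). Qed.

Section good_point.
Variables (xi : field S) (t : R).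
Hypotheses (xit : along xi) (xd : field_derivable xi t).

Definition dcrd a := derive1 (crd xi a) t.

Lemma is_derive_crd a : is_derive t (1 : R) (crd xi a) (dcrd a).
Proof. by rewrite /dcrd derive1E; apply: derivableP; exact: (crd_derivable zeta_sol zeta_free). Qed.

Lemma Pi_decomp : xi t = Pi xi t + \sum_a crd xi a t *: zeta a t.
Proof. by rewrite (Pi_at zeta_sol zeta_free)// /perp subrK. Qed.

Lemma Pi_derivable : field_derivable (Pi xi) t.
Proof.
have [H _] := @D_sum _ _ _ B _ (fun a => fscale (crd xi a) (zeta a)) t
  (fun a => field_derivable_fscale (is_derive_crd a) (@zd a t)).
rewrite (PiE zeta_sol zeta_free xit) -scaleN1r.
exact (field_derivableD xd (field_derivableZ H)).
Qed.

Lemma D_Pi_decomp : D xi t =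
  D (Pi xi) t + (\sum_a dcrd a *: zeta a t + \sum_a crd xi a t *: D (zeta a) t).
Proof.
have [Fd FE] := @D_sum _ _ _ B _ (fun a => fscale (crd xi a) (zeta a)) t
  (fun a => field_derivable_fscale (is_derive_crd a) (@zd a t)).
have E : xi = Pi xi + \sum_a fscale (crd xi a) (zeta a) by rewrite (PiE zeta_sol zeta_free xit) subrK.
rewrite {1}E (D_D B Pi_derivable Fd) FE -big_split; congr (_ + _); apply: eq_bigr => a _.
exact: D_fscale (@zal a) (is_derive_crd a) (@zd a t).
Qed.

Lemma dot_Pi_D a : dot t (D (Pi xi) t) (zeta a t) = - mom (Pi xi) a t.
Proof.
have at_ : along (Pi xi) by exact: (along_Pi zeta_sol zeta_free).
have H := is_derive_dot B at_ (@zal a) Pi_derivable (@zd a t).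
have E : (fun s => dot s (Pi xi s) (zeta a s)) = cst 0 by apply/funext => s; exact: dot_Pi_zeta.
rewrite E in H; have := derive_val (is_derive := H); rewrite derive_cst => /esym/eqP.
by rewrite addr_eq0 => /eqP.
Qed.

(** Through [zeta_iso], which expresses that V is isotropic, the undifferentiated coordinates
    cancel. Of the two copies of [mom], one comes from [(zeta^a, D (Pi xi))] and one from
    [(Pi xi, D zeta^a)]. *)
Lemma I_dot_crd a : I_dot a xi t = - 2 * mom (Pi xi) a t + \sum_b gram zeta t a b * dcrd b.
Proof.
rewrite /I_dot D_Pi_decomp {1}Pi_decomp !dotDr dotDl.
rewrite [dot t (zeta a t) (D (Pi xi) t)]dotC dot_Pi_D.
rewrite [dot t (zeta a t) (\sum_b dcrd b *: _)]dotC (dot_comb zeta t dcrd).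
have -> : dot t (zeta a t) (\sum_b crd xi b t *: D (zeta b) t) =
    dot t (\sum_b crd xi b t *: zeta b t) (D (zeta a) t).
  rewrite dotC dot_suml dot_suml; apply: eq_bigr => b _.
  by rewrite !dotZl dotC zeta_iso.
have -> : \sum_b dcrd b * dot t (zeta b t) (zeta a t) = \sum_b gram zeta t a b * dcrd b.
  by apply: eq_bigr => b _; rewrite (gramE zeta_sol) dotC mulrC.
rewrite /mom; ring.
Qed.

(** Solving the previous relation removes the derivatives of the coordinates along F_t from the
    second variation. *)
Lemma dcrdE a : dcrd a = \sum_b hm t a b * (I_dot b xi t + 2 * mom (Pi xi) b t).
Proof.
have := @gram_inv_solve _ _ _ B _ zeta zeta_sol zeta_free t dcrd (fun b => I_dot b xi t + 2 * mom (Pi xi) b t).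
apply=> b; rewrite I_dot_crd; ring.
Qed.

End good_point.

(** The integrated terms of the reduction. The first sum has the full [eta] and the second only
    [Pi xi], so that the product of the two parts along F_t is counted once. *)
Definition boundary xi eta t :=
  \sum_a crd xi a t * dot t (D (zeta a) t) (eta t) + \sum_a crd eta a t * dot t (D (zeta a) t) (Pi xi t).

Lemma is_derive_boundary xi eta t : along xi -> along eta ->
  field_derivable xi t -> field_derivable eta t ->
  is_derive t (1 : R) (boundary xi eta)
    (qint xi eta t - qperp (Pi xi) (Pi eta) t - bil (hm t) (fun a => I_dot a xi t) (fun a => I_dot a eta t)).
Proof.
move=> xit et xd ed.
have pxt : along (Pi xi) by exact: (along_Pi zeta_sol zeta_free).
have pet : along (Pi eta) by exact: (along_Pi zeta_sol zeta_free).
have pxd := Pi_derivable xit xd; have ped := Pi_derivable et ed.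
have H1 := is_derive_fun_sum (fun a => is_derive_funM (is_derive_crd xit xd a)
  (is_derive_dot B (@zald a) et (@zdd a t) ed)).
have H2 := is_derive_fun_sum (fun a => is_derive_funM (is_derive_crd et ed a)
  (is_derive_dot B (@zald a) pxt (@zdd a t) pxd)).
apply: (is_derive1_eq (is_derive_funD H1 H2)).
rewrite (qintE xit et xd ed).
rewrite (qperpE pxt pet pxd ped (fun s a => dot_Pi_zeta s a xit) (fun s a => dot_Pi_zeta s a et)).
set p := (fun a => mom (Pi xi) a t); set p' := (fun a => mom (Pi eta) a t).
set c := (fun a => I_dot a xi t); set c' := (fun a => I_dot a eta t).
pose dx a := dcrd xi t a; pose dx' a := dcrd eta t a.
pose x a := crd xi a t; pose x' a := crd eta a t.
have zDD a : D (D (zeta a)) t = U t (zeta a t) by exact: solution_DD.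
have L1 : \sum_a (dcrd xi t a * dot t (D (zeta a) t) (eta t) +
    crd xi a t * (dot t (D (D (zeta a)) t) (eta t) + dot t (D (zeta a) t) (D eta t))) =
    \sum_a dx a * dot t (D (zeta a) t) (eta t) + (\sum_a x a * dot t (U t (zeta a t)) (eta t) +
    \sum_a x a * dot t (D (zeta a) t) (D eta t)).
  by rewrite -!big_split; apply: eq_bigr => a _; rewrite zDD /= mulrDr.
have L2 : \sum_a (dcrd eta t a * dot t (D (zeta a) t) (Pi xi t) +
    crd eta a t * (dot t (D (D (zeta a)) t) (Pi xi t) + dot t (D (zeta a) t) (D (Pi xi) t))) =
    \sum_a dx' a * p a + (\sum_a x' a * dot t (U t (zeta a t)) (Pi xi t) +
    \sum_a x' a * dot t (D (zeta a) t) (D (Pi xi) t)).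
  by rewrite -!big_split; apply: eq_bigr => a _; rewrite zDD /= mulrDr /p /mom [dot t (Pi xi t) _]dotC.
rewrite L1 L2.
(* [E1] to [E4] split off the parts along F_t, first of [xi], then of [eta]; each term with an
   undifferentiated coordinate also occurs in [L1] or [L2] and cancels. *)
have E1 : dot t (D xi t) (D eta t) = dot t (D (Pi xi) t) (D eta t) +
    (\sum_a dx a * dot t (zeta a t) (D eta t) + \sum_a x a * dot t (D (zeta a) t) (D eta t)).
  rewrite (D_Pi_decomp xit xd) !dotDl (dot_comb zeta) dot_suml; congr (_ + (_ + _)).
  by apply: eq_bigr => a _; rewrite dotZl.
have UE v (y : 'I_k -> R) w : v = w + \sum_a y a *: zeta a t -> U t v = U t w + \sum_a y a *: U t (zeta a t).
  move=> ->; rewrite (U_D B); congr (_ + _).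
  elim/big_rec2: _ => [|a u u' _ <-]; last by rewrite (U_D B) (U_Z B).
  by have := U_Z B t 0 0; rewrite !scale0r.
have E2 : dot t (U t (xi t)) (eta t) = dot t (U t (Pi xi t)) (eta t) +
    \sum_a x a * dot t (U t (zeta a t)) (eta t).
  rewrite (UE _ _ _ (Pi_decomp t xit)) dotDl dot_suml; congr (_ + _).
  by apply: eq_bigr => a _; rewrite dotZl.
have E3 : dot t (D (Pi xi) t) (D eta t) = dot t (D (Pi xi) t) (D (Pi eta) t) +
    (- (\sum_a dx' a * p a) + \sum_a x' a * dot t (D (zeta a) t) (D (Pi xi) t)).
  rewrite (D_Pi_decomp et ed) !dotDr; congr (_ + (_ + _)).
    rewrite dotC (dot_comb zeta) -sumrN; apply: eq_bigr => a _.
    by rewrite dotC (dot_Pi_D xit xd) mulrN.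
  by rewrite dotC dot_suml; apply: eq_bigr => a _; rewrite dotZl.
have E4 : dot t (U t (Pi xi t)) (eta t) = dot t (U t (Pi xi t)) (Pi eta t) +
    \sum_a x' a * dot t (U t (zeta a t)) (Pi xi t).
  rewrite [in LHS](Pi_decomp t et) dotDr; congr (_ + _).
  rewrite dotC (dot_comb zeta); apply: eq_bigr => a _.
  by rewrite (dot_Usym B (@zal a t) (pxt t)).
have hs : forall a b, hm t a b = hm t b a by exact: (gram_inv_sym zeta_sol).
have E5 : \sum_a dx a * dot t (zeta a t) (D eta t) =
    \sum_a dx a * dot t (D (zeta a) t) (eta t) + \sum_a dx a * c' a.
  by rewrite -big_split; apply: eq_bigr => a _; rewrite /c' /I_dot [dot t (D (zeta a) t) _]dotC /=; ring.
(* What is left involves the coordinates only through their derivatives. The mixed terms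
   [2 bil p c'] of [E6] cancel against the two occurrences of [E7], one from [E3] and one from [L2],
   leaving [bil c c' - 4 bil p p']. *)
have E6 : \sum_a dx a * c' a = bil (hm t) c c' + 2 * bil (hm t) p c'.
  rewrite (@bil_sum _ _ (hm t) c' (fun b => 2 * p b + c b)); last first.
    by move=> a; rewrite /dx (dcrdE xit xd); apply: eq_bigr => b _; rewrite /c /p; ring.
  by rewrite bilPr (bilC c' p hs) (bilC c' c hs); ring.
have E7 : \sum_a dx' a * p a = bil (hm t) p c' + 2 * bil (hm t) p p'.
  rewrite (@bil_sum _ _ (hm t) p (fun b => 2 * p' b + c' b)); last first.
    by move=> a; rewrite /dx' (dcrdE et ed); apply: eq_bigr => b _; rewrite /c' /p'; ring.
  by rewrite bilPr; ring.
rewrite E1 E2 E3 E4 E5 E6 E7; ring.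
Qed.

Lemma boundary_H1 xi eta (x y : R) : x <= y -> W12_field xi -> W12_field eta -> H1 x y (boundary xi eta).
Proof.
move=> xy Wx We; apply: H1D; apply: H1_sum => a; apply: H1M.
- exact: (crd_H1 zeta_sol zeta_free).
- by apply: W12_dot => //; exact: zeta_D_W12.
- exact: (crd_H1 zeta_sol zeta_free).
- apply: W12_dot => //; first exact: zeta_D_W12.
  exact: (W12_Pi zeta_sol zeta_free).
Qed.

End second_variation_identities.

(** * Integration over a period, and existence of corrections in Y *)

Section periodic_reduction.
Context {R : realType} {m : nat} {S : lagrangian_system R m} (B : second_variation S).
Context {k : nat} (zeta : 'I_k -> field S).
Local Notation M := (config S).
Local Notation gam := (gamma S).
Local Notation mu := (@lebesgue_measure R).
Local Notation D := (D B).
Local Notation U := (U B).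
Local Notation T := (tau S).
Local Notation hm := (gram_inv zeta).
Local Notation Pi := (Pi zeta).
Local Notation crd := (crd zeta).
Local Notation gbar := (gbar zeta).
Implicit Types (t : R) (xi eta : field S) (a b c : 'I_k).

Hypothesis zeta_sol : forall a, solution B (zeta a).
Hypothesis zeta_free : forall t, lin_indep (fun a => zeta a t).
Hypothesis zeta_iso : forall a b t, dot t (zeta a t) (D (zeta b) t) = dot t (zeta b t) (D (zeta a) t).
Hypothesis zeta_per : forall a t, zeta a (t + T) = zeta a t.

Let zal := zeta_along zeta_sol.
Let zald := zeta_along_D zeta_sol.
Let zd := zeta_derivable zeta_sol.
Let zdd := zeta_D_derivable zeta_sol.
Let T0 : 0 <= T := ltW (tau_gt0 S).

Lemma zeta_D_per a t : D (zeta a) (t + T) = D (zeta a) t.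
Proof. by rewrite -(D_shift B); congr (D _ _); apply/funext => s; exact: zeta_per. Qed.

Lemma gram_inv_per t : hm (t + T) = hm t.
Proof.
suff E : gram zeta (t + T) = gram zeta t by rewrite /gram_inv E.
have gE r a b : gram zeta r a b = metric r (zeta a r) (zeta b r) by rewrite mxE.
have E a b : metric (t + T) (zeta a (t + T)) (zeta b (t + T)) = metric t (zeta a t) (zeta b t).
  by rewrite (zeta_per a t) (zeta_per b t) (metricT (@zal a t) (@zal b t)).
apply/matrixP => a b.
exact (etrans (gE (t + T) a b) (etrans (E a b) (esym (gE t a b)))).
Qed.

Lemma coef_per t v a : tangent (gam t) v -> coef zeta (t + T) v a = coef zeta t v a.
Proof.
move=> vt; apply: eq_bigr => b _; by rewrite gram_inv_per zeta_per (dotT vt (@zal b t)).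
Qed.

Lemma perp_per t v : tangent (gam t) v -> perp zeta (t + T) v = perp zeta t v.
Proof.
move=> vt; rewrite /perp; congr (_ - _); apply: eq_bigr => a _.
by rewrite (coef_per a vt) zeta_per.
Qed.

Lemma Pi_per xi : along xi -> (forall t, xi (t + T) = xi t) -> forall t, Pi xi (t + T) = Pi xi t.
Proof.
move=> xit xp t; rewrite !(Pi_at zeta_sol zeta_free)// xp; exact: (perp_per (xit t)).
Qed.

Lemma Xspace_along xi : Xspace xi -> along xi.
Proof. by move=> /XspaceP[[]]. Qed.

Lemma Pi_Xspace xi : Xspace xi -> Xspace (Pi xi).
Proof.
move=> /XspaceP[Wx xp]; apply/XspaceP; split; first exact: (W12_Pi zeta_sol zeta_free).
by apply: Pi_per => //; exact: Wx.1.
Qed.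

Lemma Pi_Eperp xi t : along xi -> Eperp zeta t (Pi xi t).
Proof.
move=> xit; rewrite (Pi_at zeta_sol zeta_free)//.
exact: (perp_Eperp zeta_sol zeta_free (xit t)).
Qed.

Lemma Pi_id xi : (forall t, Eperp zeta t (xi t)) -> Pi xi = xi.
Proof.
move=> xE; apply/funext => t.
have xit : along xi by move=> s; exact: (xE s).1.
by rewrite (Pi_at zeta_sol zeta_free)// (perp_id zeta_sol zeta_free).
Qed.

Lemma Pi_lin (x : R) xi eta : along xi -> along eta -> Pi (x *: xi + eta) = x *: Pi xi + Pi eta.
Proof.
move=> xit et; apply/funext => t.
have xet : along (x *: xi + eta) by apply: alongD => //; exact: alongZ.
change (Pi (x *: xi + eta) t = x *: Pi xi t + Pi eta t).
rewrite !(Pi_at zeta_sol zeta_free)// /perp.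
change (x *: xi t + eta t - \sum_a coef zeta t (x *: xi t + eta t) a *: zeta a t =
  x *: (xi t - \sum_a coef zeta t (xi t) a *: zeta a t) + (eta t - \sum_a coef zeta t (eta t) a *: zeta a t)).
have -> : \sum_a coef zeta t (x *: xi t + eta t) a *: zeta a t =
    x *: (\sum_a coef zeta t (xi t) a *: zeta a t) + \sum_a coef zeta t (eta t) a *: zeta a t.
  rewrite scaler_sumr -big_split; apply: eq_bigr => a _ /=; rewrite scalerA -scalerDl; congr (_ *: _).
  rewrite /coef mulr_sumr -big_split; apply: eq_bigr => b _ /=; rewrite dotDl dotZl; ring.
by rewrite scalerBr opprD addrACA.
Qed.

Lemma Pi_Fspace xi t : along xi -> Fspace zeta t (xi t - Pi xi t).
Proof.
move=> xit; exists (fun a => crd xi a t).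
by rewrite {1}(Pi_decomp zeta_sol zeta_free t xit) addrAC subrr add0r.
Qed.

Lemma Pi_0 xi : along xi -> (forall t, Fspace zeta t (xi t)) -> Pi xi = 0.
Proof.
move=> xit xF; apply/funext => t; rewrite (Pi_at zeta_sol zeta_free)// /perp.
by rewrite {1}(Fspace_coef zeta_sol zeta_free (xF t)); exact: subrr.
Qed.

Lemma qint_L1 xi eta (x y : R) : x <= y -> W12_field xi -> W12_field eta -> L1 x y (qint B xi eta).
Proof.
move=> xy Wx We; apply: L1_ae (L1D (W12_DdotD B Wx We xy) (W12_U B Wx We xy)).
apply: ae_imp2 (W12_ae Wx) (W12_ae We) => t xd ed _.
by rewrite (qintE B Wx.1 We.1 xd ed).
Qed.

Lemma h_sym xi eta : Xspace xi -> Xspace eta -> h B xi eta = h B eta xi.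
Proof.
move=> /XspaceP[Wx _] /XspaceP[We _].
apply: ae_Rintegral; apply: ae_imp2 (W12_ae Wx) (W12_ae We) => t xd ed _.
change (qint B xi eta t = qint B eta xi t).
rewrite (qintE B Wx.1 We.1 xd ed) (qintE B We.1 Wx.1 ed xd).
by rewrite dotC (dot_Usym B (Wx.1 t) (We.1 t)) [X in _ + X]dotC.
Qed.

Lemma boundary_per xi eta : Xspace xi -> Xspace eta ->
  boundary B zeta xi eta T = boundary B zeta xi eta 0.
Proof.
move=> /XspaceP[Wx xp] /XspaceP[We ep]; rewrite /boundary.
have cT v : along v -> (forall t, v (t + T) = v t) -> forall a, crd v a T = crd v a 0.
  move=> vt vp a; rewrite -[in LHS](add0r T) /crd vp; exact: (coef_per a (vt 0)).
have dT v : along v -> (forall t, v (t + T) = v t) -> forall a,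
    dot T (D (zeta a) T) (v T) = dot 0 (D (zeta a) 0) (v 0).
  move=> vt vp a; rewrite -[in LHS](add0r T) vp zeta_D_per; exact: (dotT (@zald a 0) (vt 0)).
have pxt : along (Pi xi) by exact: (along_Pi zeta_sol zeta_free Wx.1).
have pp : forall t, Pi xi (t + T) = Pi xi t by exact: Pi_per Wx.1 xp.
exact (congr2 +%R
  (eq_bigr _ (fun a _ => congr2 *%R (cT _ Wx.1 xp a) (dT _ We.1 ep a)))
  (eq_bigr _ (fun a _ => congr2 *%R (cT _ We.1 ep a) (dT _ pxt pp a)))).
Qed.

(** Membership in Y with the constants recorded; the zero constants give Y^0 by definition. *)
Definition I_const xi (c : 'I_k -> R) := Xspace xi /\
  forall a, {ae mu, forall t, I_ B zeta a xi t = c a}.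

Lemma I_const_dot xi (c : 'I_k -> R) : I_const xi c ->
  {ae mu, forall t, forall a, I_dot B zeta a xi t = c a}.
Proof.
move=> [/XspaceP[Wx _] xc]; apply: ae_forall => a; apply: ae_imp2 (W12_ae Wx) (xc a) => t xd <-.
by rewrite (I_dotE zeta_sol a Wx.1 xd).
Qed.

Lemma gram_inv_cont a b t : {for t, continuous (fun s => hm s a b)}.
Proof. exact: (C1_fun_continuous (gram_inv_C1 zeta_sol zeta_free a b)). Qed.

Lemma gram_inv_within a b (x y : R) : {within `[x, y], continuous (fun s => hm s a b)}.
Proof. by apply: within_continuous => t _; exact: gram_inv_cont. Qed.

Lemma bil_gram_inv_L1 (x y : R) (c c' : 'I_k -> R) : L1 x y (fun t => bil (hm t) c c').
Proof.
apply: L1_sum => a; apply: L1_sum => b.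
have E : (fun t => hm t a b * c a * c' b) = (fun t => c a * c' b * hm t a b).
  by apply/funext => t; ring.
by rewrite E; apply: L1Z; apply: L1_cont; exact: gram_inv_within.
Qed.

Lemma gram_inv_Rintegral (c c' : 'I_k -> R) : \int[mu]_(t in `[0, T]) bil (hm t) c c' = bil gbar c c'.
Proof.
have E a b : (fun t => hm t a b * c a * c' b) = (fun t => c a * c' b * hm t a b).
  by apply/funext => t; ring.
have Lh a b : L1 0 T (fun t => hm t a b) by apply: L1_cont; exact: gram_inv_within.
have L a b : L1 0 T (fun t => hm t a b * c a * c' b) by rewrite E; apply: L1Z.
rewrite /bil (L1_Rintegral_sum (f := fun a t => \sum_b hm t a b * c a * c' b)); last first.
  by move=> a; apply: L1_sum => b; exact: L.
apply: eq_bigr => a _; rewrite (L1_Rintegral_sum (f := fun b t => hm t a b * c a * c' b)) => [|b]; last exact: L.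
apply: eq_bigr => b _; rewrite mxE E (L1_RintegralZ (c a * c' b) (Lh a b)); ring.
Qed.

Lemma h_hperp xi eta (c c' : 'I_k -> R) : I_const xi c -> I_const eta c' ->
  h B xi eta = hperp B zeta (Pi xi) (Pi eta) + bil gbar c c'.
Proof.
move=> xc ec; have xI := I_const_dot xc; have eI := I_const_dot ec.
have Xx := xc.1; have Xe := ec.1.
have [Wx xp] := (XspaceP xi).1 Xx; have [We ep] := (XspaceP eta).1 Xe.
pose f t := qint B xi eta t - qperp B zeta (Pi xi) (Pi eta) t - bil (hm t) c c'.
have Hd : {ae mu, forall t, t \in `]0, T[ -> is_derive t (1 : R) (boundary B zeta xi eta) (f t)}.
  apply: ae_imp2 (ae_imp2 (fun _ x y => conj x y) (W12_ae Wx) (W12_ae We)) (ae_imp2 (fun _ x y => conj x y) xI eI).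
  move=> t [xd ed] [xt et] _.
  apply: (is_derive1_eq (is_derive_boundary zeta_sol zeta_free zeta_iso Wx.1 We.1 xd ed)).
  by congr (_ - _); apply: bil_ext => a; [exact: xt|exact: et].
have bH := boundary_H1 zeta_sol zeta_free T0 Wx We.
have Lf : L1 0 T f by apply: L2_L1; exact: H1_L2 bH Hd.
have := H1_FTC T0 bH Hd; rewrite (boundary_per Xx Xe) subrr => f0.
have Lq := qint_L1 T0 Wx We; have Lb := bil_gram_inv_L1 0 T c c'.
(* Solving for the integrand of [hperp] shows that it is a combination of integrable functions: [f]
   is one, being the derivative of the absolutely continuous [boundary]. *)
have E : qperp B zeta (Pi xi) (Pi eta) = (fun t => qint B xi eta t + (-1 * bil (hm t) c c' + -1 * f t)).
  by apply/funext => t; rewrite /f; ring.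
rewrite /h /hperp /form_of -/(qint B xi eta) -/(qperp B zeta (Pi xi) (Pi eta)) E.
rewrite (L1_RintegralD Lq (L1D (L1Z (-1) Lb) (L1Z (-1) Lf))) (L1_RintegralD (L1Z (-1) Lb) (L1Z (-1) Lf)).
rewrite (L1_RintegralZ (-1) Lb) (L1_RintegralZ (-1) Lf) f0 gram_inv_Rintegral mulr0 addr0 mulN1r.
by rewrite -addrA addNr addr0.
Qed.

(** For a field in F_t the [mom] term in [dcrdE] vanishes, so the gain of the coordinates over a
    period is governed by [gbar]. Applied to the difference of [eta_a] and its periodic correction
    this computes [s]; applied to a periodic field it forces the constants to be 0. *)
Lemma crd_increment v (e : 'I_k -> R) a : W12_field v -> (forall t, Fspace zeta t (v t)) ->
  {ae mu, forall t, forall b, I_dot B zeta b v t = e b} ->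
  [/\ forall x y : R, x <= y -> H1 x y (crd v a),
      {ae mu, forall t, is_derive t (1 : R) (crd v a) (\sum_b hm t a b * e b)} &
      crd v a T - crd v a 0 = \sum_b gbar a b * e b].
Proof.
move=> Wv vF vI; have P0 := Pi_0 Wv.1 vF.
have Hx x y : x <= y -> H1 x y (crd v a) by move=> xy; exact: (crd_H1 zeta_sol zeta_free a xy Wv).
have Hd : {ae mu, forall t, is_derive t (1 : R) (crd v a) (\sum_b hm t a b * e b)}.
  apply: ae_imp2 (W12_ae Wv) vI => t vd vt.
  apply: (is_derive1_eq (is_derive_crd zeta_sol zeta_free Wv.1 vd a)).
  rewrite (dcrdE zeta_sol zeta_free zeta_iso Wv.1 vd a); apply: eq_bigr => b _.
  by rewrite vt P0 /mom dot0l mulr0 addr0.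
split=> //; rewrite -(H1_FTC (g := fun t => \sum_b hm t a b * e b) T0 (Hx _ _ T0)); last exact: ae_imp Hd.
have Lh b : L1 0 T (fun t => hm t a b) by apply: L1_cont; exact: gram_inv_within.
have E b : (fun t => hm t a b * e b) = (fun t => e b * hm t a b) by apply/funext => t; ring.
rewrite (L1_Rintegral_sum (f := fun b t => hm t a b * e b)) => [|b]; last by rewrite E; exact: L1Z.
by apply: eq_bigr => b _; rewrite mxE E (L1_RintegralZ (e b) (Lh b)) mulrC.
Qed.

Lemma gbar_sym a b : gbar a b = gbar b a.
Proof.
rewrite !mxE; congr Rintegral; apply/funext => t; exact: (@gram_inv_sym _ _ _ B _ zeta zeta_sol t a b).
Qed.

(** The integrand is continuous and everywhere positive, hence bounded below by its positive minimum
    over the period. *)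
Lemma gbar_gt0 (x : 'I_k -> R) : (exists a, x a != 0) -> 0 < bil gbar x x.
Proof.
move=> x0; rewrite -gram_inv_Rintegral.
have fc : {within `[0, T], continuous (fun t => bil (hm t) x x)}.
  apply: within_continuous => t _.
  apply: (C1_fun_continuous (C1_fun_sum (fun a => C1_fun_sum (fun b => C1_funM (C1_funM (gram_inv_C1 zeta_sol zeta_free a b) (C1_fun_cst _)) (C1_fun_cst _))))).
have [t0 _ H] := EVT_min T0 fc.
have m0 : 0 < bil (hm t0) x x by exact: (gram_inv_gt0 zeta_sol zeta_free).
have I1 := continuous_compact_integrable (@segment_compact R 0 T) fc.
have I0 : mu.-integrable `[0, T] (EFin \o (fun=> bil (hm t0) x x)).
  by apply: continuous_compact_integrable; [exact: segment_compact|apply: within_continuous => t _; exact: cst_continuous].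
apply: (@lt_le_trans _ _ (\int[mu]_(t in `[0, T]) bil (hm t0) x x)); last first.
  exact (@le_Rintegral _ _ R mu _ _ _ (measurable_itv `[0, T]) I0 I1 (fun t tT => H t tT)).
rewrite /Rintegral integral_cst//= lebesgue_measure_itv/= lte_fin (tau_gt0 S).
by rewrite -EFinD -EFinM /= subr0 mulr_gt0// (tau_gt0 S).
Qed.

Lemma gbar_unit : gbar \in unitmx.
Proof.
rewrite unitmxE unitfE; apply/negP => /det0P[v v0 vG].
have [a va] : exists a, v 0 a != 0.
  by apply: contrapT => H; move/negP: v0; apply; apply/eqP/rowP => a; rewrite mxE;
    apply/eqP; apply: contrapT => va; apply: H; exists a; apply/negP.
have := gbar_gt0 (ex_intro (fun a => v 0 a != 0) a va).
rewrite -(@bil_sum _ _ gbar _ _ (fun=> 0)) ?big1 ?ltxx// => b; first by rewrite mul0r.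
have /rowP/(_ b) := vG; rewrite !mxE => E; rewrite -[LHS]E; apply: eq_bigr => c _.
by rewrite gbar_sym mulrC.
Qed.

(** By isotropy of V, Gamma lies in Y^0; so constants are defined on classes modulo Gamma. *)
Lemma I_const_span xi : spanned zeta xi -> I_const xi (fun=> 0).
Proof.
move=> [x ->]; have sx : solution B (\sum_a x a *: zeta a).
  by apply: solution_sum => a; apply: solutionZ.
split.
  apply/XspaceP; split; first exact: solution_W12 sx.
  move=> t; rewrite fct_sumE.
  exact (eq_bigr _ (fun a _ => congr1 (fun v => x a *: v) (zeta_per a t))).
move=> b; apply: ae_all => t.
rewrite (I_dotE zeta_sol b (solution_along sx) (@solution_derivable _ _ _ B _ t sx)) /I_dot.
have xzd a : field_derivable (x a *: zeta a) t by apply: field_derivableZ; exact: zd.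
have [_ ->] := @D_sum _ _ _ B _ (fun a => x a *: zeta a) t xzd.
have -> : (\sum_a x a *: zeta a) t = \sum_a x a *: zeta a t by rewrite fct_sumE.
rewrite (dot_comb zeta t x) dotC dot_suml.
under eq_bigr => a _ do rewrite (D_Z B (x a) (@zal a) (@zd a t)) dotZl dotC zeta_iso.
exact: subrr.
Qed.

Lemma I_const_lin (x : R) xi eta (c c' : 'I_k -> R) : I_const xi c -> I_const eta c' ->
  I_const (x *: xi + eta) (fun a => x * c a + c' a).
Proof.
move=> xc ec; have xI := I_const_dot xc; have eI := I_const_dot ec.
have [Wx xp] := (XspaceP xi).1 xc.1; have [We ep] := (XspaceP eta).1 ec.1.
have Wxe : W12_field (x *: xi + eta) by apply: W12_fieldD => //; exact: W12_fieldZ.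
split.
  by apply/XspaceP; split=> // t; exact (congr2 (fun u v => x *: u + v) (xp t) (ep t)).
move=> a; apply: ae_imp2 (ae_imp2 (fun _ x y => conj x y) (W12_ae Wx) (W12_ae We))
  (ae_imp2 (fun _ x y => conj x y) xI eI) => t [xd ed] [<- <-].
have xd' : field_derivable (x *: xi) t by exact: field_derivableZ.
rewrite (I_dotE zeta_sol a Wxe.1 (field_derivableD xd' ed)) /I_dot.
rewrite (D_D B xd' ed) (D_Z B x Wx.1 xd) dotC dotDl dotZl.
change (x * dot t (D xi t) (zeta a t) + dot t (D eta t) (zeta a t)
  - dot t (x *: xi t + eta t) (D (zeta a) t) =
 x * (dot t (zeta a t) (D xi t) - dot t (xi t) (D (zeta a) t)) +
 (dot t (zeta a t) (D eta t) - dot t (eta t) (D (zeta a) t))).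
rewrite dotDl dotZl [dot t (D xi t) _]dotC [dot t (D eta t) _]dotC; ring.
Qed.

(** Two different values would make the whole line a null set. *)
Lemma I_const_unique xi (c c' : 'I_k -> R) : I_const xi c -> I_const xi c' -> c =1 c'.
Proof.
move=> [_ xc] [_ xc'] a; apply: contrapT => cc'.
have : {ae mu, forall t, False}.
  by apply: ae_imp2 (xc a) (xc' a) => t -> /cc'.
move=> /negligibleP; rewrite (_ : ~` _ = setT); last by apply/seteqP; split=> // t _ [].
move=> /(_ measurableT).
move=> E; have : (mu `[0%R, 1%R]%classic <= mu setT)%E.
  by apply: le_measure; rewrite ?inE//; exact: measurable_itv.
move: E; rewrite /mzero /= => ->.
by rewrite lebesgue_measure_itv/= lte_fin ltr01 sube0 lee_fin ler10.
Qed.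

(** By periodicity [gbar c = 0], so positivity of [gbar] gives [c = 0]; then the coordinates have
    zero derivative almost everywhere and, being absolutely continuous, are constant. *)
Lemma I_const_Zspace v (c : 'I_k -> R) : I_const v c -> (forall t, Fspace zeta t (v t)) ->
  spanned zeta v.
Proof.
move=> vc vF; have [Wv vp] := (XspaceP v).1 vc.1.
have vI := I_const_dot vc.
have H a := crd_increment a Wv vF vI.
have c0 a : c a = 0.
  apply: contrapT => ca.
  have := gbar_gt0 (ex_intro (fun a => c a != 0) a (introN eqP ca)).
  rewrite -(@bil_sum _ _ gbar c c (fun=> 0)) ?big1 ?ltxx// => b; first by rewrite mul0r.
  have [_ _ <-] := H b; have -> : crd v b T = crd v b 0 by rewrite -[in LHS](add0r T) /crd vp; exact: (coef_per b (Wv.1 0)).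
  by rewrite subrr.
exists (fun a => crd v a 0); apply/funext => t; rewrite fct_sumE.
rewrite (Fspace_coef zeta_sol zeta_free (vF t)); apply: eq_bigr => a _.
have [Hh Hd _] := H a.
suff -> : coef zeta t (v t) a = crd v a 0 by exact: erefl.
apply: (@H1_const _ (crd v a)) => //; apply: ae_imp Hd => s; rewrite big1// => b _; by rewrite c0 mulr0.
Qed.

(** Conservation of the symplectic form along solutions: the derivative vanishes because [U] is
    symmetric. *)
Lemma solution_I_dot xi a t t' : solution B xi -> I_dot B zeta a xi t = I_dot B zeta a xi t'.
Proof.
move=> sx.
have H s : is_derive s (1 : R) (I_dot B zeta a xi) 0.
  have := is_derive_funB
    (is_derive_dot B (@zal a) (solution_along_D sx) (@zd a s) (@solution_D_derivable _ _ _ B xi s sx))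
    (is_derive_dot B (solution_along sx) (@zald a) (@solution_derivable _ _ _ B xi s sx) (@zdd a s)).
  move=> H; apply: (is_derive1_eq H).
  rewrite (@solution_DD _ _ _ B xi s sx) (@solution_DD _ _ _ B _ s (zeta_sol a)).
  rewrite -(dot_Usym B (@solution_along _ _ _ B xi sx s) (@zal a s)) [X in _ - (X + _)]dotC.
  rewrite [dot s (U s (xi s)) _]dotC; ring.
exact: is_derive_0_is_cst.
Qed.

(** * Solutions periodic up to a combination of the [zeta a], and their periodic corrections *)

Section quasiperiodic_solution.
Variables (eta0 xi : field S) (s c : 'I_k -> R).
Hypothesis eta0_sol : solution B eta0.
Hypothesis eta0_per : forall t, eta0 (t + T) = eta0 t + \sum_a s a *: zeta a t.
Hypothesis xi_const : I_const xi c.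
Hypothesis eta0_xi : forall t, Fspace zeta t (eta0 t - xi t).

(** Its coordinates [crd v] are the functions lambda, so that [xi = eta0 - lambda_b zeta^b]. *)
Let v : field S := eta0 - xi.

Let Wxi : W12_field xi := ((XspaceP xi).1 xi_const.1).1.
Let xi_per : forall t, xi (t + T) = xi t := ((XspaceP xi).1 xi_const.1).2.
Let We0 : W12_field eta0 := solution_W12 eta0_sol.
Let Wv : W12_field v := W12_fieldB We0 Wxi.

Let vF : forall t, Fspace zeta t (v t).
Proof. by move=> t; exact: eta0_xi. Qed.

Lemma crd_holonomy a : crd v a T = crd v a 0 + s a.
Proof.
rewrite -[in LHS](add0r T) /crd.
have -> : v (0 + T) = v 0 + \sum_a s a *: zeta a 0.
  change (eta0 (0 + T) - xi (0 + T) = eta0 0 - xi 0 + \sum_a s a *: zeta a 0).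
  by rewrite eta0_per xi_per addrAC.
have vt : tangent (gam 0) (v 0 + \sum_a s a *: zeta a 0).
  by apply: tangentD; [exact: (Wv.1 0)|exact: (tangent_comb zeta_sol)].
rewrite (coef_per a vt) -[in RHS](coef_comb zeta_sol zeta_free 0 s a).
rewrite /coef -big_split; apply: eq_bigr => b _ /=; rewrite dotDl; ring.
Qed.

Lemma holonomy_gbar (d : 'I_k -> R) a : (forall b t, I_dot B zeta b eta0 t = d b) ->
  s a = \sum_b gbar a b * (d b - c b).
Proof.
move=> dE; have xI := I_const_dot xi_const.
have vI : {ae mu, forall t, forall b, I_dot B zeta b v t = d b - c b}.
  apply: ae_imp2 (W12_ae Wxi) xI => t xd xt b.
  rewrite -(dE b t) -(xt b) /I_dot.
  have e0d := @solution_derivable _ _ _ B _ t eta0_sol.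
  have xd' : field_derivable (-1 *: xi) t by exact: field_derivableZ.
  have -> : v = eta0 + -1 *: xi by rewrite scaleN1r.
  rewrite (D_D B e0d xd') (D_Z B (-1) Wxi.1 xd) dotC dotDl dotZl.
  change (dot t (D eta0 t) (zeta b t) + -1 * dot t (D xi t) (zeta b t)
    - dot t (eta0 t + -1 *: xi t) (D (zeta b) t) =
    dot t (zeta b t) (D eta0 t) - dot t (eta0 t) (D (zeta b) t) -
    (dot t (zeta b t) (D xi t) - dot t (xi t) (D (zeta b) t))).
  rewrite dotDl dotZl [dot t (D xi t) _]dotC [dot t (D eta0 t) _]dotC; ring.
have [_ _ <-] := crd_increment a Wv vF vI.
by rewrite crd_holonomy addrC addKr.
Qed.

Lemma h_quasiperiodic eta (e : 'I_k -> R) : I_const eta e -> h B xi eta = - \sum_a s a * e a.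
Proof.
move=> ec; have eI := I_const_dot ec; have [We ep] := (XspaceP eta).1 ec.1.
(* The primitive of the integrand of [h]. The summand [e a] compensates for the replacement of
   [(zeta^a, D eta)] by [(D zeta^a, eta)], which differ by the constant of [eta]. *)
pose f t := dot t (D eta0 t) (eta t) - \sum_a crd v a t * (dot t (D (zeta a) t) (eta t) + e a).
have e0D : W12_field (D eta0) by exact: solution_W12_D.
have fH : H1 0 T f.
  apply: H1B; first exact: W12_dot.
  apply: H1_sum => a; apply: H1M; first exact: (crd_H1 zeta_sol zeta_free a T0 Wv).
  by apply: H1D; [apply: W12_dot => //; exact: (zeta_D_W12 zeta_sol a)|exact: H1_cst].
have Hd : {ae mu, forall t, t \in `]0, T[ -> is_derive t (1 : R) f (qint B xi eta t)}.
  apply: ae_imp3 (W12_ae Wxi) (W12_ae We) eI => t xd ed et _.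
  have e0d := @solution_derivable _ _ _ B _ t eta0_sol.
  have e0dd := @solution_D_derivable _ _ _ B _ t eta0_sol.
  have e0a := solution_along_D eta0_sol.
  have vd : field_derivable v t.
    have xd' : field_derivable (-1 *: xi) t by exact: field_derivableZ.
    by rewrite /v -scaleN1r; exact: field_derivableD.
  have H1 := is_derive_fun_sum (fun a => is_derive_funM (is_derive_crd zeta_sol zeta_free Wv.1 vd a)
    (is_derive_funD (is_derive_dot B (@zald a) We.1 (@zdd a t) ed) (is_derive_cst (e a) t 1))).
  apply: (is_derive1_eq (is_derive_funB (is_derive_dot B e0a We.1 e0dd ed) H1)).
  rewrite (qintE B Wxi.1 We.1 xd ed).
  have xE : xi = eta0 - v by rewrite /v opprB addrC subrK.
  have P0 : Pi v = 0 by exact: Pi_0 Wv.1 vF.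
  have vE : v t = \sum_a crd v a t *: zeta a t.
    by rewrite {1}(Pi_decomp zeta_sol zeta_free t Wv.1) P0; exact: add0r.
  have DvE : D v t = \sum_a dcrd zeta v t a *: zeta a t + \sum_a crd v a t *: D (zeta a) t.
    rewrite {1}(D_Pi_decomp zeta_sol zeta_free Wv.1 vd) P0.
    by have := D_0 B t; rewrite /= => ->; exact: add0r.
  have UE (y : 'I_k -> R) : U t (\sum_a y a *: zeta a t) = \sum_a y a *: U t (zeta a t).
    elim/big_rec2: _ => [|a u u' _ <-]; last by rewrite (U_D B) (U_Z B).
    by have := U_Z B t 0 0; rewrite !scale0r.
  have E1 : dot t (D xi t) (D eta t) = dot t (D eta0 t) (D eta t) -
      (\sum_a dcrd zeta v t a * dot t (zeta a t) (D eta t) + \sum_a crd v a t * dot t (D (zeta a) t) (D eta t)).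
    have vd' : field_derivable (-1 *: v) t by exact: field_derivableZ.
    rewrite {1}xE -scaleN1r (D_D B e0d vd') (D_Z B (-1) Wv.1 vd) scaleN1r dotBl DvE dotDl.
    rewrite (dot_comb zeta t (fun a => dcrd zeta v t a)) [dot t (\sum_a crd v a t *: D (zeta a) t) _]dot_suml.
    by congr (_ - (_ + _)); apply: eq_bigr => a _; rewrite dotZl.
  have E2 : dot t (U t (xi t)) (eta t) = dot t (U t (eta0 t)) (eta t) -
      \sum_a crd v a t * dot t (U t (zeta a t)) (eta t).
    have -> : xi t = eta0 t + -1 *: v t by rewrite {1}xE scaleN1r.
    rewrite (U_D B) (U_Z B) scaleN1r dotBl vE UE dot_suml.
    by congr (_ - _); apply: eq_bigr => a _; rewrite dotZl.
  rewrite E1 E2 (@solution_DD _ _ _ B _ t eta0_sol).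
  have -> : \sum_a (dcrd zeta v t a * (dot t (D (zeta a) t) (eta t) + e a) +
      crd v a t * (dot t (D (D (zeta a)) t) (eta t) + dot t (D (zeta a) t) (D eta t) + 0)) =
    \sum_a dcrd zeta v t a * dot t (zeta a t) (D eta t) +
    (\sum_a crd v a t * dot t (U t (zeta a t)) (eta t) + \sum_a crd v a t * dot t (D (zeta a) t) (D eta t)).
    rewrite -!big_split; apply: eq_bigr => a _ /=.
    rewrite (@solution_DD _ _ _ B _ t (zeta_sol a)) -(et a) /I_dot [dot t (eta t) _]dotC; ring.
  ring.
have <- : f T - f 0 = - \sum_a s a * e a.
  (* Over a period [D eta0] gains [s_a D zeta^a], which cancels in [f] against the effect of the
     gain [s_a] of [crd v] in [E3]; only the terms [s_a e_a] survive. *)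
  have E1 : dot T (D eta0 T) (eta T) = dot 0 (D eta0 0) (eta 0) + \sum_a s a * dot 0 (D (zeta a) 0) (eta 0).
    rewrite -[in LHS](add0r T) ep -(D_shift B).
    have -> : (fun r => eta0 (r + T)) = eta0 + \sum_a s a *: zeta a.
      rewrite [X in _ = _ + X]fct_sumE; apply/funext => r; exact: eta0_per.
    have zsd a : field_derivable (s a *: zeta a) 0 by apply: field_derivableZ; exact: zd.
    have [sd sE] := @D_sum _ _ _ B _ (fun a => s a *: zeta a) 0 zsd.
    have e0d := @solution_derivable _ _ _ B _ 0 eta0_sol.
    rewrite (D_D B e0d sd) sE.
    have DzE a : D (s a *: zeta a) 0 = s a *: D (zeta a) 0 by exact: (D_Z B (s a) (@zal a) (@zd a 0)).
    under eq_bigr do rewrite DzE.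
    have t1 : tangent (gam 0) (D eta0 0 + \sum_a s a *: D (zeta a) 0).
      apply: tangentD; first by have H := solution_along_D eta0_sol; exact: (H 0).
      by apply: tangent_sum => a; apply: tangentZ; exact: (@zald a 0).
    rewrite (dotT t1 (We.1 0)) dotDl dot_suml; congr (_ + _).
    by apply: eq_bigr => a _; rewrite dotZl.
  have E2 a : dot T (D (zeta a) T) (eta T) = dot 0 (D (zeta a) 0) (eta 0).
    rewrite -[in LHS](add0r T) ep zeta_D_per; exact: (dotT (@zald a 0) (We.1 0)).
  have E3 : \sum_a crd v a T * (dot T (D (zeta a) T) (eta T) + e a) =
      \sum_a crd v a 0 * (dot 0 (D (zeta a) 0) (eta 0) + e a) +
      (\sum_a s a * dot 0 (D (zeta a) 0) (eta 0) + \sum_a s a * e a).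
    rewrite -!big_split; apply: eq_bigr => a _.
    by apply: (etrans (congr2 *%R (crd_holonomy a) (congr1 (+%R^~ (e a)) (E2 a)))) => /=; ring.
  have -> : f T = _ := congr2 (fun u w => u - w) E1 E3.
  rewrite /f; ring.
by rewrite -(H1_FTC T0 fH Hd).
Qed.

End quasiperiodic_solution.

(** The field is sought as [eta + x_a zeta^a]. Constancy of [I] with value [c] then says that [x']
    is the inverse Gram matrix applied to [c] minus the value of [I] on [eta]. Its primitive is
    periodic when this has zero integral over a period, an equation solvable for [c] because [gbar]
    is invertible. *)
Lemma I_const_exists eta : Xspace eta ->
  exists xi, Yspace B zeta xi /\ Zspace zeta (xi - eta).
Proof.
move=> Xe; have [We ep] := (XspaceP eta).1 Xe.
pose f (c : 'I_k -> R) a t := \sum_b hm t a b * (c b - I_dot B zeta b eta t).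
have I_L2 b (x y : R) : x <= y -> L2 x y (I_dot B zeta b eta).
  move=> xy; apply: L2D; first exact: (W12_dotD B (zeta_W12 zeta_sol b) We xy).
  have -> : (fun t => - dot t (eta t) (D (zeta b) t)) = (fun t => -1 * dot t (eta t) (D (zeta b) t)).
    by apply/funext => t; rewrite mulN1r.
  apply: L2Mcont; first by apply: within_continuous => t _; exact: cst_continuous.
  exact: (W12_dotD B We (zeta_W12 zeta_sol b) xy).
have f_L2 (c : 'I_k -> R) a (x y : R) : x <= y -> L2 x y (f c a).
  move=> xy; apply: L2_sum => b; apply: L2Mcont; first exact: gram_inv_within.
  apply: L2D; first by apply: L2_cont; apply: within_continuous => t _; exact: cst_continuous.
  have -> : (fun t => - I_dot B zeta b eta t) = (fun t => -1 * I_dot B zeta b eta t).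
    by apply/funext => t; rewrite mulN1r.
  apply: L2Mcont; first by apply: within_continuous => t _; exact: cst_continuous.
  exact: I_L2.
pose e a := \int[mu]_(t in `[0, T]) \sum_b hm t a b * I_dot B zeta b eta t.
(* The solution of [gbar c = e], which makes the integrals of the [f c a] vanish. *)
pose c a := \sum_b kappa zeta a b * e b.
have f0 a : \int[mu]_(t in `[0, T]) f c a t = 0.
  have Lh b : L1 0 T (fun t => hm t a b) by apply: L1_cont; exact: gram_inv_within.
  have LI : L1 0 T (fun t => \sum_b hm t a b * I_dot B zeta b eta t).
    apply: L1_sum => b; apply: L2_L1; apply: L2Mcont; first exact: gram_inv_within.
    exact: I_L2.
  have Lc b : L1 0 T (fun t => c b * hm t a b) by apply: L1Z.
  have E : f c a = (fun t => \sum_b c b * hm t a b + -1 * \sum_b hm t a b * I_dot B zeta b eta t).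
    apply/funext => t; rewrite mulN1r -sumrB; apply: eq_bigr => b _; ring.
  rewrite E (L1_RintegralD (L1_sum Lc) (L1Z (-1) LI)) (L1_Rintegral_sum Lc) (L1_RintegralZ (-1) LI).
  rewrite -/(e a) mulN1r; apply/eqP; rewrite subr_eq0; apply/eqP.
  have -> : e a = \sum_b gbar a b * c b.
    have gk b : \sum_i gbar a i * kappa zeta i b = (a == b)%:R.
      by have /matrixP/(_ a b) := mulmxV gbar_unit; rewrite [in RHS]mxE => <-; rewrite mxE.
    under eq_bigr => b _ do rewrite /c mulr_sumr.
    rewrite exchange_big/=; under eq_bigr => b _.
      under eq_bigr do rewrite mulrA.
      rewrite -mulr_suml gk; over.
    by rewrite (bigD1 a)//= eqxx mul1r big1 ?addr0// => b ba; rewrite eq_sym (negbTE ba) mul0r.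
  by apply: eq_bigr => b _; rewrite mxE (L1_RintegralZ (c b) (Lh b)) mulrC.
have fper a : {ae mu, forall t, f c a (t + T) = f c a t}.
  apply: ae_imp (W12_ae We) => t ed.
  have Dp : D eta (t + T) = D eta t.
    by rewrite -(D_shift B); congr (D _ _); apply/funext => r; exact: ep.
  have Ip b : I_dot B zeta b eta (t + T) = I_dot B zeta b eta t.
    rewrite /I_dot (zeta_per b t) (ep t) (zeta_D_per b t) Dp.
    by rewrite (dotT (@zal b t) (D_tangent B We.1 ed)) (dotT (We.1 t) (@zald b t)).
  by apply: eq_bigr => b _; rewrite gram_inv_per Ip.
have xex a := H1_ex_primitive (f_L2 c a).
pose x a := projT1 (cid (xex a)).
have xH a (y z : R) : y <= z -> H1 y z (x a) by move: y z; rewrite /x; case: cid => y [].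
have xd a : {ae mu, forall t, is_derive t (1 : R) (x a) (f c a t)} by rewrite /x; case: cid => y [].
have xI a (y z : R) : y <= z -> x a z - x a y = \int[mu]_(t in `[y, z]) f c a t.
  by move: y z; rewrite /x; case: cid => y [].
have xper a t : x a (t + T) = x a t.
  (* Periodicity of [f c a] makes increments of [x a] invariant under a shift by one period; with
     [xT] this gives periodicity of [x a]. *)
  have step (y z : R) : y <= z -> x a (z + T) - x a (y + T) = x a z - x a y.
    move=> yz; rewrite (xI a y z yz) (xI a _ _ (lerD yz (lexx T))).
    rewrite L1_Rintegral_shift; last by apply: L2_L1; apply: f_L2; rewrite lerD2r.
    by apply: ae_Rintegral; apply: ae_imp (fper a) => r rE _.
  have xT : x a T = x a 0 by apply/eqP; rewrite -subr_eq0 (xI a 0 T T0) f0.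
  have [t0|/ltW t0] := leP 0 t.
    by have := step 0 t t0; rewrite add0r xT => /addIr.
  by have := step t 0 t0; rewrite add0r xT => /addrI/oppr_inj.
pose xi := eta + \sum_a fscale (x a) (zeta a).
have xiE t : xi t = eta t + \sum_a x a t *: zeta a t.
  by rewrite /xi; change (eta t + (\sum_a fscale (x a) (zeta a)) t = eta t + \sum_a x a t *: zeta a t); rewrite fct_sumE.
have Wxi : W12_field xi.
  apply: W12_fieldD => //; apply: W12_field_sum => a; apply: W12_fscale; last exact: zeta_W12.
  by move=> y z yz; exact: xH.
have Xxi : Xspace xi.
  apply/XspaceP; split=> // t; rewrite !xiE ep; congr (_ + _).
  by apply: eq_bigr => a _; rewrite xper zeta_per.
exists xi; split; last first.
  split; last first.
    move=> t; exists (fun a => x a t); change (xi t - eta t = \sum_a x a t *: zeta a t).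
    by rewrite xiE addrAC subrr add0r.
  apply/XspaceP; split; first exact: W12_fieldB.
  move=> t; have [_ xip] := (XspaceP xi).1 Xxi.
  exact (congr2 (fun u v => u - v) (xip t) (ep t)).
split=> //; exists c => b.
apply: ae_imp2 (W12_ae We) (ae_forall xd) => t ed xdt.
have sd a := field_derivable_fscale (xdt a) (@zd a t).
have [Sd SE] := @D_sum _ _ _ B _ (fun a => fscale (x a) (zeta a)) t sd.
rewrite (I_dotE zeta_sol b Wxi.1 (field_derivableD ed Sd)) /I_dot xiE (D_D B ed Sd) SE.
have -> : \sum_a D (fscale (x a) (zeta a)) t = \sum_a f c a t *: zeta a t + \sum_a x a t *: D (zeta a) t.
  rewrite -big_split; apply: eq_bigr => a _; exact: D_fscale (@zal a) (xdt a) (@zd a t).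
rewrite dotC !dotDl (dot_comb zeta t (fun a => f c a t)) (dot_comb zeta t (fun a => x a t)).
have -> : dot t (\sum_a x a t *: D (zeta a) t) (zeta b t) = \sum_a x a t * dot t (zeta a t) (D (zeta b) t).
  by rewrite dot_suml; apply: eq_bigr => a _; rewrite dotZl dotC zeta_iso.
have -> : \sum_a f c a t * dot t (zeta a t) (zeta b t) = c b - I_dot B zeta b eta t.
  rewrite (@gram_solve _ _ _ B _ zeta zeta_sol zeta_free t (fun b => c b - I_dot B zeta b eta t) (fun a => f c a t)) //.
  by apply: eq_bigr => a _; rewrite (gramE zeta_sol) dotC mulrC.
rewrite /I_dot [dot t (D eta t) _]dotC; ring.
Qed.

End periodic_reduction.

(** * The solutions dual to the periodic ones *)

Section quotient_by_span.
Context {R : nzRingType} {V : lmodType R} {k : nat} (b : 'I_k -> V).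

Lemma qclass_lin (x : R) u v : qclass b (x *: u + v) = x *: qclass b u + qclass b v.
Proof. by rewrite qclassD -qclassZ. Qed.

Lemma qclass_sum (I : finType) (y : I -> R) (v : I -> V) :
  qclass b (\sum_i y i *: v i) = \sum_i y i *: qclass b (v i).
Proof.
elim/big_rec2: _ => [|i u u' _ <-]; last by rewrite qclass_lin.
by apply: (addrI (qclass b 0)); rewrite -qclassD add0r addr0.
Qed.

End quotient_by_span.

Section dual_solutions.
Context {R : realType} {m : nat} {S : lagrangian_system R m} (B : second_variation S).
Context {k : nat} (zeta eta : 'I_k -> field S) (s : 'M[R]_k).
Local Notation gam := (gamma S).
Local Notation mu := (@lebesgue_measure R).
Local Notation D := (D B).
Local Notation T := (tau S).
Local Notation Pi := (Pi zeta).
Local Notation gbar := (gbar zeta).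
Local Notation kappa := (kappa zeta).
Local Notation I_const := (I_const B zeta).
Implicit Types (t : R) (a b : 'I_k) (c d : 'I_k -> R) (xi : field S).

Hypothesis zeta_sol : forall a, solution B (zeta a).
Hypothesis zeta_free : forall t, lin_indep (fun a => zeta a t).
Hypothesis zeta_iso : forall a b t, dot t (zeta a t) (D (zeta b) t) = dot t (zeta b t) (D (zeta a) t).
Hypothesis zeta_per : forall a t, zeta a (t + T) = zeta a t.
Hypothesis eta_sol : forall a, solution B (eta a).
Hypothesis eta_per : forall a t, eta a (t + T) = eta a t + \sum_b s a b *: zeta b t.
Hypothesis eta_dual : forall a b t, I_dot B zeta b (eta a) t = (b == a)%:R.
Hypothesis det_aperp : \det (aperp_mx zeta s) != 0.

Let lin := I_const_lin zeta_sol.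
Let span0 := I_const_span zeta_sol zeta_iso zeta_per.

Lemma I_const_along xi c : I_const xi c -> along xi.
Proof. by move=> [/XspaceP[[]]]. Qed.

Lemma I_const_ext xi c c' : c =1 c' -> I_const xi c -> I_const xi c'.
Proof. by move=> /funext ->. Qed.

(** Elements of Gamma have constants 0, so the constants depend on the class alone; this frees what
    follows from the representative that [qrepr] picks. *)
Lemma I_const_qclass xi xi' c : qclass zeta xi = qclass zeta xi' -> I_const xi c -> I_const xi' c.
Proof.
move=> /qclassE/span0 H xc; have := lin (-1) H xc.
rewrite scaleN1r opprB subrK; apply: I_const_ext => a; ring.
Qed.

Lemma Pi_qclass xi xi' c : qclass zeta xi = qclass zeta xi' -> I_const xi c -> Pi xi = Pi xi'.
Proof.
move=> E xc; have xi'c := I_const_qclass E xc.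
move/qclassE : E => [d E].
have E' : xi = 1 *: (\sum_a d a *: zeta a) + xi' by rewrite -E scale1r subrK.
have za : along (\sum_a d a *: zeta a).
  by apply: along_sum => a; apply: alongZ; exact: zeta_along.
rewrite E' (Pi_lin zeta_sol zeta_free 1 za (I_const_along xi'c)) (Pi_0 zeta_sol zeta_free za) ?scaler0 ?add0r//.
by move=> t; exists d; rewrite fct_sumE.
Qed.

Lemma I_const_sum (y : 'I_k -> R) (xi : 'I_k -> field S) (C : 'M[R]_k) :
  (forall a, I_const (xi a) (C a)) ->
  I_const (\sum_a y a *: xi a) (fun b => \sum_a y a * C a b).
Proof.
move=> xC; apply: (@I_const_ext _ (fun b => \sum_(a <- index_enum 'I_k) y a * C a b)) => //.
elim: (index_enum 'I_k) => [|a r ih].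
  rewrite big_nil; apply: (@I_const_ext _ (fun=> 0)) => [b|]; first by rewrite big_nil.
  by apply: span0; exists (fun=> 0); rewrite big1// => a _; rewrite scale0r.
rewrite big_cons; apply: I_const_ext (lin (y a) (xC a) ih) => b.
by rewrite big_cons.
Qed.

Lemma Pi_sum (y : 'I_k -> R) (xi : 'I_k -> field S) : (forall a, along (xi a)) ->
  Pi (\sum_a y a *: xi a) = \sum_a y a *: Pi (xi a).
Proof.
move=> xit; elim: (index_enum 'I_k) => [|a r ih].
  rewrite !big_nil; apply: (Pi_0 zeta_sol zeta_free) => t; first exact: tangent0.
  by exists (fun=> 0); rewrite big1// => a _; rewrite scale0r.
rewrite !big_cons (Pi_lin zeta_sol zeta_free (y a) (xit a)) ?ih//.
by elim/big_rec: _ => [|b z _ zt]; [by move=> t; exact: tangent0|apply: alongD => //; exact: alongZ].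
Qed.

Let ealong a : along (eta a).
Proof. exact: solution_along. Qed.

Lemma Pi_eta_Xspace a : Xspace (Pi (eta a)).
Proof.
apply/XspaceP; split; first exact: (W12_Pi zeta_sol zeta_free (solution_W12 (eta_sol a))).
move=> t; rewrite !(Pi_at zeta_sol zeta_free _ (ealong a)) eta_per.
have zt : tangent (gam t) (\sum_b s a b *: zeta b t) by exact: (tangent_comb zeta_sol).
have et : tangent (gam t) (eta a t) by exact: ealong.
rewrite (perp_per zeta_sol zeta_per (tangentD et zt)) /perp.
have -> : \sum_b coef zeta t (eta a t + \sum_e s a e *: zeta e t) b *: zeta b t =
    \sum_b coef zeta t (eta a t) b *: zeta b t + \sum_b s a b *: zeta b t.
  rewrite -big_split; apply: eq_bigr => b _ /=; rewrite -scalerDl; congr (_ *: _).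
  rewrite -(coef_comb zeta_sol zeta_free t (s a) b) /coef -big_split; apply: eq_bigr => c _ /=.
  by rewrite dotDl mulrDr.
by rewrite opprD addrACA subrr addr0.
Qed.

Definition etahat a := Phi B zeta (Pi (eta a)).
(** The representative on which [hhat] and [Pihat] evaluate the class; values of [h] and [Pi] are
    computed on it. *)
Definition etalift a := qrepr (etahat a).

Lemma etalift_spec a : exists c, I_const (etalift a) c /\ forall t, Fspace zeta t (eta a t - etalift a t).
Proof.
have [xi0 xi0P] := I_const_exists zeta_sol zeta_free zeta_iso zeta_per (Pi_eta_Xspace a).
(* [y] is the field chosen inside [Phi]; by [xi0P] the choice is not the default 0. *)
set y := xget 0 [set xi | Yspace B zeta xi /\ Zspace zeta (xi - Pi (eta a))].
have [[Xy [c yc]] [_ yF]] : Yspace B zeta y /\ Zspace zeta (y - Pi (eta a)).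
  exact (@xgetPex _ 0 [set xi | Yspace B zeta xi /\ Zspace zeta (xi - Pi (eta a))] (ex_intro _ xi0 xi0P)).
have E : qclass zeta (etalift a) = qclass zeta y by rewrite /etalift qreprK.
exists c; split; first exact: I_const_qclass (esym E) (conj Xy yc).
move=> t; have [d /(congr1 (fun f : field S => f t))] := (qclassE zeta _ _).1 (esym E).
rewrite fct_sumE => dE; have [e eE] := yF t; have [f fE] := Pi_Fspace zeta_sol zeta_free t (ealong a).
(* Three contributions: [y] against its representative, [y] against [Pi (eta a)], and [eta a]
   against its projection. *)
exists (fun b => d b - e b + f b).
under eq_bigr do rewrite scalerDl scalerBl.
rewrite big_split sumrB/= -fE -eE.
have -> : \sum_b d b *: zeta b t = y t - etalift a t by exact: esym dE.
change (eta a t - etalift a t = y t - etalift a t - (y t - Pi (eta a) t) + (eta a t - Pi (eta a) t)).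
by rewrite opprB [X in _ = X + _]addrC (addrA (_ - y t)) subrK [RHS]addrC addrA subrK.
Qed.

(** The matrix called C above: row [a] holds the values of [I] on [etalift a]. *)
Definition etaconst : 'M[R]_k := \matrix_(a, b) projT1 (cid (etalift_spec a)) b.

Lemma etalift_const a : I_const (etalift a) (etaconst a).
Proof.
have := (projT2 (cid (etalift_spec a))).1.
by apply: I_const_ext => b; rewrite mxE.
Qed.

Lemma etalift_F a t : Fspace zeta t (eta a t - etalift a t).
Proof. exact: (projT2 (cid (etalift_spec a))).2. Qed.

Lemma Pi_etalift a : Pi (etalift a) = Pi (eta a).
Proof.
have xa := I_const_along (etalift_const a).
have da : along (eta a - etalift a) by exact: alongB.
have -> : eta a = 1 *: (eta a - etalift a) + etalift a by rewrite scale1r subrK.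
by rewrite (Pi_lin zeta_sol zeta_free 1 da xa) (Pi_0 zeta_sol zeta_free da (etalift_F a)) scaler0 add0r.
Qed.

Lemma h_etalift a xi c : I_const xi c -> h B (etalift a) xi = - \sum_b s a b * c b.
Proof.
exact: (h_quasiperiodic zeta_sol zeta_free zeta_per (eta_sol a) (eta_per a) (etalift_const a) (etalift_F a)).
Qed.

Let G := gbar.

Let GT : G^T = G.
Proof. by apply/matrixP => a b; rewrite mxE (gbar_sym zeta_sol). Qed.

Let Gu : G \in unitmx.
Proof. exact: gbar_unit zeta_sol zeta_free. Qed.

Let kT : kappa^T = kappa.
Proof. by rewrite /Defs.kappa trmx_inv -/G GT. Qed.

Lemma s_etaconst : s = (1%:M - etaconst) *m gbar.
Proof.
apply/matrixP => a b; rewrite mxE.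
rewrite (holonomy_gbar zeta_sol zeta_free zeta_iso zeta_per (eta_sol a) (eta_per a) (etalift_const a) (etalift_F a) b (eta_dual a)).
apply: eq_bigr => c _; rewrite (gbar_sym zeta_sol) mulrC; congr (_ * _).
by rewrite !mxE [c == a]eq_sym.
Qed.

Lemma etaconstE : etaconst = 1%:M - s *m kappa.
Proof. by rewrite s_etaconst -mulmxA /Defs.kappa mulmxV// mulmx1 opprB addrC subrK. Qed.

Lemma etaconst_unit : etaconst \in unitmx.
Proof.
have -> : etaconst = - (aperp_mx zeta s *m kappa).
  by rewrite etaconstE /aperp_mx mulmxBl /Defs.kappa mulmxV// opprB.
rewrite unitmxE -scaleN1r detZ det_mulmx !unitfE !mulf_neq0 ?signr_eq0//.
by rewrite -unitfE -unitmxE /Defs.kappa unitmx_inv.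
Qed.

Lemma h_etalift2 a b : h B (etalift a) (etalift b) = - (s *m etaconst^T) a b.
Proof.
rewrite (h_etalift a (etalift_const b)) mxE; congr (- _).
by apply: eq_bigr => c _; rewrite [etaconst^T _ _]mxE.
Qed.

(** Symmetry of [h] gives [s C^T = C s^T]. With [C = 1 - s kappa] and [kappa] symmetric this reads
    [s - s kappa s^T = s^T - s kappa s^T], and the quadratic terms cancel. *)
Lemma s_sym : s^T = s.
Proof.
have E : s *m etaconst^T = etaconst *m s^T.
  rewrite -[RHS]trmxK trmx_mul trmxK; apply/matrixP => a b; rewrite [RHS]mxE.
  apply: oppr_inj; rewrite -!h_etalift2.
  by apply: h_sym; exact: (etalift_const _).1.
move: E; rewrite etaconstE linearB/= trmx1 trmx_mul kT mulmxBr mulmxBl mulmx1 mul1mx mulmxA.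
by move=> /addIr.
Qed.

Lemma h_etalift_amx a b : h B (etalift a) (etalift b) = a_mx zeta s a b.
Proof.
rewrite h_etalift2 etaconstE linearB/= trmx1 trmx_mul kT s_sym mulmxBr mulmx1 mulmxA.
by rewrite /a_mx !mxE opprB.
Qed.

(** By [h_hperp] the value is that of [h] minus the entry of [C gbar C^T]; expanding C leaves [(s
    kappa s - s) - (gbar - 2 s + s kappa s)]. *)
Lemma hperp_eta a b : hperp B zeta (Pi (eta a)) (Pi (eta b)) = aperp_mx zeta s a b.
Proof.
have := h_hperp zeta_sol zeta_free zeta_iso zeta_per (etalift_const a) (etalift_const b).
rewrite !Pi_etalift h_etalift_amx.
have -> : bil gbar (etaconst a) (etaconst b) = (etaconst *m gbar *m etaconst^T) a b.
  rewrite mxE /bil exchange_big; apply: eq_bigr => c _; rewrite !mxE mulr_suml; apply: eq_bigr => d _ /=; ring.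
have -> : etaconst *m gbar *m etaconst^T = gbar - s - s + s *m kappa *m s.
  have kG : kappa *m gbar = 1%:M by exact: mulVmx.
  have Gk : gbar *m kappa = 1%:M by exact: mulmxV.
  rewrite etaconstE linearB/= trmx1 trmx_mul kT s_sym mulmxBl mul1mx -(mulmxA s kappa gbar) kG mulmx1.
  by rewrite mulmxBr mulmx1 mulmxBl (mulmxA gbar) Gk mul1mx mulmxA opprB addrA addrAC.
rewrite /a_mx /aperp_mx !mxE => E; lra.
Qed.

Lemma hperp_eta_Y0 a xi : Y0space B zeta xi -> hperp B zeta (Pi (eta a)) (Pi xi) = 0.
Proof.
move=> x0; have xc : I_const xi (fun=> 0) by [].
have := h_hperp zeta_sol zeta_free zeta_iso zeta_per (etalift_const a) xc.
rewrite Pi_etalift (h_etalift a xc) /bil !big1 ?oppr0 ?addr0// => [b _|b _]; last by rewrite mulr0.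
by rewrite big1// => c _; rewrite mulr0.
Qed.

Lemma Yspace_decomp xi c : I_const xi c ->
  exists (y : 'I_k -> R) xi0, Y0space B zeta xi0 /\ xi = \sum_a y a *: etalift a + xi0.
Proof.
move=> xc; pose r : 'rV[R]_k := (\row_b c b) *m invmx etaconst.
exists (fun a => r 0 a), (xi - \sum_a r 0 a *: etalift a); split; last by rewrite addrC subrK.
have H := lin (-1) (I_const_sum (fun a => r 0 a) etalift_const) xc.
suff : I_const (xi - \sum_a r 0 a *: etalift a) (fun=> 0) by [].
rewrite addrC -scaleN1r; apply: I_const_ext H => b.
have /matrixP/(_ 0 b) : r *m etaconst = \row_b c b by rewrite mulmxKV// etaconst_unit.
by rewrite !mxE => ->; rewrite mulN1r addNr.
Qed.

Lemma etaconst_free (y : 'I_k -> R) : (forall b, \sum_a y a * etaconst a b = 0) -> forall a, y a = 0.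
Proof.
move=> yC a; pose r := \row_a y a.
have : r *m etaconst = 0 by apply/rowP => b; rewrite !mxE -[RHS](yC b); apply: eq_bigr => c _; rewrite mxE.
move=> /(congr1 (mulmx^~ (invmx etaconst))); rewrite mulmxK ?etaconst_unit// mul0mx => /rowP/(_ a).
by rewrite !mxE.
Qed.

Lemma Pi_inj xi xi' c c' : I_const xi c -> I_const xi' c' -> Pi xi = Pi xi' -> qclass zeta xi = qclass zeta xi'.
Proof.
move=> xc xc' E; apply/qclassE.
have := lin (-1) xc' xc; rewrite scaleN1r addrC => H.
apply: (I_const_Zspace zeta_sol zeta_free zeta_iso zeta_per H) => t.
have dt := I_const_along H.
have P0 : Pi (xi - xi') = 0.
  have -> : xi - xi' = -1 *: xi' + xi by rewrite scaleN1r addrC.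
  by rewrite (Pi_lin zeta_sol zeta_free (-1) (I_const_along xc') (I_const_along xc)) E scaleN1r addNr.
have := Pi_Fspace zeta_sol zeta_free t dt; rewrite P0.
by have -> : (xi - xi') t - (0 : field S) t = (xi - xi') t by exact: subr0.
Qed.

Lemma etahat_sum (y : 'I_k -> R) :
  \sum_a y a *: etahat a = qclass zeta (\sum_a y a *: etalift a).
Proof. by rewrite qclass_sum; apply: eq_bigr => a _; rewrite /etalift qreprK. Qed.

Lemma Yhat_qrepr x : Yhat B zeta x -> exists c, I_const (qrepr x) c.
Proof.
by move=> [xi [Xx [c xc]] <-]; exists c; apply: (@I_const_qclass xi); rewrite ?qreprK.
Qed.

Lemma Y0hat_qrepr x : Y0hat B zeta x -> I_const (qrepr x) (fun=> 0).
Proof. by move=> [xi x0 <-]; apply: (@I_const_qclass xi); rewrite ?qreprK. Qed.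

Lemma Pihat_qclass xi c : I_const xi c -> Pihat zeta (qclass zeta xi) = Pi xi.
Proof. by move=> xc; apply/esym/(Pi_qclass _ xc); rewrite qreprK. Qed.

Lemma Yhat_lin (x : R) u v : Yhat B zeta u -> Yhat B zeta v -> Yhat B zeta (x *: u + v).
Proof.
move=> [xi [Xx [c xc]] <-] [xi' [Xx' [c' xc']] <-].
exists (x *: xi + xi'); last by rewrite qclass_lin.
have H := lin x (conj Xx xc : I_const xi c) (conj Xx' xc').
by split; [exact: H.1|exists (fun a => x * c a + c' a); exact: H.2].
Qed.

Lemma Y0hat_Yhat : Y0hat B zeta `<=` Yhat B zeta.
Proof. by move=> _ [xi [Xx x0] <-]; exists xi => //; split=> //; exists (fun=> 0). Qed.

Lemma etahat_Yhat : spanned etahat `<=` Yhat B zeta.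
Proof.
move=> _ [y ->]; rewrite etahat_sum; eexists; last by [].
have H := I_const_sum y etalift_const.
by split; [exact: H.1|eexists; exact: H.2].
Qed.

Lemma Pihat_etahat (y : 'I_k -> R) : Pihat zeta (\sum_a y a *: etahat a) = \sum_a y a *: Pi (eta a).
Proof.
rewrite etahat_sum (Pihat_qclass (I_const_sum y etalift_const)) Pi_sum.
  by apply: eq_bigr => a _; rewrite Pi_etalift.
by move=> a; exact: I_const_along (etalift_const a).
Qed.

Lemma Pihat_lin (x : R) u v : Yhat B zeta u -> Yhat B zeta v ->
  Pihat zeta (x *: u + v) = x *: Pihat zeta u + Pihat zeta v.
Proof.
move=> /Yhat_qrepr[c uc] /Yhat_qrepr[d vd].
rewrite -{1}(qreprK u) -{1}(qreprK v) -qclass_lin (Pihat_qclass (lin x uc vd)).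
exact: (Pi_lin zeta_sol zeta_free x (I_const_along uc) (I_const_along vd)).
Qed.

Lemma Pihat_inj u v : Yhat B zeta u -> Yhat B zeta v -> Pihat zeta u = Pihat zeta v -> u = v.
Proof.
move=> /Yhat_qrepr[c uc] /Yhat_qrepr[d vd] /(Pi_inj uc vd).
by rewrite !qreprK.
Qed.

Lemma Pi_Xperp xi c : I_const xi c -> Xperp zeta (Pi xi).
Proof.
move=> xc; split; first exact: (Pi_Xspace zeta_sol zeta_free zeta_per xc.1).
by move=> t; exact: (Pi_Eperp zeta_sol zeta_free t (I_const_along xc)).
Qed.

(** A correction of [xi] lying in Y differs from it by a field in F_t, which [Pi] kills. Hence [Pi]
    maps Y onto X^perp, and the decomposition of Y can be transported there. *)
Lemma Xperp_Pi xi : Xperp zeta xi -> exists xi' c, I_const xi' c /\ Pi xi' = xi.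
Proof.
move=> [Xx xE].
have [xi' [[Xx' [c xc]] [_ xF]]] := I_const_exists zeta_sol zeta_free zeta_iso zeta_per Xx.
exists xi', c; split=> //; have xt := Xspace_along Xx; have xt' := Xspace_along Xx'.
have dt : along (xi' - xi) by exact: alongB.
have -> : xi' = 1 *: (xi' - xi) + xi by rewrite scale1r subrK.
rewrite (Pi_lin zeta_sol zeta_free 1 dt xt) (Pi_0 zeta_sol zeta_free dt xF) scaler0 add0r.
exact: (Pi_id zeta_sol zeta_free).
Qed.

Lemma etalift_sum_Y0 (y : 'I_k -> R) : I_const (\sum_a y a *: etalift a) (fun=> 0) -> forall a, y a = 0.
Proof.
move=> H; apply: etaconst_free => b.
exact: (I_const_unique (I_const_sum y etalift_const) H b).
Qed.

Lemma direct_sum_Yhat : direct_sum (Yhat B zeta) (spanned etahat) (Y0hat B zeta).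
Proof.
split.
  apply/seteqP; split=> [_ [xi [Xx [c xc]] <-]|_ [u [v [uE vE ->]]]]; last first.
    by rewrite -[u]scale1r; apply: Yhat_lin; [exact: etahat_Yhat|exact: Y0hat_Yhat].
  have [y [xi0 [x0 ->]]] := Yspace_decomp (conj Xx xc : I_const xi c).
  exists (\sum_a y a *: etahat a), (qclass zeta xi0); split; [by exists y|by exists xi0|].
  by rewrite etahat_sum qclassD.
apply/seteqP; split=> [_ [[y ->] /Y0hat_qrepr H]|_ ->]; last first.
  split; first by exists (fun=> 0); rewrite big1// => a _; rewrite scale0r.
  exists 0; last exact: raddf0.
  by apply: (@span0 0); exists (fun=> 0); rewrite big1// => a _; rewrite scale0r.
have H' : I_const (\sum_a y a *: etalift a) (fun=> 0).
  by apply: I_const_qclass H; rewrite qreprK etahat_sum.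
by rewrite big1// => a _; rewrite (etalift_sum_Y0 H') scale0r.
Qed.

Lemma direct_sum_Xperp : direct_sum (Xperp zeta) (spanned (fun a => Pi (eta a))) (Pi @` Y0space B zeta).
Proof.
have PiE (y : 'I_k -> R) : \sum_a y a *: Pi (eta a) = Pi (\sum_a y a *: etalift a).
  rewrite Pi_sum => [|a]; last exact: I_const_along (etalift_const a).
  by apply: eq_bigr => a _; rewrite Pi_etalift.
have PiD xi xi' c c' : I_const xi c -> I_const xi' c' -> Pi (xi + xi') = Pi xi + Pi xi'.
  move=> xc xc'; have := Pi_lin zeta_sol zeta_free 1 (I_const_along xc) (I_const_along xc').
  by rewrite !scale1r.
have HC y := I_const_sum y etalift_const.
split.
  apply/seteqP; split=> [xi /Xperp_Pi[xi' [c [xc <-]]]|_ [_ [_ [[y ->] [xi0 x0 <-] ->]]]].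
    have [y [xi0 [x0 E]]] := Yspace_decomp xc.
    exists (\sum_a y a *: Pi (eta a)), (Pi xi0); split; [by exists y|by exists xi0|].
    by rewrite E PiE (PiD _ _ _ _ (HC y) x0).
  rewrite PiE -(PiD _ _ _ _ (HC y) x0).
  have := lin 1 (HC y) x0; rewrite scale1r; exact: Pi_Xperp.
apply/seteqP; split=> [_ [[y ->] [xi0 x0]]|_ ->]; last first.
  split; first by exists (fun=> 0); rewrite big1// => a _; rewrite scale0r.
  have s0 : spanned zeta 0 by exists (fun=> 0); rewrite big1// => a _; rewrite scale0r.
  exists 0; first exact: span0 s0.
  apply: (Pi_0 zeta_sol zeta_free) => t; first exact: tangent0.
  by exists (fun=> 0); rewrite big1// => a _; rewrite scale0r.
(* Equal projections mean equal classes modulo Gamma, so the combination has the zero constants of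
   an element of Y^0, and invertibility of [etaconst] kills its coefficients. *)
rewrite PiE => E; have H' : I_const (\sum_a y a *: etalift a) (fun=> 0).
  by apply: (I_const_qclass _ x0); exact: (Pi_inj x0 (HC y) E).
by rewrite -PiE big1// => a _; rewrite (etalift_sum_Y0 H') scale0r.
Qed.

Lemma Pihat_iso_etahat : linear_iso (spanned etahat) (spanned (fun a => Pi (eta a))) (Pihat zeta).
Proof.
split=> [x u v /etahat_Yhat uY /etahat_Yhat vY|]; first exact: Pihat_lin.
split.
- by move=> _ [y ->]; exists y; exact: Pihat_etahat.
- by move=> u v; rewrite !inE => /etahat_Yhat uY /etahat_Yhat vY; exact: Pihat_inj.
- by move=> _ [y ->]; exists (\sum_a y a *: etahat a); [exists y|exact: Pihat_etahat].
Qed.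

Lemma Pihat_iso_Y0hat : linear_iso (Y0hat B zeta) (X0perp B zeta) (Pihat zeta).
Proof.
split=> [x u v /Y0hat_Yhat uY /Y0hat_Yhat vY|]; first exact: Pihat_lin.
split.
- by move=> u /Y0hat_qrepr H; exists (qrepr u).
- by move=> u v; rewrite !inE => /Y0hat_Yhat uY /Y0hat_Yhat vY; exact: Pihat_inj.
- move=> _ [xi x0 <-]; exists (qclass zeta xi); first by exists xi.
  exact: (@Pihat_qclass xi (fun=> 0)).
Qed.

Lemma h_Y0 xi xi' : I_const xi (fun=> 0) -> I_const xi' (fun=> 0) ->
  h B xi xi' = hperp B zeta (Pi xi) (Pi xi').
Proof.
move=> x0 x0'; rewrite (h_hperp zeta_sol zeta_free zeta_iso zeta_per x0 x0').
by rewrite /bil big1 ?addr0// => a _; rewrite big1// => b _; rewrite mulr0.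
Qed.

End dual_solutions.

(** The square matrices expressing the basis and the spanning family in each other satisfy
    [X Y = 1], hence [Y X = 1]; a relation with coefficient row [r] has [r Y = 0], so
    [r = r Y X = 0]. This turns the dimension of F_t into pointwise independence of the [zeta a]. *)
Lemma spanning_lin_indep (F : comUnitRingType) (V : lmodType F) k (f : 'I_k -> V) :
  has_dim (spanned f) k -> lin_indep f.
Proof.
move=> [b [b_free E]] c c0.
have bf i : exists d : 'I_k -> F, b i = \sum_j d j *: f j.
  have : spanned b (b i).
    exists (fun j => (i == j)%:R); rewrite (bigD1 i)//= eqxx scale1r big1 ?addr0// => j ji.
    by rewrite eq_sym (negbTE ji) scale0r.
  by rewrite -E => -[d dE]; exists d.
have fb i : exists d : 'I_k -> F, f i = \sum_j d j *: b j.
  have : spanned f (f i).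
    exists (fun j => (i == j)%:R); rewrite (bigD1 i)//= eqxx scale1r big1 ?addr0// => j ji.
    by rewrite eq_sym (negbTE ji) scale0r.
  by rewrite E => -[d dE]; exists d.
pose X : 'M[F]_k := \matrix_(i, j) projT1 (cid (bf i)) j.
pose Y : 'M[F]_k := \matrix_(i, j) projT1 (cid (fb i)) j.
have XE i : b i = \sum_j X i j *: f j.
  by rewrite [LHS](projT2 (cid (bf i))); apply: eq_bigr => j _; rewrite mxE.
have YE i : f i = \sum_j Y i j *: b j.
  by rewrite [LHS](projT2 (cid (fb i))); apply: eq_bigr => j _; rewrite mxE.
have comb (x : 'I_k -> F) : \sum_i x i *: f i = \sum_j (\sum_i x i * Y i j) *: b j.
  under eq_bigr do rewrite YE scaler_sumr; rewrite exchange_big; apply: eq_bigr => j _ /=.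
  by rewrite scaler_suml; apply: eq_bigr => i _; rewrite scalerA.
have XY : X *m Y = 1%:M.
  apply/matrixP => i j; rewrite !mxE; apply/eqP; rewrite -subr_eq0; apply/eqP.
  apply: (b_free (fun j => \sum_l X i l * Y l j - (i == j)%:R)).
  under eq_bigr do rewrite scalerBl; rewrite sumrB -comb -XE (bigD1 i)//= eqxx scale1r big1 ?addr0 ?subrr// => l li.
  by rewrite eq_sym (negbTE li) scale0r.
have YX := mulmx1C XY; move=> a; pose r := \row_i c i.
have rY : r *m Y = 0.
  apply/rowP => j; rewrite !mxE; move: c0; rewrite comb => /b_free/(_ j); apply: etrans.
  by apply: eq_bigr => i _; rewrite mxE.
have : r *m Y *m X = 0 by rewrite rY mul0mx.
by rewrite -mulmxA YX mulmx1 => /rowP/(_ a); rewrite !mxE.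
Qed.

(** * Translation of the hypotheses on the Poincare map into properties of the fields *)

Theorem theorem6p4 (R : realType) (m k : nat) (S : lagrangian_system R m)
  (B : second_variation S)
  (P : phase S -> phase S) (hP : poincare_map B P)
  (N V : set (phase S)) (hN : N = kerPI2 P) (hV : V = kerPI P)
  (N_symplectic : symplectic_subspace N) (dimV : has_dim V k)
  (V_lagrangian : lagrangian_in N V)
  (w : 'I_k -> phase S) (w_basis : is_basis V w)
  (zeta : 'I_k -> field S) (zeta_sol : forall a, solution B (zeta a))
  (zeta_init : forall a, phase_at B (zeta a) 0 = w a)
  (dimF : forall t, has_dim (Fspace zeta t) k)
  (K : set (phase S)) (K_lagrangian : lagrangian_in N K)
  (K_complement : direct_sum N V K)
  (q : 'I_k -> phase S) (q_basis : is_basis K q)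
  (q_dual : forall a b, omega (w a) (q b) = (a == b)%:R)
  (q_isotropic : forall a b, omega (q a) (q b) = 0)
  (eta : 'I_k -> field S) (eta_sol : forall a, solution B (eta a))
  (eta_init : forall a, phase_at B (eta a) 0 = q a)
  (s : 'M[R]_k) (hs : forall a, P (q a) = q a + \sum_b s a b *: w b)
  (det_aperp : \det (aperp_mx zeta s) != 0) :
  let etaperp := fun a => Pi zeta (eta a) in
  let etahat := fun a => Phi B zeta (etaperp a) in
  let Omegaperp := spanned etaperp in
  let Omegahat := spanned etahat in
  [/\ (* a *)
      direct_sum (Yhat B zeta) Omegahat (Y0hat B zeta) /\
      direct_sum (Xperp zeta) Omegaperp (Pi zeta @` Y0space B zeta),
      (* b *)
      linear_iso Omegahat Omegaperp (Pihat zeta) /\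
      linear_iso (Y0hat B zeta) (X0perp B zeta) (Pihat zeta),
      (* c *)
      (forall xi xi', Y0space B zeta xi -> Y0space B zeta xi' ->
         h B xi xi' = hperp B zeta (Pi zeta xi) (Pi zeta xi')) /\
      (forall x x', Y0hat B zeta x -> Y0hat B zeta x' ->
         hhat B zeta x x' = hperp B zeta (Pihat zeta x) (Pihat zeta x')),
      (* d *)
      (forall xi a, Y0space B zeta xi ->
         hhat B zeta (etahat a) (qclass zeta xi) = 0) /\
      (forall a b, hhat B zeta (etahat a) (etahat b) = a_mx zeta s a b)
    & (* e *)
      (forall xi a, (Pi zeta @` Y0space B zeta) xi ->
         hperp B zeta (etaperp a) xi = 0) /\
      (forall a b, hperp B zeta (etaperp a) (etaperp b) = aperp_mx zeta s a b)].
Proof.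
have zeta_free t : lin_indep (fun a => zeta a t) by exact: (spanning_lin_indep (dimF t)).
have Vw a : V (w a).
  rewrite w_basis.2; exists (fun b => (a == b)%:R).
  rewrite (bigD1 a)//= eqxx scale1r big1 ?addr0// => b ba.
  by rewrite eq_sym (negbTE ba) scale0r.
have Pw a : P (w a) = w a.
  by have := Vw a; rewrite hV => -[_ /eqP]; rewrite subr_eq0 => /eqP.
have shift_phase xi : phase_at B (fun t => xi (t + tau S)) 0 = phase_at B xi (tau S).
  by rewrite /phase_at (D_shift B) add0r.
(* A fixed point of [P] is the initial phase of a periodic solution, by uniqueness. *)
have zeta_per a t : zeta a (t + tau S) = zeta a t.
  have E : (fun r => zeta a (r + tau S)) = zeta a.
    apply: (solution_eq (solution_shift (zeta_sol a)) (zeta_sol a)).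
    by rewrite shift_phase -hP// zeta_init Pw.
  exact (congr1 (fun f : field S => f t) E).
(* On solutions [I] is conserved, and at time 0 it is the symplectic product with [w a]. *)
have I_omega a xi t : solution B xi -> I_dot B zeta a xi t = omega (w a) (phase_at B xi 0).
  move=> sx; rewrite (solution_I_dot zeta_sol a t 0 sx) -zeta_init /omega /=.
  have zt : tangent (gamma S 0) (zeta a 0) by have H := solution_along (zeta_sol a); exact: (H 0).
  have xt : tangent (gamma S 0) (xi 0) by have H := solution_along sx; exact: (H 0).
  have zdt : tangent (gamma S 0) (D B (zeta a) 0) by have H := solution_along_D (zeta_sol a); exact: (H 0).
  have xdt : tangent (gamma S 0) (D B xi 0) by have H := solution_along_D sx; exact: (H 0).
  by rewrite (metricE zt xdt) (metricE xt zdt).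
(* The left side minus the right is [omega (w a) (w b)], which vanishes because V is Lagrangian in
   N. *)
have zeta_iso a b t : dot t (zeta a t) (D B (zeta b) t) = dot t (zeta b t) (D B (zeta a) t).
  apply/eqP; rewrite -subr_eq0; apply/eqP; rewrite -/(I_dot B zeta a (zeta b) t).
  rewrite (I_omega a _ t (zeta_sol b)) zeta_init.
  by have := Vw a; rewrite {1}V_lagrangian => -[_ ->].
(* Both sides solve the variational system, and [hs] says that their phases at time 0 coincide. *)
have eta_per a t : eta a (t + tau S) = eta a t + \sum_b s a b *: zeta b t.
  have ss : solution B (\sum_b s a b *: zeta b) by apply: solution_sum => b; exact: solutionZ.
  have sumE r : (\sum_b s a b *: zeta b) r = \sum_b s a b *: zeta b r by rewrite fct_sumE.
  have E : (fun r => eta a (r + tau S)) = eta a + \sum_b s a b *: zeta b.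
    apply: (solution_eq (solution_shift (eta_sol a)) (solutionD (eta_sol a) ss)).
    rewrite shift_phase -hP// eta_init hs.
    have zd b : field_derivable (s a b *: zeta b) 0.
      by apply: field_derivableZ; exact: (@solution_derivable _ _ _ B _ 0 (zeta_sol b)).
    have [sd sE] := @D_sum _ _ _ B _ (fun b => s a b *: zeta b) 0 zd.
    have DE b : D B (s a b *: zeta b) 0 = s a b *: D B (zeta b) 0.
      exact: (D_Z B (s a b) (zeta_along zeta_sol b) (@solution_derivable _ _ _ B _ 0 (zeta_sol b))).
    have -> : \sum_b s a b *: w b = (\sum_b s a b *: zeta b 0, \sum_b s a b *: D B (zeta b) 0).
      elim: (index_enum 'I_k) => [|b r ih]; first by rewrite !big_nil.
      by rewrite !big_cons ih -zeta_init.
    rewrite -eta_init; apply: (congr2 pair); last first.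
      rewrite (D_D B (@solution_derivable _ _ _ B _ 0 (eta_sol a)) sd) sE.
      by congr (_ + _); apply: eq_bigr => b _; rewrite DE.
    change (eta a 0 + \sum_b s a b *: zeta b 0 = eta a 0 + (\sum_b s a b *: zeta b) 0).
    by rewrite sumE.
  rewrite -sumE; exact (congr1 (fun f : field S => f t) E).
have eta_dual a b t : I_dot B zeta b (eta a) t = (b == a)%:R.
  by rewrite (I_omega b _ t (eta_sol a)) eta_init q_dual.
move=> etaperp etahat Omegaperp Omegahat; split.
- split.
    exact: (direct_sum_Yhat zeta_sol zeta_free zeta_iso zeta_per eta_sol eta_per eta_dual det_aperp).
  exact: (direct_sum_Xperp zeta_sol zeta_free zeta_iso zeta_per eta_sol eta_per eta_dual det_aperp).
- split.
    exact: (Pihat_iso_etahat zeta_sol zeta_free zeta_iso zeta_per eta_sol eta_per).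
  exact: (Pihat_iso_Y0hat zeta_sol zeta_free zeta_iso zeta_per).
- split=> [xi xi' x0 x0'|x x' x0 x0'].
    exact (h_Y0 zeta_sol zeta_free zeta_iso zeta_per x0 x0').
  exact (h_Y0 zeta_sol zeta_free zeta_iso zeta_per
    (Y0hat_qrepr zeta_sol zeta_iso zeta_per x0) (Y0hat_qrepr zeta_sol zeta_iso zeta_per x0')).
- split=> [xi a x0|a b]; last first.
    exact (h_etalift_amx zeta_sol zeta_free zeta_iso zeta_per eta_sol eta_per eta_dual a b).
  (* [hhat] uses the representative picked by [qrepr] in place of [xi]; its constants are still
     0. *)
  have x0' : Y0hat B zeta (qclass zeta xi) by exists xi.
  apply: (etrans (h_etalift zeta_sol zeta_free zeta_iso zeta_per eta_sol eta_per a
    (Y0hat_qrepr zeta_sol zeta_iso zeta_per x0'))).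
  by rewrite big1 ?oppr0// => b _; rewrite mulr0.
- split=> [_ a [xi x0 <-]|a b].
    exact (hperp_eta_Y0 zeta_sol zeta_free zeta_iso zeta_per eta_sol eta_per a x0).
  exact (hperp_eta zeta_sol zeta_free zeta_iso zeta_per eta_sol eta_per eta_dual a b).
Qed.
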